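(* Let $0<\rho_-<\rho_+<1$ and consider the LPP model with independent weights $\omega_{0,0}=0$, $\omega_{i,j}$ exponential with rate $1$ for $i,j>0$, with rate $\rho_-$ for $i=0,j\ge1$, and with rate $1-\rho_+$ for $j=0,i\ge1$. Let $(I_n,J_n)_{n\ge1}$ be the competition interface of this model (defined in the context). Let $\eta=\frac{(1-\rho_+)(1-\rho_-)}{\rho_-\rho_+}$, $v_+=\frac{1}{\rho_-^2}-\frac{\eta}{(1-\rho_-)^2}$, $v_-=\frac{\eta}{(1-\rho_+)^2}-\frac{1}{\rho_+^2}$, $m_+=1/(1-\rho_-)$, $m_-=1/(1-\rho_+)$. Then for every $u\in\mathbb{R}$, $$\lim_{t\to\infty}\mathbb{P}\left(I_{\lfloor t\rfloor}-J_{\lfloor t\rfloor}\le -t\frac{1-\eta}{1+\eta}+\frac{2ut^{1/2}}{(1+\eta)^{3/2}}\right)=\int_{u(m_+-m_-)}^\infty \frac{e^{-\frac{x^2}{2(v_-+v_+)}}}{\sqrt{2\pi(v_-+v_+)}}\,\mathrm{d}x.$$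
   Context: An up-right path is a sequence of points of $\mathbb{Z}^2$ with increments in $\{(1,0),(0,1)\}$. For $z=(i,j)$ with $i,j\ge1$, let $L^+(z)$ (resp. $L^-(z)$) be the maximum, over up-right paths $\pi=(\pi(0),\dots,\pi(n))$ from $\pi(0)=(0,0)$ to $z$ with $\pi(1)=(0,1)$ (resp. $\pi(1)=(1,0)$), of $\sum_{(a,b)\in\pi\setminus\{(0,0)\}}\omega_{a,b}$. Let $\Gamma_+^\infty=\{z:L^+(z)>L^-(z)\}$, $\Gamma_-^\infty=\{z:L^-(z)>L^+(z)\}$ (a.s. every $z$ with positive coordinates lies in exactly one). Competition interface: $\phi_0=(0,0)$, $\phi_{n+1}=\phi_n+(1,0)$ if $\phi_n+(1,1)\in\Gamma_+^\infty$ and $\phi_{n+1}=\phi_n+(0,1)$ if $\phi_n+(1,1)\in\Gamma_-^\infty$; $\phi_n=(I_n,J_n)$. *)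

(* Defs.v *)
From HB Require Import structures.
From mathcomp Require Import all_boot all_order all_algebra.
From mathcomp Require Import all_classical all_reals all_analysis.
Set Implicit Arguments. Unset Strict Implicit. Unset Printing Implicit Defensive.
Import Order.TTheory GRing.Theory Num.Theory.
Import numFieldNormedType.Exports.
Local Open Scope classical_set_scope.
Local Open Scope ring_scope.

Definition mutually_independent {d} {T : measurableType d} {R : realType}
  (P : probability T R) (I : eqType) (X : I -> {RV P >-> R}) : Prop :=
  forall (J : seq I) (B : I -> set R), uniq J -> (forall i, measurable (B i)) ->
    P (\bigcap_(i in [set` J]) (X i @^-1` B i)) =
    (\prod_(i <- J) P (X i @^-1` B i))%E.

Definition has_exp_law {d} {T : measurableType d} {R : realType}
  (P : probability T R) (X : {RV P >-> R}) (r : R) : Prop :=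
  forall A : set R, measurable A -> distribution P X A = exponential_prob r A.

(* Up-right paths from (0,0) encoded by their sequence of steps:
   true = (0,1) (up), false = (1,0) (right).
   pos s k = the point reached after the first k steps. *)
Definition pos (s : seq bool) (k : nat) : nat * nat :=
  (count negb (take k s), count id (take k s)).

Definition path_weight {R : realType} (w : nat -> nat -> R) (s : seq bool) : R :=
  \sum_(1 <= k < (size s).+1) w (pos s k).1 (pos s k).2.

Definition Lplus {R : realType} (w : nat -> nat -> R) (i j : nat) : \bar R :=
  \big[Order.max/-oo%E]_(s : (i + j).-tuple bool |
       (count id s == j) && (nth false s 0 == true)) (path_weight w s)%:E.

Definition Lminus {R : realType} (w : nat -> nat -> R) (i j : nat) : \bar R :=
  \big[Order.max/-oo%E]_(s : (i + j).-tuple bool |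
       (count id s == j) && (nth false s 0 == false)) (path_weight w s)%:E.

(* Competition interface phi_n = (I_n, J_n).  phi_{n+1} = phi_n + (1,0) if
   phi_n + (1,1) is in Gamma_+ (L^+ > L^-), and phi_n + (0,1) otherwise
   (ties have probability zero). *)
Fixpoint comp_interface {R : realType} (w : nat -> nat -> R) (n : nat) : nat * nat :=
  match n with
  | 0 => (0, 0)
  | n'.+1 => let z := comp_interface w n' in
      if (Lminus w z.1.+1 z.2.+1 < Lplus w z.1.+1 z.2.+1)%E
      then (z.1.+1, z.2) else (z.1, z.2.+1)
  end.

(* Main.v *)
(* By monotonicity of increments, {I_n <= k} is the event L^+ <= L^- at the point
   (k+1, n-k), so the theorem is a central limit theorem for L^+ - L^- along the
   line through the origin of slope 1/eta.

   Scaling the weights of the horizontal (resp. vertical) axis turns the model into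
   the stationary one of parameter rho_- (resp. rho_+) without changing L^+
   (resp. L^-).  The point lies strictly above the characteristic direction of the
   first stationary model and strictly below that of the second, so that with high
   probability the geodesics leave along the expected axis and L^+, L^- equal the
   stationary passage times.  By Burke's property a stationary passage time is the
   sum of the weights of an initial stretch of the axis plus a stationary passage
   time from the end of that stretch; when the stretch reaches almost to the
   characteristic through the endpoint, the variance of the second term is at most
   epsilon n.  Hence L^+ - L^- is a constant plus the difference of two independent
   sums of independent centered exponential variables, up to a negligible error.

   The central limit theorem for that difference is Lindeberg's: a Gaussian
   distribution function evolves by the heat equation, so each summand can be
   traded for its variance in the time variable. *)
Require Import Defs.
From HB Require Import structures.
From mathcomp Require Import all_boot all_order all_algebra.
From mathcomp Require Import all_classical all_reals all_analysis.
From mathcomp Require Import measurable_realfun lra ring zify.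
Set Implicit Arguments. Unset Strict Implicit. Unset Printing Implicit Defensive.
Import Order.TTheory GRing.Theory Num.Theory.
Import numFieldNormedType.Exports.
Local Open Scope classical_set_scope.
Local Open Scope ring_scope.

(** * Last passage times and the competition interface *)

Section LastPassage.
Context {R : realType}.
Implicit Type w : nat -> nat -> R.

(** Variance and exit point control each other. By Burke's property the variance of a stationary
    passage time is the gap [n/rho^2 - m/(1-rho)^2] plus twice its covariance with the sum along the
    horizontal axis. A passage time forced to start upwards does not see that axis, so only the rare
    event of a horizontal exit contributes to the covariance. That event is bounded by Markov's
    inequality for fourth powers, which need only Burke's property again; hence the covariance is
    O(1). The bound requires a gap of at least [kappa * N], with a constant depending on [kappa].
    The remaining variance is therefore [epsilon * n] for a fixed epsilon, and n goes to infinity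
    only after epsilon and the smoothing width are chosen. Constants are uniform over probability
    spaces and environments, because each use of Burke's property replaces the environment by
    another one. The Gaussian distribution function at a small time also serves as the smoothed
    indicator of a half line, so probabilities are compared directly. Passage times are monotone and
    nonnegative only for nonnegative weights; weights are replaced by their absolute values, which
    almost surely changes nothing. *)

Fixpoint lpp w (i : nat) {struct i} : nat -> R :=
  match i with
  | 0 => fun j => \sum_(1 <= k < j.+1) w 0 k
  | i'.+1 => fix row (j : nat) : R :=
      match j with
      | 0 => lpp w i' 0 + w i'.+1 0
      | j'.+1 => Num.max (lpp w i' j'.+1) (row j') + w i'.+1 j'.+1
      end
  end.

(** This moves the origin to (0,1). [lpp] never counts the weight at its origin, which is why [Lup]
    adds [w 0 1] by hand. *)
Definition shift_up w : nat -> nat -> R := fun i j => w i j.+1.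
Definition transpose w : nat -> nat -> R := fun i j => w j i.

Lemma lpp0l w j : lpp w 0 j = \sum_(1 <= k < j.+1) w 0 k.
Proof. by []. Qed.

Lemma lpp00 w : lpp w 0 0 = 0.
Proof. by rewrite lpp0l big_geq. Qed.

Lemma lpp0S w j : lpp w 0 j.+1 = lpp w 0 j + w 0 j.+1.
Proof. by rewrite !lpp0l [in LHS]big_nat_recr. Qed.

Lemma lppS0 w i : lpp w i.+1 0 = lpp w i 0 + w i.+1 0.
Proof. by []. Qed.

Lemma lppSS w i j :
  lpp w i.+1 j.+1 = Num.max (lpp w i j.+1) (lpp w i.+1 j) + w i.+1 j.+1.
Proof. by []. Qed.

Lemma lppl0 w i : lpp w i 0 = \sum_(1 <= k < i.+1) w k 0.
Proof.
elim: i => [|i ih]; first by rewrite lpp00 big_geq.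
by rewrite lppS0 ih [RHS]big_nat_recr.
Qed.

Local Arguments lpp : simpl never.

Lemma lpp_transpose w i j : lpp (transpose w) i j = lpp w j i.
Proof.
elim: i j => [j|i ihi]; first by rewrite lppl0 lpp0l.
elim=> [|j ihj]; first by rewrite lppS0 ihi lpp0S.
by rewrite !lppSS ihi ihj maxC.
Qed.

Lemma eq_lpp w w' m n :
  (forall i j, (i <= m)%N -> (j <= n)%N -> (i, j) != (0, 0)%N -> w i j = w' i j) ->
  lpp w m n = lpp w' m n.
Proof.
elim: m n => [|m ihm] n h.
  rewrite !lpp0l; apply: eq_big_nat => k /andP[k1 kn].
  by apply: h => //; case: k k1 kn.
elim: n h => [|n ihn] h.
  by rewrite !lppS0 ihm ?h// => i j im jn; apply: h => //; exact: ltnW.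
rewrite !lppSS ihm ?ihn ?h//.
- by move=> i j im jn; apply: h => //; exact: ltnW.
- by move=> i j im jn; apply: h => //; exact: ltnW.
Qed.

Lemma le_lpp w w' m n :
  (forall i j, (i, j) != (0, 0)%N -> w i j <= w' i j) -> lpp w m n <= lpp w' m n.
Proof.
move=> h; elim: m n => [|m ihm] n.
  rewrite !lpp0l !big_nat; apply: ler_sum => k /andP[k1 kn].
  by apply: h => //; case: k k1 kn.
elim: n => [|n ihn]; first by rewrite !lppS0 lerD ?h.
by rewrite !lppSS lerD ?h// ge_max !le_max ihm ihn orbT.
Qed.

(* [Lup w i j] is L^+(i, j+1) and [Lright w i j] is L^-(i+1, j). *)
Definition Lup w i j := w 0 1 + lpp (shift_up w) i j.
Definition Lright w i j := Lup (transpose w) j i.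

Lemma Lup_sum w j : Lup w 0 j = \sum_(1 <= k < j.+2) w 0 k.
Proof.
by rewrite big_nat_recl// /Lup lpp0l /shift_up [in RHS]big_add1.
Qed.

Lemma Lrightl0 w i : Lright w i 0 = \sum_(1 <= k < i.+2) w k 0.
Proof. by rewrite /Lright Lup_sum. Qed.

Lemma LupS0 w i : Lup w i.+1 0 = Lup w i 0 + w i.+1 1.
Proof. by rewrite /Lup lppS0 addrA. Qed.

Lemma LupSS w i j :
  Lup w i.+1 j.+1 = Num.max (Lup w i j.+1) (Lup w i.+1 j) + w i.+1 j.+2.
Proof. by rewrite /Lup lppSS -addr_maxr addrA. Qed.

Lemma Lright0S w j : Lright w 0 j.+1 = Lright w 0 j + w 1 j.+1.
Proof. by rewrite /Lright LupS0. Qed.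

Lemma LrightSS w i j :
  Lright w i.+1 j.+1 = Num.max (Lright w i j.+1) (Lright w i.+1 j) + w i.+2 j.+1.
Proof. by rewrite /Lright LupSS maxC. Qed.

(** The maximum of two solutions of the recursion for [lpp] is again a solution, so only the
    boundary rows need a separate check. *)
Lemma lpp_max_first_step w i j :
  lpp w i.+1 j.+1 = Num.max (Lup w i.+1 j) (Lright w i j.+1).
Proof.
elim: i j => [|i ihi]; elim=> [|j ihj].
- rewrite lppSS lpp0S lppS0 !lpp00 LupS0 Lright0S /Lright /Lup !lpp00 !add0r !addr0.
  by rewrite /transpose addr_maxl.
- rewrite lppSS ihj LupSS (Lright0S w j.+1) Lup_sum -lpp0l.
  by rewrite -[in RHS]addr_maxl maxA.
- rewrite lppSS ihi (LupS0 w i.+1) LrightSS Lrightl0 -lppl0.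
  by rewrite -addr_maxl maxA.
- rewrite lppSS ihi ihj (LupSS w i.+1) (LrightSS w i j.+1) -addr_maxl; congr (_ + _).
  by rewrite -!maxA; congr Num.max; rewrite maxCA.
Qed.

Lemma Lup_le_lpp w i j : Lup w i j <= lpp w i j.+1.
Proof.
case: i => [|i]; first by rewrite Lup_sum lpp0l.
by rewrite lpp_max_first_step le_max lexx.
Qed.

Lemma Lright_le_lpp w i j : Lright w i j <= lpp w i.+1 j.
Proof. by rewrite /Lright -lpp_transpose Lup_le_lpp. Qed.

(* The recursion makes an order between the increments of two last passage
   times propagate from the bottom left corner of a cell to its top right. *)
Lemma Lup_Lright_increments w i j :
  (Lup w i.+2 j - Lup w i.+1 j <= Lright w i.+1 j.+1 - Lright w i j.+1) /\
  (Lright w i j.+2 - Lright w i j.+1 <= Lup w i.+1 j.+1 - Lup w i.+1 j).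
Proof.
(* On row 1 a path that starts upwards has no choice left, so its increment is a single weight,
   whereas the other increment is that weight plus a nonnegative term. The column is symmetric. *)
have hrow i' : Lup w i'.+2 0 - Lup w i'.+1 0 <= Lright w i'.+1 1 - Lright w i' 1.
  rewrite LupS0 addrAC subrr add0r LrightSS addrAC lerDr subr_ge0.
  by rewrite le_max lexx.
have hcol j' : Lright w 0 j'.+2 - Lright w 0 j'.+1 <= Lup w 1 j'.+1 - Lup w 1 j'.
  rewrite Lright0S addrAC subrr add0r LupSS addrAC lerDr subr_ge0.
  by rewrite le_max lexx orbT.
have cell i' j' :
    (Lup w i'.+2 j' - Lup w i'.+1 j' <= Lright w i'.+1 j'.+1 - Lright w i' j'.+1) ->
    (Lright w i' j'.+2 - Lright w i' j'.+1 <= Lup w i'.+1 j'.+1 - Lup w i'.+1 j') ->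
  (Lup w i'.+2 j'.+1 - Lup w i'.+1 j'.+1 <= Lright w i'.+1 j'.+2 - Lright w i' j'.+2) /\
  (Lright w i'.+1 j'.+2 - Lright w i'.+1 j'.+1 <= Lup w i'.+2 j'.+1 - Lup w i'.+2 j').
  rewrite (LupSS w i'.+1) (LrightSS w i' j'.+1).
  move: (Lup w i'.+2 j') (Lup w i'.+1 j') (Lup w i'.+1 j'.+1) => a b c.
  move: (Lright w i' j'.+1) (Lright w i' j'.+2) (Lright w i'.+1 j'.+1) => e f g.
  rewrite !maxEle; case: ifPn => h1; case: ifPn => h2 h3 h4;
    rewrite -?ltNge in h1 h2 *; lra.
elim: i j => [|i ihi]; elim=> [|j [ihj1 ihj2]].
- by split.
- by split => //; have [] := cell 0 j ihj1 (hcol j).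
- split => //; have [h1 h2] := ihi 0; by have [] := cell i 0 h1 h2.
- split; first by have [] := cell i.+1 j ihj1 ihj2.
  by have [h1 h2] := ihi j.+1; have [] := cell i j.+1 h1 h2.
Qed.

(** Membership of (i+1, j+1), not of (i, j), in the cluster of L^+: the indices are those of the
    interface position that performs the test. *)
Definition in_upper w i j := Lright w i j.+1 < Lup w i.+1 j.

Lemma in_upper_left w i j : in_upper w i.+1 j -> in_upper w i j.
Proof. rewrite /in_upper => h; have [h1 _] := Lup_Lright_increments w i j; lra. Qed.

Lemma in_upper_up w i j : in_upper w i j -> in_upper w i j.+1.
Proof. rewrite /in_upper => h; have [_ h1] := Lup_Lright_increments w i j; lra. Qed.

Lemma in_upper_mono w i i' j j' :
  (i' <= i)%N -> (j <= j')%N -> in_upper w i j -> in_upper w i' j'.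
Proof.
move=> ii' jj' h.
have {}h : in_upper w i' j.
  move: h; rewrite -(subnK ii'); elim: (i - i')%N => // k ih.
  by rewrite addSn => /in_upper_left.
rewrite -(subnK jj'); elim: (j' - j)%N => // k ih.
by rewrite addSn; exact: in_upper_up.
Qed.

End LastPassage.
Arguments lpp : simpl never.

(** * Agreement of the recursions with the maxima over paths *)

Section Paths.
Context {R : realType}.
Implicit Type w : nat -> nat -> R.

Lemma path_weight_rcons w s b : path_weight w (rcons s b) =
  path_weight w s + w (count negb (rcons s b)) (count id (rcons s b)).
Proof.
rewrite /path_weight size_rcons big_nat_recr//=; congr (_ + _).
  apply: eq_big_nat => k /andP[_ ks].
  by rewrite /pos -cats1 takel_cat.
by rewrite /pos -(size_rcons s b) take_size.
Qed.

Lemma path_weight_le_lpp w s :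
  path_weight w s <= lpp w (count negb s) (count id s).
Proof.
elim/last_ind: s => [|s b ih]; first by rewrite /path_weight/= big_geq// lpp00.
rewrite path_weight_rcons -cats1 !count_cat /=.
case: b => /=; rewrite ?addn0 ?addn1; move: ih;
  move: (count negb s) (count id s) => i j ih.
  case: i ih => [|i] ih; first by rewrite lpp0S lerD2r.
  by rewrite lppSS lerD2r le_max ih orbT.
case: j ih => [|j] ih; first by rewrite lppS0 lerD2r.
by rewrite lppSS lerD2r le_max ih.
Qed.

Lemma lpp_path w i j : exists s : seq bool,
  [/\ count negb s = i, count id s = j & path_weight w s = lpp w i j].
Proof.
have step s b i' j' : count negb (rcons s b) = i' -> count id (rcons s b) = j' ->
    path_weight w (rcons s b) = path_weight w s + w i' j'.
  by move=> <- <-; rewrite path_weight_rcons.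
have ct s : count negb (rcons s true) = count negb s /\
            count id (rcons s true) = (count id s).+1.
  by rewrite -cats1 !count_cat/= !addn0 addn1.
have cf s : count negb (rcons s false) = (count negb s).+1 /\
            count id (rcons s false) = count id s.
  by rewrite -cats1 !count_cat/= !addn0 addn1.
elim: i j => [|i ihi]; elim=> [|j].
- by exists [::]; rewrite lpp00 /path_weight/= big_geq.
- move=> [s [s1 s2 s3]]; exists (rcons s true); have [c1 c2] := ct s.
  rewrite c1 c2 s1 s2; split=> //.
  by rewrite (step _ _ 0%N j.+1) ?c1 ?c2 ?s1 ?s2// s3 lpp0S.
- have [s [s1 s2 s3]] := ihi 0%N; exists (rcons s false); have [c1 c2] := cf s.
  rewrite c1 c2 s1 s2; split=> //.
  by rewrite (step _ _ i.+1 0%N) ?c1 ?c2 ?s1 ?s2// s3 lppS0.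
- move=> [t [t1 t2 t3]]; have [s [s1 s2 s3]] := ihi j.+1.
  rewrite lppSS maxEle; case: ifPn => _.
    exists (rcons t true); have [c1 c2] := ct t.
    rewrite c1 c2 t1 t2; split=> //.
    by rewrite (step _ _ i.+1 j.+1) ?c1 ?c2 ?t1 ?t2// t3.
  exists (rcons s false); have [c1 c2] := cf s.
  rewrite c1 c2 s1 s2; split=> //.
  by rewrite (step _ _ i.+1 j.+1) ?c1 ?c2 ?s1 ?s2// s3.
Qed.

Lemma path_weight_up w s :
  path_weight w (true :: s) = w 0 1 + path_weight (shift_up w) s.
Proof.
by rewrite /path_weight /= big_nat_recl// /pos/= take0.
Qed.

(** Reflection in the diagonal exchanges the two kinds of steps, so a path starting to the right is
    a path starting upwards for the transposed weights. *)
Lemma path_weight_right w s :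
  path_weight w (false :: s) =
  w 1 0 + path_weight (shift_up (transpose w)) (map negb s).
Proof.
rewrite /path_weight /= big_nat_recl// /pos/= take0 size_map; congr (_ + _).
apply: eq_bigr => k _.
rewrite -map_take !count_map /shift_up /transpose /= add1n add0n; congr (w _.+1 _).
by apply: eq_count => -[].
Qed.

Lemma count_negbS (s : seq bool) : count negb s = (size s - count id s)%N.
Proof.
rewrite -(count_predC id) addKn; exact: eq_count.
Qed.

Lemma LplusE w i j : Lplus w i j.+1 = (Lup w i j)%:E.
Proof.
apply/eqP; rewrite eq_le; apply/andP; split.
  apply/bigmax_leP; split => [|/= s /andP[/eqP sj /eqP s0]]; first exact: leNye.
  have ss : size s = (i + j.+1)%N by rewrite size_tuple.
  case: (tval s) ss sj s0 => [|[] s'] //= ss sj _; rewrite path_weight_up /Lup.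
  rewrite lee_fin lerD2l (le_trans (path_weight_le_lpp _ _))//.
  have -> : count id s' = j by lia.
  by rewrite count_negbS; have -> : (size s' - count id s' = i)%N by lia.
have [s [s1 s2 s3]] := lpp_path (shift_up w) i j.
have sz : size (true :: s) == (i + j.+1)%N.
  by rewrite /= addnS -s1 -s2 -(count_predC id s) addnC eqSS.
rewrite /Lup -s3 -path_weight_up.
apply: (@le_bigmax_cond _ _ _ -oo%E (Tuple sz)
  (fun s : (i + j.+1).-tuple bool => (count id s == j.+1) && (nth false s 0 == true))
  (fun s : (i + j.+1).-tuple bool => (path_weight w s)%:E)).
by rewrite /= s2 add1n !eqxx.
Qed.

Lemma LminusE w i j : Lminus w i.+1 j = (Lright w i j)%:E.
Proof.
apply/eqP; rewrite eq_le; apply/andP; split.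
  apply/bigmax_leP; split => [|/= s /andP[/eqP sj /eqP s0]]; first exact: leNye.
  have ss : size s = (i.+1 + j)%N by rewrite size_tuple.
  case: (tval s) ss sj s0 => [|[] s'] //=.
  move=> ss sj _; rewrite path_weight_right /Lright /Lup.
  rewrite lee_fin lerD2l (le_trans (path_weight_le_lpp _ _))//.
  have e1 : count id (map negb s') = i.
    by rewrite count_map (eq_count (a2 := negb))// count_negbS; lia.
  rewrite e1 count_negbS e1 size_map.
  by have -> : (size s' - i = j)%N by lia.
have [s [s1 s2 s3]] := lpp_path (shift_up (transpose w)) j i.
have c1 : count id (map negb s) = j by rewrite count_map -s1; exact: eq_count.
have sz : size (false :: map negb s) == (i.+1 + j)%N.
  by rewrite /= size_map addSn -s1 -s2 -(count_predC id s) eqSS.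
have wE : path_weight w (false :: map negb s) = Lright w i j.
  rewrite path_weight_right /Lright /Lup -s3 -map_comp; congr (_ + path_weight _ _).
  by rewrite -[RHS]map_id; apply: eq_map => -[].
rewrite -wE.
apply: (@le_bigmax_cond _ _ _ -oo%E (Tuple sz)
  (fun s : (i.+1 + j).-tuple bool => (count id s == j) && (nth false s 0 == false))
  (fun s : (i.+1 + j).-tuple bool => (path_weight w s)%:E)).
by rewrite /= c1 !eqxx.
Qed.

Lemma comp_interfaceS w n : comp_interface w n.+1 =
  let z := comp_interface w n in
  if in_upper w z.1 z.2 then (z.1.+1, z.2) else (z.1, z.2.+1).
Proof.
rewrite /=; move: (comp_interface w n) => [i j] /=.
by rewrite LplusE LminusE lte_fin.
Qed.

Lemma comp_interface_sum w n :
  ((comp_interface w n).1 + (comp_interface w n).2 = n)%N.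
Proof.
elim: n => // n; rewrite comp_interfaceS; move: (comp_interface w n) => [i j] /=.
by case: ifP => _ <- /=; rewrite ?addSn ?addnS.
Qed.

(* The interface keeps the squares on its upper left in the cluster of L^+ and
   those on its lower right outside. *)
Lemma comp_interface_separates w n :
  (forall i j, (i < (comp_interface w n).1)%N -> ((comp_interface w n).2 <= j)%N ->
     in_upper w i j) /\
  (forall i j, ((comp_interface w n).1 <= i)%N -> (j < (comp_interface w n).2)%N ->
     ~~ in_upper w i j).
Proof.
elim: n => [|n]; first by split.
rewrite comp_interfaceS; move: (comp_interface w n) => [a b] /= [h1 h2].
case: ifPn => h /=; split => i j ai bj.
- by apply: in_upper_mono h; [rewrite -ltnS|].
- by apply: h2 => //; exact: ltnW.
- by apply: h1 => //; exact: ltnW.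
- by apply: contra h; apply: in_upper_mono; rewrite // -ltnS.
Qed.

(** Since I_n + J_n = n, the cell (k, n-k-1) lies on the lower right of the interface exactly when
    I_n <= k and on its upper left otherwise, so the separation property decides the event in both
    directions. *)
Lemma comp_interface_le w n k : (k < n)%N ->
  ((comp_interface w n).1 <= k)%N =
  (Lup w k.+1 (n - k.+1) <= Lright w k (n - k.+1).+1).
Proof.
move=> kn; rewrite leNgt -/(in_upper w k (n - k.+1)).
have := comp_interface_sum w n; have := comp_interface_separates w n.
move: (comp_interface w n) => [a b] /= [h1 h2] abn.
case: leqP => h; apply/esym; first by apply: h2; lia.
by apply/negbTE; rewrite negbK; apply: h1; lia.
Qed.

End Paths.

(** * Independent families *)

Section MeasureUniqueness.
Local Open Scope ereal_scope.

Lemma finite_measure_rect_unique d1 d2 (T1 : measurableType d1)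
    (T2 : measurableType d2) (R : realType)
    (m1 m2 : {measure set (T1 * T2) -> \bar R}) :
  m1 setT < +oo ->
  (forall A B, measurable A -> measurable B -> m1 (A `*` B) = m2 (A `*` B)) ->
  forall C, measurable C -> m1 C = m2 C.
Proof.
move=> m1oo h C mC.
apply: (measure_unique [set A `*` B | A in @measurable _ T1 & B in @measurable _ T2]
  (fun=> setT)) => //.
- by rewrite measurable_prod_measurableType.
- move=> _ _ [A mA [B mB <-]] [A' mA' [B' mB' <-]].
  exists (A `&` A'); first exact: measurableI.
  by exists (B `&` B'); [exact: measurableI|rewrite setXI].
- by move=> _; exists setT => //; exists setT => //; rewrite setXTT.
- by rewrite bigcup_const//; exists 0%N.
- by move=> _ [A mA [B mB <-]]; exact: h.
Qed.

Import HBNNSimple.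

Lemma ge0_integral_density d (T : measurableType d) (R : realType)
    (mu nu : {measure set T -> \bar R}) (h : T -> R) :
  measurable_fun setT h -> (forall x, 0 <= h x)%R ->
  (forall A, measurable A -> nu A = \int[mu]_(x in A) (h x)%:E) ->
  forall f : T -> \bar R, measurable_fun setT f -> (forall x, 0 <= f x) ->
  \int[nu]_x f x = \int[mu]_x (f x * (h x)%:E).
Proof.
move=> mh h0 nuE f mf f0.
have key (E : set T) : measurable E ->
    \int[nu]_x (\1_E x)%:E = \int[mu]_x ((\1_E x)%:E * (h x)%:E).
  move=> mE; rewrite integral_indic// setIT nuE// integral_mkcond.
  apply: eq_integral => x _; rewrite patchE indicE.
  by case: ifPn => _; rewrite ?mul1e ?mul0e.
pose f_ := nnsfun_approx measurableT mf.
transitivity (limn (fun n => \int[nu]_x (f_ n x)%:E)).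
  rewrite -monotone_convergence//.
  - by apply: eq_integral => y _; apply/esym/cvg_lim => //; exact: cvg_nnsfun_approx.
  - by move=> n; exact/measurable_EFinP/measurable_funP.
  - by move=> n y _; rewrite lee_fin.
  - by move=> y _ m n mn; rewrite lee_fin; exact/lefP/nd_nnsfun_approx.
transitivity (limn (fun n => \int[mu]_x ((f_ n x)%:E * (h x)%:E))); last first.
  rewrite -monotone_convergence//.
  - apply: eq_integral => y _; apply/cvg_lim => //.
    by apply: cvgeZr => //; exact: cvg_nnsfun_approx.
  - move=> n; apply: emeasurable_funM; exact/measurable_EFinP.
  - by move=> n y _; rewrite mule_ge0// lee_fin.
  - move=> y _ m n mn; rewrite lee_wpmul2r ?lee_fin//.
    exact/lefP/nd_nnsfun_approx.
congr (limn _); apply/funext => n.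
have mh' : measurable_fun setT (EFin \o h) by exact/measurable_EFinP.
under eq_integral do rewrite fimfunE -fsumEFin//.
rewrite ge0_integral_fsum//; last 2 first.
- by move=> y; exact/measurable_EFinP/measurable_funM.
- by move=> y x _; rewrite nnfun_muleindic_ge0.
under [RHS]eq_integral do rewrite fimfunE -fsumEFin//.
transitivity (\int[mu]_x \sum_(k \in range (f_ n))
    ((k * \1_(f_ n @^-1` [set k]) x)%:E * (h x)%:E)); last first.
  apply: eq_integral => x _; rewrite ge0_mule_fsuml// => k.
  by rewrite nnfun_muleindic_ge0.
rewrite ge0_integral_fsum//; last 2 first.
- move=> y; apply: emeasurable_funM => //; exact/measurable_EFinP/measurable_funM.
- by move=> y x _; rewrite mule_ge0 ?nnfun_muleindic_ge0// lee_fin.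
apply: eq_fsbigr => r rr.
have r0 : (0 <= r)%R by move: rr; rewrite inE => -[x _ <-].
have mr : measurable (f_ n @^-1` [set r]) by [].
under eq_integral do rewrite EFinM.
under [RHS]eq_integral do rewrite EFinM -muleA.
rewrite !ge0_integralZl//.
- by rewrite key.
- apply: emeasurable_funM => //; exact/measurable_EFinP.
- by move=> x _; rewrite mule_ge0// lee_fin.
- exact/measurable_EFinP.
Qed.

End MeasureUniqueness.

Section ProductProbability.
Local Open Scope ereal_scope.
Context d1 d2 (T1 : measurableType d1) (T2 : measurableType d2) (R : realType).
Variables (m1 : probability T1 R) (m2 : probability T2 R).

Definition prod_prob : probability (T1 * T2)%type R :=
  lebesgue_integral_fubini_product_measure1__canonical__probability_measure_Probability m1 m2.

Lemma prod_probE A B : measurable A -> measurable B ->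
  prod_prob (A `*` B) = m1 A * m2 B.
Proof. exact: product_measure1E. Qed.

Lemma integral_prod_prob (f : T1 * T2 -> \bar R) :
  measurable_fun setT f -> (forall z, 0 <= f z) ->
  \int[prod_prob]_z f z = \int[m1]_x \int[m2]_y f (x, y).
Proof. exact: (fubini_tonelli1 (m1 := m1) (m2 := m2)). Qed.

Lemma measurable_integral_prod (f : T1 * T2 -> \bar R) :
  measurable_fun setT f -> (forall z, 0 <= f z) ->
  measurable_fun setT (fun x => \int[m2]_y f (x, y)).
Proof. exact: (measurable_fun_fubini_tonelli_F (m2 := m2)). Qed.

End ProductProbability.

Section Independence.
Local Open Scope ereal_scope.
Context d (T : measurableType d) (R : realType) (P : probability T R).

(** One product formula encodes both independence and the marginals, the latter through one-element
    sequences. The laws are bare set functions, so they can be rewritten or transported without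
    building measures. *)
Definition indep_family (K : eqType) (mu : K -> set R -> \bar R)
    (X : K -> T -> R) :=
  (forall k, measurable_fun setT (X k)) /\
  (forall (J : seq K) (B : K -> set R), uniq J -> (forall k, measurable (B k)) ->
    P (\bigcap_(k in [set` J]) X k @^-1` B k) = \prod_(k <- J) mu k (B k)).

(** Taking [B] to be the whole line shows that [X] has law [mu]; the rest is independence of [X] and
    [W]. *)
Definition indep_law (mu : set R -> \bar R) (X W : T -> R) :=
  [/\ measurable_fun setT X, measurable_fun setT W &
      forall A B, measurable A -> measurable B ->
        P (X @^-1` A `&` W @^-1` B) = mu A * P (W @^-1` B)].

Lemma measurable_preimage (X : T -> R) A :
  measurable_fun setT X -> measurable A -> measurable (X @^-1` A).
Proof. by move=> mX mA; rewrite -[_ @^-1` _]setTI; exact: mX. Qed.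

Lemma indep_law_integral (mu : probability (measurableTypeR R) R) X W
    (F : R * R -> \bar R) :
  indep_law mu X W -> measurable_fun setT F -> (forall z, 0 <= F z) ->
  \int[P]_t F (X t, W t) = \int[P]_t \int[mu]_x F (x, W t).
Proof.
move=> [mX mW indep] mF F0.
have mXW : @measurable_fun _ _ T (measurableTypeR R * R)%type setT
    (fun t => (X t, W t)) by exact: measurable_fun_pair.
pose W' : {RV P >-> R} := HB.pack W (isMeasurableFun.Build _ _ _ _ _ mW).
pose XW' : {RV P >-> (measurableTypeR R * R)%type} :=
  HB.pack (fun t => (X t, W t)) (isMeasurableFun.Build _ _ _ _ _ mXW).
rewrite -[LHS](ge0_integral_distribution XW')//.
rewrite -[RHS](@ge0_integral_distribution _ _ _ _ _ P W' (fun w => \int[mu]_x F (x, w)))//; last 2 first.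
- exact: (@measurable_fun_fubini_tonelli_G _ _ (measurableTypeR R) R).
- by move=> y; exact: integral_ge0.
rewrite -[RHS](@fubini_tonelli2 _ _ (measurableTypeR R) R _ _ _ F)//.
apply: eq_measure_integral => C mC _; apply/esym.
by apply: product_measure_unique => // A B mA mB; exact: indep.
Qed.

Lemma indep_family_law (K : eqType) (mu : K -> set R -> \bar R) X k A :
  indep_family mu X -> measurable A -> P (X k @^-1` A) = mu k A.
Proof.
move=> [mX h] mA.
have := h [:: k] (fun=> A) isT (fun=> mA).
by rewrite set_cons1 bigcap_set1 big_seq1.
Qed.

(** A pi-system generating the sigma-algebra of the coordinates in [D]. Measurability for the space
    it generates on [T] is how the development says that a variable depends only on these
    coordinates. *)
Definition cylinders (K : eqType) (X : K -> T -> R) (D : pred K) : set (set T) :=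
  [set E | exists J B, [/\ uniq J, all D J, (forall k, measurable (B k)) &
     E = \bigcap_(k in [set` J]) X k @^-1` B k]].

Section Cylinders.
Variables (K : eqType) (mu : K -> set R -> \bar R) (X : K -> T -> R).
Hypothesis indX : indep_family mu X.
Variable D : pred K.

Let mX k : measurable_fun setT (X k) := indX.1 k.

Lemma cylinders_measurable : cylinders X D `<=` measurable.
Proof.
move=> _ [J [B [_ _ mB ->]]]; apply: fin_bigcap_measurable => // k _.
exact: measurable_preimage.
Qed.

Lemma cylindersT : cylinders X D setT.
Proof. by exists [::], (fun=> setT); split => //; rewrite set_nil bigcap_set0. Qed.

Lemma cylindersI : setI_closed (cylinders X D).
Proof.
move=> _ _ [J1 [B1 [u1 D1 m1 ->]]] [J2 [B2 [u2 D2 m2 ->]]].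
exists (undup (J1 ++ J2)), (fun k => (if k \in J1 then B1 k else setT) `&`
   (if k \in J2 then B2 k else setT)); split.
- exact: undup_uniq.
- by apply/allP => k; rewrite mem_undup mem_cat => /orP[]; exact/allP.
- by move=> k; apply: measurableI; case: ifP.
- apply/seteqP; split => t /=.
    by move=> [h1 h2] k _ /=; split; case: ifPn => // kJ; [exact: h1|exact: h2].
  move=> h; split => k /= kJ; have := h k; rewrite /= mem_undup mem_cat kJ ?orbT;
    by case=> //.
Qed.

Lemma cylinders_generated (E : set T) :
  <<s cylinders X D >> E -> measurable E.
Proof.
exact: (smallest_sub (@sigma_algebra_measurable _ T) cylinders_measurable).
Qed.

Notation TD := (g_sigma_algebraType (cylinders X D)).

Lemma measurable_cylinders_coord k : D k -> @measurable_fun _ _ TD R setT (X k).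
Proof.
move=> Dk _ A mA; rewrite setTI; apply: sub_sigma_algebra.
exists [:: k], (fun=> A); split => //=; first by rewrite Dk.
by rewrite set_cons1 bigcap_set1.
Qed.

Lemma measurable_cylinders (W : T -> R) :
  @measurable_fun _ _ TD R setT W -> measurable_fun setT W.
Proof. by move=> mW _ A mA; apply: cylinders_generated; exact: mW. Qed.

(** Both sides are finite measures in [E]; they agree on the pi-system of cylinders by the product
    formula for the index sequence [a :: J]. *)
Lemma indep_sigma a (A : set R) (E : set T) : ~~ D a -> measurable A ->
  <<s cylinders X D >> E -> P (X a @^-1` A `&` E) = mu a A * P E.
Proof.
move=> Da mA sE.
have mXA : measurable (X a @^-1` A) by exact: measurable_preimage.
have PA := indep_family_law a indX mA.
have fA : P (X a @^-1` A) \is a fin_num by exact: fin_num_measure.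
pose c : {nonneg R} := NngNum (fine_ge0 (measure_ge0 P (X a @^-1` A))).
rewrite setIC -[LHS]/(mrestr P mXA E).
transitivity (mscale c P E); last by rewrite /mscale /= fineK// PA.
apply: (g_sigma_algebra_measure_unique (cylinders X D) _ (fun=> setT)) => //.
- exact: cylinders_measurable.
- by move=> _; exact: cylindersT.
- by rewrite bigcup_const//; exists 0%N.
- exact: cylindersI.
- move=> _ [J [B [uJ DJ mB ->]]].
  have aJ : a \notin J by apply: contra Da => /(allP DJ).
  rewrite /= /mrestr /mscale /= fineK// PA (indX.2 _ _ uJ mB).
  have -> : \bigcap_(k in [set` J]) X k @^-1` B k `&` X a @^-1` A =
      \bigcap_(k in [set` a :: J]) X k @^-1` (if k == a then A else B k).
    apply/seteqP; split => t /=.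
      move=> [h1 h2] k /=; rewrite inE => /orP[/eqP ->|kJ]; first by rewrite eqxx.
      by case: eqP => [->//|_]; exact: h1.
    move=> h; split => [k /= kJ|].
      have := h k; rewrite /= inE kJ orbT; case: eqP => [ka|_]; last exact.
      by move: aJ; rewrite -ka kJ.
    by have := h a; rewrite /= inE eqxx; exact.
  rewrite (indX.2 (a :: J)) /=; last 2 first.
  - by rewrite aJ.
  - by move=> k; case: ifP.
  rewrite big_cons eqxx; congr (_ * _); apply: eq_big_seq => k kJ.
  by case: eqP => // ka; move: aJ; rewrite -ka kJ.
- by move=> _; rewrite /= /mrestr setTI -ge0_fin_numE//; exact: fin_num_measure.
Qed.

Lemma indep_family_pair a (W : T -> R) : ~~ D a ->
  @measurable_fun _ _ TD R setT W -> indep_law (mu a) (X a) W.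
Proof.
move=> Da mW; split => //; first exact: measurable_cylinders.
move=> A B mA mB; apply: indep_sigma => //.
by have := mW measurableT _ mB; rewrite setTI.
Qed.

End Cylinders.
End Independence.

(** * Burke's property *)

Section Exponential.
Local Open Scope ereal_scope.
Context {R : realType}.
Local Notation leb := (@lebesgue_measure R).

Definition exp_law (r : R) (r0 : (0 < r)%R) : probability (measurableTypeR R) R :=
  exponential_distribution_exponential_prob__canonical__probability_measure_Probability r0.

Lemma integral_exp_law (r : R) (r0 : (0 < r)%R) (f : R -> \bar R) :
  measurable_fun setT f -> (forall x, 0 <= f x) ->
  \int[exp_law r0]_x f x = \int[leb]_x (f x * (exponential_pdf r x)%:E).
Proof.
move=> mf f0.
apply: (ge0_integral_density (mu := leb) (nu := exp_law r0) (h := exponential_pdf r)) => //.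
  exact: measurable_exponential_pdf.
by move=> x; apply: exponential_pdf_ge0; exact: ltW.
Qed.

Lemma lebesgue_measure_shift (a : R) (A : set R) : measurable A ->
  pushforward leb (fun x : measurableTypeR R => (x + a)%R : measurableTypeR R) A = leb A.
Proof.
have ms : measurable_fun setT (fun x : measurableTypeR R => (x + a)%R : measurableTypeR R).
  exact: measurable_funD.
move=> mA; apply/esym.
pose m : {measure set (measurableTypeR R) -> \bar R} :=
  measure_function_pushforward__canonical__measure_function_Measure leb ms.
apply: (lebesgue_measure_unique (mu := m)) => //= _ [[b c]] _ <-.
rewrite /pushforward.
have -> : (fun x : measurableTypeR R => (x + a)%R) @^-1` `]b, c] = `](b - a)%R, (c - a)%R]%classic.
  by apply/seteqP; split => x; rewrite /= !in_itv/= ltrBlDr lerBrDr.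
rewrite !lebesgue_measure_itv/= !lte_fin; rewrite ltrD2r.
by case: ifP => // _; rewrite -!EFinB opprB addrA subrK.
Qed.

Lemma ge0_integral_shift (a : R) (f : R -> \bar R) :
  measurable_fun setT f -> (forall x, 0 <= f x) ->
  \int[leb]_x f (x + a)%R = \int[leb]_x f x.
Proof.
move=> mf f0.
have ms : measurable_fun setT (fun x : measurableTypeR R => (x + a)%R : measurableTypeR R).
  exact: measurable_funD.
transitivity (\int[pushforward leb (fun x : measurableTypeR R => (x + a)%R : measurableTypeR R)]_x f x).
  by rewrite ge0_integral_pushforward// preimage_setT.
by apply: eq_measure_integral => A mA _; exact: lebesgue_measure_shift.
Qed.

(** The substitution d = x - y, m = min(x, y) has Jacobian one: it is a translation of x by y for
    fixed y, followed by a translation of y by max(-d, 0) for fixed d. *)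
Lemma integral_diff_min (h : R * R -> \bar R) :
  measurable_fun setT h -> (forall z, 0 <= h z) ->
  \int[leb]_x \int[leb]_y h (x, y) =
  \int[leb]_d \int[leb]_m h (m + Num.max d 0, m + Num.max (- d) 0)%R.
Proof.
move=> mh h0.
have mh2 : measurable_fun setT (fun z : R * R => h (z.1 + z.2, z.2)%R).
  apply: (measurableT_comp mh); apply: measurable_fun_pair => //.
  exact: measurable_funD.
apply: (etrans (fubini_tonelli (m1 := leb) (m2 := leb) h mh h0)).
transitivity (\int[leb]_y \int[leb]_d h (d + y, y)%R).
  apply: eq_integral => y _.
  rewrite -(ge0_integral_shift y (f := fun x => h (x, y)))//.
  by apply: measurableT_comp mh _; exact: measurable_fun_pair.
apply: (etrans (esym (fubini_tonelli (m1 := leb) (m2 := leb)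
  (fun z : R * R => h (z.1 + z.2, z.2)%R) mh2 (fun z => h0 _)))).
apply: eq_integral => d _ /=.
rewrite -(ge0_integral_shift (Num.max (- (d : R)) 0)%R (f := fun y => h (d + y, y)%R))//; last first.
  apply: measurableT_comp mh _; apply: measurable_fun_pair => //.
  exact: measurable_funD.
apply: eq_integral => m _; congr (h (_, _)).
by rewrite addrCA addr_maxr subrr addr0 maxC.
Qed.

(* The increments (I, J) below and left of a cell of weight w become those above
   and right of it, and w is replaced by min(I, J). *)
Definition burke_map (z : R * (R * R)) : R * (R * R) :=
  (z.2.2 + Num.max (z.1 - z.2.1) 0, (z.2.2 + Num.max (z.2.1 - z.1) 0,
    Num.min z.1 z.2.1))%R.

Lemma measurable_burke_map : measurable_fun setT burke_map.
Proof.
have m1 : measurable_fun setT (fun z : R * (R * R) => z.2.1).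
  exact: (measurableT_comp measurable_fst measurable_snd).
have m2 : measurable_fun setT (fun z : R * (R * R) => z.2.2).
  exact: (measurableT_comp measurable_snd measurable_snd).
apply: measurable_fun_pair.
  apply: measurable_funD => //; apply: measurable_maxr => //.
  exact: measurable_funB.
apply: measurable_fun_pair.
  apply: measurable_funD => //; apply: measurable_maxr => //.
  exact: measurable_funB.
exact: measurable_minr.
Qed.

Lemma measurable_integral_snd (H : R * (R * R) -> \bar R) :
  measurable_fun setT H -> (forall z, 0 <= H z) ->
  measurable_fun setT (fun z : R * R => \int[leb]_w H (z.1, (z.2, w))).
Proof.
move=> mH H0.
apply: (measurable_fun_fubini_tonelli_F (m2 := leb) (fun z : (R * R) * R => H (z.1.1, (z.1.2, z.2)))) => //.
apply: measurableT_comp mH _; apply: measurable_fun_pair.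
  exact: (measurableT_comp measurable_fst measurable_fst).
apply: measurable_fun_pair => //.
exact: (measurableT_comp measurable_snd measurable_fst).
Qed.

(* In the coordinates d = x - y, m = min(x, y), the map exchanges m and w. *)
Lemma burke_map_lebesgue (H : R * (R * R) -> \bar R) :
  measurable_fun setT H -> (forall z, 0 <= H z) ->
  \int[leb]_x \int[leb]_y \int[leb]_w H (burke_map (x, (y, w))) =
  \int[leb]_x \int[leb]_y \int[leb]_w H (x, (y, w)).
Proof.
move=> mH H0.
have mHb : measurable_fun setT (H \o burke_map).
  by apply: measurableT_comp => //; exact: measurable_burke_map.
have E H' : measurable_fun setT H' -> (forall z, 0 <= H' z) ->
    \int[leb]_x \int[leb]_y \int[leb]_w H' (x, (y, w)) =
    \int[leb]_d \int[leb]_m \int[leb]_w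
       H' (m + Num.max d 0, (m + Num.max (- d) 0, w))%R.
  move=> mH' H'0.
  apply: (integral_diff_min (h := fun z => \int[leb]_w H' (z.1, (z.2, w)))).
    exact: measurable_integral_snd.
  by move=> z; apply: integral_ge0.
have E1 := E (H \o burke_map) mHb (fun z => H0 (burke_map z)).
have E2 := E H mH H0.
apply: (etrans E1); apply: (etrans _ (esym E2)).
apply: eq_integral => d _ /=.
transitivity (\int[leb]_m \int[leb]_w
    H (w + Num.max d 0, (w + Num.max (- d) 0, m))%R).
  apply: eq_integral => m _; apply: eq_integral => w _; congr H.
  rewrite /burke_map/=; congr (_ + _, (_ + _, _))%R.
  - by congr Num.max; case: (leP 0%R (d : R)) => d0; case: (leP 0%R (- (d : R))%R) => d1; lra.
  - by congr Num.max; case: (leP 0%R (d : R)) => d0; case: (leP 0%R (- (d : R))%R) => d1; lra.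
  - by case: (leP 0%R (d : R)) => d0; case: (leP 0%R (- (d : R))%R) => d1; case: leP; lra.
have E3 (a b : R) : \int[leb]_m \int[leb]_w H (w + a, (w + b, m))%R =
    \int[leb]_w \int[leb]_m H (w + a, (w + b, m))%R.
  have mHab : measurable_fun setT (fun z : R * R => H (z.2 + a, (z.2 + b, z.1))%R).
    apply: measurableT_comp mH _; apply: measurable_fun_pair.
      by apply: measurable_funD; [exact: measurable_snd|exact: measurable_cst].
    apply: measurable_fun_pair; last exact: measurable_fst.
    by apply: measurable_funD; [exact: measurable_snd|exact: measurable_cst].
  exact: (fubini_tonelli (m1 := leb) (m2 := leb)
     (fun z : R * R => H (z.2 + a, (z.2 + b, z.1))%R) mHab (fun z => H0 _)).
exact: E3.
Qed.

End Exponential.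

Lemma measure_integral_indic d (T : measurableType d) (R : realType)
    (nu : {measure set T -> \bar R}) (U : set T) : measurable U ->
  nu U = (\int[nu]_z (\1_U z)%:E)%E.
Proof. by move=> mU; rewrite integral_indic// setIT. Qed.

Section BurkeExponential.
Local Open Scope ereal_scope.
Context {R : realType}.
Local Notation leb := (@lebesgue_measure R).
Local Notation mR := (measurableTypeR R).

Variables (a b c : R) (a0 : (0 < a)%R) (b0 : (0 < b)%R) (c0 : (0 < c)%R).

Local Notation exp3_law := (prod_prob (exp_law a0) (prod_prob (exp_law b0) (exp_law c0))).

Lemma exp3_law_rect A B C : measurable A -> measurable B -> measurable C ->
  exp3_law (A `*` (B `*` C)) = exponential_prob a A * (exponential_prob b B * exponential_prob c C).
Proof.
move=> mA mB mC; by rewrite prod_probE ?prod_probE//; exact: measurableX.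
Qed.

Definition exp3_pdf (z : R * (R * R)) : R :=
  (exponential_pdf c z.2.2 * exponential_pdf b z.2.1 * exponential_pdf a z.1)%R.

Lemma exp3_pdf_ge0 z : (0 <= exp3_pdf z)%R.
Proof. by rewrite /exp3_pdf !mulr_ge0// exponential_pdf_ge0// ltW. Qed.

Lemma measurable_exp3_pdf : measurable_fun setT exp3_pdf.
Proof.
apply: measurable_funM; last first.
  exact: (measurableT_comp (measurable_exponential_pdf a) measurable_fst).
apply: measurable_funM.
  apply: (measurableT_comp (measurable_exponential_pdf c)).
  exact: (measurableT_comp measurable_snd measurable_snd).
apply: (measurableT_comp (measurable_exponential_pdf b)).
exact: (measurableT_comp measurable_fst measurable_snd).
Qed.

Lemma integral_exp3_law (H : R * (R * R) -> \bar R) :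
  measurable_fun setT H -> (forall z, 0 <= H z) ->
  \int[exp3_law]_z H z =
  \int[leb]_x \int[leb]_y \int[leb]_w (H (x, (y, w)) * (exp3_pdf (x, (y, w)))%:E).
Proof.
move=> mH H0.
have mp (r : R) : measurable_fun setT (fun x => (exponential_pdf r x)%:E).
  by apply/measurable_EFinP; exact: measurable_exponential_pdf.
have p0 (r : R) : (0 < r)%R -> forall x, 0 <= (exponential_pdf r x)%:E.
  by move=> r0 x; rewrite lee_fin exponential_pdf_ge0// ltW.
have mHx x : measurable_fun setT (fun yw : R * R => H (x, yw)).
  by apply: measurableT_comp mH _; apply: measurable_fun_pair.
have mHxy x y : measurable_fun setT (fun w : R => H (x, (y, w))).
  by apply: measurableT_comp (mHx x) _; apply: measurable_fun_pair.
have E1 := integral_prod_prob (exp_law a0) (prod_prob (exp_law b0) (exp_law c0)) mH H0.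
apply: (etrans E1).
have mF := measurable_integral_prod (prod_prob (exp_law b0) (exp_law c0)) mH H0.
have F0 x : 0 <= \int[prod_prob (exp_law b0) (exp_law c0)]_z H (x, z).
  by apply: integral_ge0.
apply: (etrans (integral_exp_law a0 mF F0)).
apply: eq_integral => x _.
have E2 := integral_prod_prob (exp_law b0) (exp_law c0) (mHx x) (fun z => H0 (x, z)).
have mF2 := measurable_integral_prod (exp_law c0) (mHx x) (fun z => H0 (x, z)).
have F20 y : 0 <= \int[exp_law c0]_z H (x, (y, z)) by apply: integral_ge0.
have E3 := integral_exp_law b0 mF2 F20.
apply: (etrans (congr1 (fun u => u * _) (etrans E2 E3))).
have mG : measurable_fun setT (fun z : R * R => H (x, z) * (exponential_pdf c z.2 * exponential_pdf b z.1)%:E).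
  apply: emeasurable_funM => //; apply/measurable_EFinP; apply: measurable_funM.
    exact: (measurableT_comp (measurable_exponential_pdf c) measurable_snd).
  exact: (measurableT_comp (measurable_exponential_pdf b) measurable_fst).
have G0 z : 0 <= H (x, z) * (exponential_pdf c z.2 * exponential_pdf b z.1)%:E.
  by rewrite mule_ge0// lee_fin mulr_ge0// exponential_pdf_ge0// ltW.
have mG2 := @measurable_fun_fubini_tonelli_F _ _ mR mR R leb _ mG G0.
have G20 y : 0 <= \int[leb]_z (H (x, (y, z)) * (exponential_pdf c z * exponential_pdf b y)%:E).
  by apply: integral_ge0 => z _; exact: (G0 (y, z)).
have step y : \int[exp_law c0]_w H (x, (y, w)) * (exponential_pdf b y)%:E
   = \int[leb]_w (H (x, (y, w)) * (exponential_pdf c w * exponential_pdf b y)%:E).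
  apply: (etrans (congr1 (fun u => u * _) (integral_exp_law c0 (mHxy x y) (fun z => H0 _)))).
  rewrite -ge0_integralZr//.
  - by apply: eq_integral => w _; rewrite -muleA EFinM.
  - by apply: emeasurable_funM; [exact: (mHxy x y)|exact: (mp c)].
  - by move=> w _; apply: mule_ge0 => //; exact: (p0 _ c0).
  - exact: (p0 _ b0).
rewrite -ge0_integralZr//; last 3 first.
- move: mG2; apply: eq_measurable_fun => y _; rewrite step.
  by [].
- by move=> y _; rewrite step.
- exact: (p0 _ a0).
apply: eq_integral => y _; rewrite step -ge0_integralZr//.
- apply: eq_integral => w _; rewrite -muleA; congr (_ * _).
- exact: (measurableT_comp mG (pair1_measurable _)).
- by rewrite lee_fin exponential_pdf_ge0// ltW.
Qed.

End BurkeExponential.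

Section BurkeLaw.
Local Open Scope ereal_scope.
Context {R : realType}.
Local Notation leb := (@lebesgue_measure R).
Variables (a b c : R) (a0 : (0 < a)%R) (b0 : (0 < b)%R) (c0 : (0 < c)%R).
Hypothesis abc : (a + b = c)%R.

(** With d = x - y and m = min(x, y), the exponent a x + b y + c w is (a+b) m + c w + a max(d,0) + b
    max(-d,0). It is symmetric in m and w precisely because a + b = c. The sign conditions m >= 0
    and w >= 0 are exchanged as well. *)
Lemma exp3_pdf_burke_map z : exp3_pdf a b c (burke_map z) = exp3_pdf a b c z.
Proof.
case: z => x [y w].
have neg (u v s : R) : ((u < 0) || (v < 0) || (s < 0))%R ->
    exp3_pdf a b c (u, (v, s)) = 0%R.
  rewrite /exp3_pdf /=; case: (ltP u 0%R) => u0 /=.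
    by rewrite (@lt0_exponential_pdf _ a u u0) mulr0.
  case: (ltP v 0%R) => v0 /=.
    by rewrite (@lt0_exponential_pdf _ b v v0) mulr0 mul0r.
  by move=> s0; rewrite (@lt0_exponential_pdf _ c s s0) !mul0r.
case: (boolP ((x < 0) || (y < 0) || (w < 0))%R) => [xyw|].
  rewrite [RHS]neg// /burke_map/= neg//.
  case/orP: xyw => [xy|w0]; first by rewrite gt_min xy !orbT.
  case: (leP x y) => xy; apply/orP; left; apply/orP; [left|right].
    by rewrite max_r ?addr0// subr_le0.
  by rewrite max_r ?addr0// subr_le0 ltW.
rewrite !negb_or -!leNgt => /andP[/andP[x0 y0] w0].
rewrite /exp3_pdf /burke_map /= !exponential_pdfE//; last 3 first.
- by rewrite addr_ge0// le_max lexx orbT.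
- by rewrite addr_ge0// le_max lexx orbT.
- by rewrite le_min x0 y0.
have E (i j k : R) : (c * expR (- c * k) * (b * expR (- b * j)) * (a * expR (- a * i)) =
    c * b * a * expR (- (c * k + b * j + a * i)))%R.
  by rewrite !opprD !expRD !mulNr; ring.
rewrite !E -abc; congr (_ * expR (- _))%R.
have [xy|xy] := leP x y.
  have -> : Num.max (x - y)%R 0%R = 0%R by rewrite max_r// subr_le0.
  have -> : Num.max (y - x)%R 0%R = (y - x)%R by rewrite max_l// subr_ge0.
  ring.
have -> : Num.max (x - y)%R 0%R = (x - y)%R by rewrite max_l// subr_ge0 ltW.
have -> : Num.max (y - x)%R 0%R = 0%R by rewrite max_r// subr_le0 ltW.
ring.
Qed.

Lemma exp3_law_burke_map (A B C : set R) :
  measurable A -> measurable B -> measurable C ->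
  prod_prob (exp_law a0) (prod_prob (exp_law b0) (exp_law c0))
    (burke_map @^-1` (A `*` (B `*` C))) =
  exponential_prob a A * (exponential_prob b B * exponential_prob c C).
Proof.
move=> mA mB mC; rewrite -(exp3_law_rect a0 b0 c0 mA mB mC).
set nu := prod_prob _ _; set S := A `*` (B `*` C).
have mS : measurable (S : set (R * (R * R))) by do 2 apply: measurableX => //.
have mbS : measurable (burke_map @^-1` S).
  by rewrite -[_ @^-1` _]setTI; exact: measurable_burke_map.
have m1 (U : set (R * (R * R))) : measurable U ->
    measurable_fun setT (fun z : R * (R * R) => (\1_U z)%:E : \bar R).
  by move=> mU; apply/measurable_EFinP; exact: measurable_indic.
have i0 (U : set (R * (R * R))) z : 0 <= (\1_U z)%:E :> \bar R by rewrite lee_fin.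
apply: (etrans (measure_integral_indic nu mbS)).
apply: (etrans _ (esym (measure_integral_indic nu mS))).
apply: (etrans (integral_exp3_law a0 b0 c0 (m1 _ mbS) (i0 _))).
apply: (etrans _ (esym (integral_exp3_law a0 b0 c0 (m1 _ mS) (i0 _)))).
have mH : measurable_fun setT (fun z => (\1_S z)%:E * (exp3_pdf a b c z)%:E).
  by apply: emeasurable_funM; [exact: m1|apply/measurable_EFinP; exact: measurable_exp3_pdf].
have H0 z : 0 <= (\1_S z)%:E * (exp3_pdf a b c z)%:E.
  by rewrite mule_ge0// lee_fin exp3_pdf_ge0.
apply: (etrans _ (burke_map_lebesgue mH H0)).
apply: eq_integral => x _; apply: eq_integral => y _; apply: eq_integral => w _.
by rewrite exp3_pdf_burke_map.
Qed.

End BurkeLaw.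

(** * One Burke step inside an independent family *)

Section Flip.
Local Open Scope ereal_scope.
Context d (T : measurableType d) (R : realType) (P : probability T R).

Lemma joint_law d1 d2 (T1 : measurableType d1) (T2 : measurableType d2)
    (m1 : probability T1 R) (m2 : probability T2 R) (U : T -> T1) (V : T -> T2)
    (E : set T) :
  measurable_fun setT U -> measurable_fun setT V -> measurable E ->
  (forall A B, measurable A -> measurable B ->
     P (U @^-1` A `&` (V @^-1` B `&` E)) = m1 A * (m2 B * P E)) ->
  forall C : set (T1 * T2), measurable C ->
    P ((fun t => (U t, V t)) @^-1` C `&` E) = prod_prob m1 m2 C * P E.
Proof.
move=> mU mV mE UVE C mC.
have mUV : measurable_fun setT (fun t => (U t, V t)) by exact: measurable_fun_pair.
have fE : P E \is a fin_num by exact: fin_num_measure.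
pose c : {nonneg R} := NngNum (fine_ge0 (measure_ge0 P E)).
pose n1 : {measure set (T1 * T2) -> \bar R} :=
  measure_function_pushforward__canonical__measure_function_Measure (mrestr P mE) mUV.
pose n2 : {measure set (T1 * T2) -> \bar R} := mscale c (prod_prob m1 m2).
have n12 : n1 C = n2 C.
  apply: finite_measure_rect_unique => //.
    rewrite /n1/= /pushforward /mrestr preimage_setT setTI.
    by rewrite -ge0_fin_numE.
  move=> A B mA mB.
  rewrite /n1/= /pushforward /mrestr /n2/= /mscale/= fineK//.
  have -> : (fun t => (U t, V t)) @^-1` (A `*` B) `&` E = U @^-1` A `&` (V @^-1` B `&` E).
    by rewrite setIA.
  by rewrite UVE// (prod_probE _ _ mA mB) muleA muleC.
apply: (etrans n12).
by rewrite /n2/= /mscale/= fineK// muleC.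
Qed.

Context (K : eqType) (mu : K -> set R -> \bar R).

(** The Burke map is applied in place to three coordinates, so the index set and the prescribed laws
    stay the same. *)
Definition flip (X : K -> T -> R) (a b c : K) (k : K) (t : T) : R :=
  let z := burke_map (X a t, (X b t, X c t)) in
  if k == a then z.1 else if k == b then z.2.1 else
  if k == c then z.2.2 else X k t.

Variables (X : K -> T -> R) (a b c : K) (ra rb rc : R).
Hypotheses (ra0 : (0 < ra)%R) (rb0 : (0 < rb)%R) (rc0 : (0 < rc)%R).
Hypothesis rabc : (ra + rb = rc)%R.
Hypotheses (mua : mu a = exponential_prob ra) (mub : mu b = exponential_prob rb)
  (muc : mu c = exponential_prob rc).
Hypothesis uabc : uniq [:: a; b; c].
Hypothesis indX : indep_family P mu X.

Let mX k : measurable_fun setT (X k) := indX.1 k.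

(** [joint_law] is used twice: once to pair [X a] with the pair of the other two, and once for that
    pair itself, relative to the event that also fixes [X a]. *)
Lemma indep_family_triple (J : seq K) (B : K -> set R) (C : set (R * (R * R))) :
  uniq J -> all (fun k => k \notin [:: a; b; c]) J ->
  (forall k, measurable (B k)) -> measurable C ->
  P ((fun t => (X a t, (X b t, X c t))) @^-1` C `&`
     \bigcap_(k in [set` J]) X k @^-1` B k) =
  prod_prob (exp_law ra0) (prod_prob (exp_law rb0) (exp_law rc0)) C *
  P (\bigcap_(k in [set` J]) X k @^-1` B k).
Proof.
move=> uJ Jabc mB mC; set E := \bigcap_(k in _) _.
have mE : measurable E.
  apply: fin_bigcap_measurable => // k _; exact: measurable_preimage.
have indep3 (A1 A2 A3 : set R) : measurable A1 -> measurable A2 -> measurable A3 ->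
    P (X a @^-1` A1 `&` (X b @^-1` A2 `&` (X c @^-1` A3 `&` E))) =
    mu a A1 * (mu b A2 * (mu c A3 * P E)).
  move=> mA1 mA2 mA3.
  pose B' k := if k == a then A1 else if k == b then A2 else if k == c then A3 else B k.
  have mB' k : measurable (B' k) by rewrite /B'; do 3 (case: ifP => // _).
  have B'J k : k \in J -> B' k = B k.
    move=> /(allP Jabc); rewrite !inE !negb_or => /and3P[/negbTE ka /negbTE kb /negbTE kc].
    by rewrite /B' ka kb kc.
  have [ab ac bc] : [/\ (b == a) = false, (c == a) = false & (c == b) = false].
    move: uabc; rewrite /= !inE !negb_or => /and3P[/andP[h1 h2] h3 _].
    by split; apply/negbTE; rewrite eq_sym.
  have uJ' : uniq [:: a, b, c & J].
    rewrite -[_ :: _]/([:: a; b; c] ++ J) cat_uniq uabc uJ andbT /=.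
    by apply/hasPn => k /(allP Jabc).
  have := indX.2 _ B' uJ' mB'; rewrite !big_cons.
  have -> : (\prod_(j <- J) mu j (B' j) = P E).
    rewrite indX.2//; apply: eq_big_seq => k kJ; by rewrite B'J.
  rewrite {2 3 4}/B' !eqxx ab ac bc => <-; congr (P _).
  apply/seteqP; split => t /=.
    move=> [h1 [h2 [h3 h4]]] k; rewrite /= !inE.
    move=> /or4P[/eqP->|/eqP->|/eqP->|kJ]; last by rewrite (B'J _ kJ); exact: h4.
    - by rewrite /B' eqxx.
    - by rewrite /B' eqxx ab.
    - by rewrite /B' eqxx ac bc.
  move=> h; split; [|split; [|split]].
  - by have := h a; rewrite /= /B' eqxx; apply; rewrite !inE eqxx.
  - by have := h b; rewrite /= /B' eqxx ab; apply; rewrite !inE eqxx orbT.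
  - by have := h c; rewrite /= /B' eqxx ac bc; apply; rewrite !inE eqxx !orbT.
  - by move=> k kJ; rewrite -(B'J _ kJ); apply: h; rewrite /= !inE kJ !orbT.
have mb1 : mu b setT = 1 by rewrite mub; exact: (probability_setT (exp_law rb0)).
have mc1 : mu c setT = 1 by rewrite muc; exact: (probability_setT (exp_law rc0)).
have PaE A1 : measurable A1 -> P (X a @^-1` A1 `&` E) = mu a A1 * P E.
  move=> mA1; have := indep3 A1 setT setT mA1 measurableT measurableT.
  by rewrite !preimage_setT !setTI mb1 mc1 !mul1e.
apply: (joint_law (m1 := exp_law ra0) (m2 := prod_prob (exp_law rb0) (exp_law rc0))
  (U := X a : T -> measurableTypeR R)
  (V := fun t => (X b t, X c t) : (measurableTypeR R * measurableTypeR R)%type)) => //.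
- exact: (mX a).
- exact: (measurable_fun_pair (mX b : measurable_fun setT (X b : T -> measurableTypeR R)) (mX c : measurable_fun setT (X c : T -> measurableTypeR R))).
move=> A1 A23 mA1 mA23.
have mE' : measurable (X a @^-1` A1 `&` E).
  by apply: measurableI => //; exact: measurable_preimage.
rewrite setICA.
apply: (etrans (joint_law (m1 := exp_law rb0) (m2 := exp_law rc0)
  (U := X b : T -> measurableTypeR R) (V := X c : T -> measurableTypeR R)
  (mX b) (mX c) mE' _ mA23)); last first.
  by rewrite (PaE _ mA1) mua muleCA.
move=> A2 A3 mA2 mA3.
rewrite [X c @^-1` A3 `&` _]setICA setICA indep3// (PaE _ mA1) mub muc.
by rewrite muleCA; congr (_ * _); rewrite muleCA.
Qed.

Lemma indep_family_flip : indep_family P mu (flip X a b c).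
Proof.
have mphi : measurable_fun setT (fun t => (X a t, (X b t, X c t))).
  by apply: measurable_fun_pair => //; apply: measurable_fun_pair.
have mz : measurable_fun setT (fun t => burke_map (X a t, (X b t, X c t))).
  exact: (measurableT_comp measurable_burke_map mphi).
split=> [k|J B uJ mB].
  rewrite /flip; case: eqP => _; first exact: (measurableT_comp measurable_fst mz).
  case: eqP => _.
    exact: (measurableT_comp measurable_fst (measurableT_comp measurable_snd mz)).
  case: eqP => _ //.
  exact: (measurableT_comp measurable_snd (measurableT_comp measurable_snd mz)).
have [ab ac bc] : [/\ (b == a) = false, (c == a) = false & (c == b) = false].
  move: uabc; rewrite /= !inE !negb_or => /and3P[/andP[h1 h2] h3 _].
  by split; apply/negbTE; rewrite eq_sym.
(* Indices outside [J] receive the whole line, so that all of [a], [b], [c] can be adjoined no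
   matter which of them belong to [J]. *)
pose B' k := if k \in J then B k else setT.
have mB' k : measurable (B' k) by rewrite /B'; case: ifP.
pose J' := [seq k <- J | k \notin [:: a; b; c]].
have uJ' : uniq J' by exact: filter_uniq.
have J'abc : all (fun k => k \notin [:: a; b; c]) J' by exact: filter_all.
have muT k : mu k setT = 1.
  by rewrite -(indep_family_law k indX measurableT) preimage_setT probability_setT.
have -> : \bigcap_(k in [set` J]) flip X a b c k @^-1` B k =
    (fun t => (X a t, (X b t, X c t))) @^-1`
       (burke_map @^-1` (B' a `*` (B' b `*` B' c))) `&`
    \bigcap_(k in [set` J']) X k @^-1` B' k.
  apply/seteqP; split => t /=.
    move=> h; split => /=.
      split; [|split]; rewrite /B'; case: ifPn => // kJ.
      - by have := h _ kJ; rewrite /= /flip eqxx.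
      - by have := h _ kJ; rewrite /= /flip eqxx ab.
      - by have := h _ kJ; rewrite /= /flip eqxx ac bc.
    move=> k /=; rewrite mem_filter => /andP[kabc kJ]; rewrite /B' kJ.
    have := h _ kJ; rewrite /= /flip.
    by move: kabc; rewrite !inE !negb_or => /and3P[/negbTE-> /negbTE-> /negbTE->].
  move=> [[h1 [h2 h3]] h4] k /= kJ; rewrite /flip.
  case: eqP => [ka|/eqP ka]; first by move: h1; rewrite /B' -ka kJ.
  case: eqP => [kb|/eqP kb]; first by move: h2; rewrite /B' -kb kJ.
  case: eqP => [kc|/eqP kc]; first by move: h3; rewrite /B' -kc kJ.
  have := h4 k; rewrite /= mem_filter !inE !negb_or ka kb kc kJ /B' kJ.
  exact.
have mS : measurable (burke_map @^-1` (B' a `*` (B' b `*` B' c))).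
  rewrite -[_ @^-1` _]setTI; apply: measurable_burke_map => //.
  by apply: measurableX => //; exact: measurableX.
rewrite indep_family_triple// exp3_law_burke_map// -mua -mub -muc.
rewrite (indX.2 _ _ uJ' mB') -!muleA.
have -> : \prod_(k <- J) mu k (B k) = \prod_(k <- [:: a, b, c & J']) mu k (B' k).
  transitivity (\prod_(k <- J) mu k (B' k)).
    by apply: eq_big_seq => k kJ; rewrite /B' kJ.
  rewrite (bigID (fun k => k \in [:: a; b; c])) /=.
  rewrite -[[:: a, b, c & J']]/([:: a; b; c] ++ J') big_cat /=; congr (_ * _).
    rewrite [RHS](bigID (fun k => k \in J)) /= [X in _ = _ * X]big1 ?mule1; last first.
      by move=> k /negbTE kJ; rewrite /B' kJ.
    rewrite -[LHS]big_filter -[RHS]big_filter; apply: perm_big; apply: uniq_perm.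
    - exact: filter_uniq.
    - exact: filter_uniq.
    - by move=> k; rewrite !mem_filter andbC.
  by rewrite big_filter.
by rewrite !big_cons.
Qed.

End Flip.

(** * Scaling and reindexing of exponential families *)

Section Scaling.
Local Open Scope ereal_scope.
Context {R : realType}.
Local Notation leb := (@lebesgue_measure R).

Lemma lebesgue_measure_scale (c : R) (A : set R) : (0 < c)%R -> measurable A ->
  leb ((fun x : R => (c * x)%R) @^-1` A) = (c^-1)%:E * leb A.
Proof.
move=> c0 mA.
have ms : measurable_fun setT (fun x : measurableTypeR R => (c * x)%R : measurableTypeR R).
  exact: measurable_funM.
pose m0 : {measure set (measurableTypeR R) -> \bar R} :=
  measure_function_pushforward__canonical__measure_function_Measure leb ms.
have c0' : (0 <= c)%R := ltW c0.
pose m : {measure set (measurableTypeR R) -> \bar R} := mscale (NngNum c0') m0.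
have mE X : ocitv X -> leb X = m X.
  move=> [[a b]] _ <-; rewrite /m /= /mscale /= /pushforward.
  have -> : (fun x : measurableTypeR R => (c * x)%R) @^-1` `]a, b] = `](a / c)%R, (b / c)%R]%classic.
    by apply/seteqP; split => x; rewrite /= !in_itv/= ltr_pdivrMr// ler_pdivlMr// mulrC.
  rewrite !lebesgue_measure_itv/= !lte_fin ltr_pM2r ?invr_gt0//.
  case: ifP => _; rewrite ?mule0// -!EFinB -EFinM; congr (_%:E).
  by field; rewrite gt_eqF.
have := lebesgue_measure_unique mE mA.
rewrite /m /= /mscale /= /m0 /= /pushforward => ->.
by rewrite muleA -EFinM mulVf ?mul1e// gt_eqF.
Qed.

Lemma ge0_integral_scale (c : R) (f : R -> \bar R) : (0 < c)%R ->
  measurable_fun setT f -> (forall x, 0 <= f x) ->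
  \int[leb]_x f (c * x)%R = (c^-1)%:E * \int[leb]_x f x.
Proof.
move=> c0 mf f0.
have ms : measurable_fun setT (fun x : measurableTypeR R => (c * x)%R : measurableTypeR R).
  exact: measurable_funM.
have c0' : (0 <= c^-1)%R by rewrite invr_ge0 ltW.
transitivity (\int[pushforward leb (fun x : measurableTypeR R => (c * x)%R : measurableTypeR R)]_x f x).
  by rewrite ge0_integral_pushforward// preimage_setT.
transitivity (\int[mscale (NngNum c0') leb]_x f x).
  by apply: eq_measure_integral => A mA _; exact: lebesgue_measure_scale.
by rewrite ge0_integral_mscale.
Qed.

Lemma exponential_prob_scale (r c : R) (A : set R) : (0 < r)%R -> (0 < c)%R ->
  measurable A ->
  exponential_prob r ((fun x : R => (c * x)%R) @^-1` A) = exponential_prob (r / c) A.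
Proof.
move=> r0 c0 mA.
have mcA : measurable ((fun x : R => (c * x)%R) @^-1` A).
  by rewrite -[_ @^-1` _]setTI; exact: measurable_funM.
rewrite /exponential_prob integral_mkcond [RHS]integral_mkcond.
pose f := (fun x => (exponential_pdf (r / c)%R x)%:E) \_ A.
have mf : measurable_fun setT f.
  apply/measurable_restrict => //; apply: measurable_funTS.
  by apply/measurable_EFinP; exact: measurable_exponential_pdf.
have f0 x : 0 <= f x.
  by rewrite /f patchE; case: ifP => // _; rewrite lee_fin exponential_pdf_ge0// divr_ge0// ltW.
have cancel (x y : \bar R) : x = (c^-1)%:E * y -> y = c%:E * x.
  by move=> ->; rewrite muleA -EFinM mulfV ?gt_eqF// mul1e.
apply/esym; apply: (etrans (cancel _ _ (ge0_integral_scale c0 mf f0))); apply/esym.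
rewrite -ge0_integralZl//.
- apply: eq_integral => x _; rewrite /f !patchE.
  have -> : (x \in (fun x : R => (c * x)%R) @^-1` A) = ((c * x)%R \in A).
    by apply/idP/idP; rewrite !inE.
  case: ifP => _; last by rewrite mule0.
  rewrite -EFinM; congr EFin; rewrite /exponential_pdf !patchE.
  have -> : ((c * x)%R \in `[0%R, +oo[%classic) = (x \in `[0%R, +oo[%classic).
    by apply/idP/idP; rewrite !inE/= !in_itv/= !andbT pmulr_rge0.
  case: ifP => _; last by rewrite mulr0.
  rewrite mulrA; congr (_ * expR _)%R; field; by rewrite gt_eqF.
- by apply: measurableT_comp mf _; exact: measurable_funM.
- by rewrite lee_fin ltW.
Qed.

End Scaling.

Section Families.
Local Open Scope ereal_scope.
Context d (T : measurableType d) (R : realType) (P : probability T R).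

Lemma indep_family_reindex (K K' : eqType) (mu : K -> set R -> \bar R)
    (X : K -> T -> R) (s : K' -> K) : injective s ->
  indep_family P mu X -> indep_family P (mu \o s) (X \o s).
Proof.
move=> sI [mX indX]; split=> [k|J B uJ mB]; first exact: mX.
have [->|[k0 k0J]] : J = [::] \/ exists k, k \in J.
- by case: J {uJ} => [|k J]; [left|right; exists k; rewrite inE eqxx].
  by rewrite set_nil bigcap_set0 big_nil probability_setT.
pose B' k := if pselect (exists2 k', k' \in J & s k' = k) is left h then
  B (sval (cid2 h)) else setT.
have B'E k : k \in J -> B' (s k) = B k.
  move=> kJ; rewrite /B'; case: pselect => [h|[]]; last by exists k.
  by case: cid2 => k' k'J /= /sI ->.
have := indX (map s J) B'; rewrite map_inj_uniq// => /(_ uJ).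
have mB' k : measurable (B' k) by rewrite /B'; case: pselect.
move=> /(_ mB'); rewrite big_map.
under eq_big_seq do rewrite B'E//.
move=> <-; congr (P _); apply/seteqP; split => t /= h k /=.
  by move=> /mapP[k' k'J ->]; rewrite B'E//; exact: h.
by move=> kJ; rewrite -B'E//; apply: h; rewrite /= map_f.
Qed.

Lemma eq_indep_family (K : eqType) (mu mu' : K -> set R -> \bar R) (X : K -> T -> R) :
  (forall k A, measurable A -> mu k A = mu' k A) ->
  indep_family P mu X -> indep_family P mu' X.
Proof.
move=> mumu [mX indX]; split => // J B uJ mB; rewrite indX//.
by apply: eq_bigr => k _; exact: mumu.
Qed.

Lemma indep_family_map (K : eqType) (mu : K -> set R -> \bar R)
    (X : K -> T -> R) (f : K -> R -> R) : (forall k, measurable_fun setT (f k)) ->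
  indep_family P mu X ->
  indep_family P (fun k A => mu k (f k @^-1` A)) (fun k => f k \o X k).
Proof.
move=> mf [mX indX]; split=> [k|J B uJ mB]; first exact: measurableT_comp.
rewrite -indX// => k; rewrite -[_ @^-1` _]setTI; exact: mf.
Qed.

End Families.

(** * Environments and the sweep behind Burke's property *)

Section LppShift.
Context {R : realType}.

(** Above row n, the recursion only needs the values on that row. Storing their increments on the
    horizontal axis of [w'] therefore reproduces [lpp w] up to the additive constant [lpp w 0 n]. *)
Lemma lpp_shift (w w' : nat -> nat -> R) m n k :
  (forall i, (i < m)%N -> w' i.+1 0 = lpp w i.+1 n - lpp w i n) ->
  (forall j, (j < k)%N -> w' 0 j.+1 = w 0 (n + j.+1)%N) ->
  (forall i j, (i < m)%N -> (j < k)%N -> w' i.+1 j.+1 = w i.+1 (n + j.+1)%N) ->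
  lpp w' m k = lpp w m (n + k)%N - lpp w 0 n.
Proof.
elim: m k => [|m ihm] k h1 h2 h3.
  elim: k h2 {h1 h3} => [|k ih] h2; first by rewrite lpp00 addn0 subrr.
  rewrite lpp0S ih => [|j jk]; last by apply: h2; exact: ltnW.
  by rewrite h2// addnS lpp0S addrAC.
elim: k h2 h3 => [|k ihk] h2 h3.
  rewrite lppS0 ihm//; last by move=> i im; apply: h1; exact: ltnW.
  by rewrite h1// addn0 addrAC subrKC.
rewrite lppSS ihm ?ihk ?h3 ?addnS ?lppSS//.
- by rewrite -addr_maxl addrAC.
- by move=> j jk; apply: h2; exact: ltnW.
- by move=> i j im jk; apply: h3 => //; exact: ltnW.
- by move=> i im; apply: h1; exact: ltnW.
- by move=> i j im jk; rewrite h3//; exact: ltnW.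
Qed.

Lemma lpp_ge0 (w : nat -> nat -> R) m n : (forall i j, 0 <= w i j) -> 0 <= lpp w m n.
Proof.
move=> w0; elim: m n => [|m ihm] n; first by rewrite lpp0l sumr_ge0.
case: n => [|n]; first by rewrite lppS0 addr_ge0.
by rewrite lppSS addr_ge0// le_max ihm.
Qed.

End LppShift.

Section Environments.
Local Open Scope ereal_scope.
Context d (T : measurableType d) (R : realType) (P : probability T R).
Implicit Types X Y : nat * nat -> T -> R.

(* The law [m0] of the weight at the origin, which no passage time uses, is free. *)
Definition env_law (a b : R) (m0 : set R -> \bar R) (z : nat * nat) : set R -> \bar R :=
  if z == (0, 0)%N then m0 else if z.1 == 0%N then exponential_prob a
  else if z.2 == 0%N then exponential_prob b else exponential_prob 1%R.

Definition weights X (t : T) : nat -> nat -> R := fun i j => X (i, j) t.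

(** The rate is [a] on the vertical axis and [b] on the horizontal one; the model is stationary when
    a + b = 1. Nonnegativity is asked everywhere rather than almost surely, so that pathwise
    comparisons hold at every sample point. *)
Definition exp_env a b X :=
  (exists m0, indep_family P (env_law a b m0) X) /\ (forall z t, (0 <= X z t)%R).

Lemma exp_env_transpose a b X :
  exp_env a b X -> exp_env b a (fun z => X (z.2, z.1)).
Proof.
move=> [[m0 indX] X0]; split => //; exists m0.
have sI : injective (fun z : nat * nat => (z.2, z.1)).
  by move=> [i j] [i' j'] [-> ->].
apply: eq_indep_family (indep_family_reindex sI indX) => -[i j] A mA /=.
suff -> : env_law a b m0 (j, i) = env_law b a m0 (i, j) by [].
by case: i j => [|i] [|j]; rewrite /env_law ?xpair_eqE /=; reflexivity.
Qed.

Definition rescale (a b : R) X : nat * nat -> T -> R := fun z t =>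
  ((if z.1 == 0%N then a else if z.2 == 0%N then b else 1) * X z t)%R.

Lemma exp_env_rescale a b a' b' X :
  (0 < a)%R -> (0 < b)%R -> (0 < a')%R -> (0 < b')%R ->
  exp_env a b X -> exp_env a' b' (rescale (a / a') (b / b') X).
Proof.
move=> a0 b0 a'0 b'0 [[m0 indX] X0]; split; last first.
  move=> z t; rewrite /rescale mulr_ge0//; case: ifP => _; first by rewrite divr_ge0// ltW.
  by case: ifP => _ //; rewrite divr_ge0// ltW.
have divE (x y : R) : x != 0%R -> (x / (x / y) = y)%R.
  by move=> x0; rewrite invf_div mulrCA divff ?mulr1.
pose c (z : nat * nat) : R :=
  if z.1 == 0%N then (a / a')%R else if z.2 == 0%N then (b / b')%R else 1%R.
have mf z : measurable_fun setT (fun x : R => (c z * x)%R) by exact: measurable_funM.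
exists (fun A => m0 ((fun x : R => (c (0, 0)%N * x)%R) @^-1` A)).
apply: eq_indep_family (indep_family_map mf indX) => z A mA.
rewrite /env_law; case: eqP => [->//|_].
rewrite /c; case: eqP => _; last case: eqP => _.
- apply: (etrans (exponential_prob_scale a0 (divr_gt0 a0 a'0) mA)).
  by rewrite divE// gt_eqF.
- apply: (etrans (exponential_prob_scale b0 (divr_gt0 b0 b'0) mA)).
  by rewrite divE// gt_eqF.
- by congr (exponential_prob _ _); apply/seteqP; split => x /=; rewrite mul1r.
Qed.

(* [Y] after the first [i] cells of the row [n.+1] have been swept: its axis
   entries are the increments of [lpp] along a down-right path. *)
Definition swept m n i X Y := forall t, let L := lpp (weights X t) in
  [/\ (forall k, (k < i)%N -> Y (k.+1, 0%N) t = L k.+1 n.+1 - L k n.+1)%R,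
      (forall k, (i <= k)%N -> (k < m)%N -> Y (k.+1, 0%N) t = L k.+1 n - L k n)%R,
      (forall j, (j < n)%N -> Y (0%N, j.+1) t = L m j.+1 - L m j)%R,
      (Y (0%N, n.+1) t = L i n.+1 - L i n)%R &
      (forall p q, [|| n.+1 < q, m < p | (q == n.+1) && (i < p)]%N ->
         Y (p, q) t = X (p, q) t)].

Lemma burke_step rho X Y m n i : (0 < rho < 1)%R -> (i < m)%N ->
  exp_env rho (1 - rho) Y -> swept m n i X Y ->
  exists Y', exp_env rho (1 - rho) Y' /\ swept m n i.+1 X Y'.
Proof.
move=> /andP[r0 r1] im [[m0 indY] Y0] sY.
(* The three slots of the cell (i+1, n+1): [a] holds the horizontal increment below it, [b] the
   vertical increment on its left, and [c] its own weight. Their rates 1-rho, rho and 1 satisfy the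
   sum condition. *)
pose a : nat * nat := (i.+1, 0)%N; pose b : nat * nat := (0, n.+1)%N.
pose c : nat * nat := (i.+1, n.+1)%N.
have uabc : uniq [:: a; b; c] by rewrite /= !inE !xpair_eqE /= andbF.
exists (flip Y a b c); split.
  split; last first.
    move=> z t; rewrite /flip/burke_map /=.
    case: ifP => _; first by rewrite addr_ge0// le_max lexx orbT.
    case: ifP => _; first by rewrite addr_ge0// le_max lexx orbT.
    by case: ifP => _ //; rewrite le_min !Y0.
  exists m0; apply: (@indep_family_flip _ _ _ _ _ _ _ a b c (1 - rho)%R rho 1%R) => //.
  - by rewrite subr_gt0.
  - by rewrite subrK.
move=> t L; have [h1 h2 h3 h4 h5] := sY t.
have Ya : Y a t = (L i.+1 n - L i n)%R by rewrite h2.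
have Yc : Y c t = X c t by rewrite h5// eqxx ltnSn !orbT.
have Lc : L i.+1 n.+1 = (Num.max (L i n.+1) (L i.+1 n) + X c t)%R by rewrite /L lppSS.
have E1 : flip Y a b c a t = (L i.+1 n.+1 - L i n.+1)%R.
  rewrite /flip eqxx /burke_map/= Ya Yc h4 -/L Lc opprB addrA subrK.
  move: (L i.+1 n) (L i n.+1) (X c t) => u v x.
  by case: (leP (u - v)%R 0%R); case: (leP v u); lra.
have E2 : flip Y a b c b t = (L i.+1 n.+1 - L i.+1 n)%R.
  rewrite /flip eqxx /= /burke_map/= Ya Yc h4 -/L Lc opprB addrA subrK.
  move: (L i.+1 n) (L i n.+1) (X c t) => u v x.
  by case: (leP (v - u)%R 0%R); case: (leP v u); lra.
have E3 p q : (p, q) != a -> (p, q) != b -> (p, q) != c -> flip Y a b c (p, q) t = Y (p, q) t.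
  by rewrite /flip => /negbTE-> /negbTE-> /negbTE->.
split.
- move=> k; rewrite ltnS leq_eqVlt => /orP[/eqP->//|ki].
  by rewrite E3 ?h1// xpair_eqE/= ?andbF// eqSS ltn_eqF.
- move=> k ik km; rewrite E3 ?h2 ?(ltnW ik)// xpair_eqE/= ?andbF// eqSS gtn_eqF//.
- move=> j jn; rewrite E3 ?h3// xpair_eqE/= ?andbF// eqSS ltn_eqF//.
- exact: E2.
- move=> p q pq; rewrite E3 ?h5//.
  + by case/or3P: pq => [->|->|/andP[-> /ltnW ->]]; rewrite ?orbT.
  + by rewrite xpair_eqE; apply/negP => /andP[/eqP pe /eqP qe]; move: pq im; rewrite pe qe; lia.
  + by rewrite xpair_eqE; apply/negP => /andP[/eqP pe /eqP qe]; move: pq im; rewrite pe qe; lia.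
  + by rewrite xpair_eqE; apply/negP => /andP[/eqP pe /eqP qe]; move: pq im; rewrite pe qe; lia.
Qed.

Lemma burke_row rho X Y m n : (0 < rho < 1)%R ->
  exp_env rho (1 - rho) Y -> swept m n 0 X Y ->
  exists Y', exp_env rho (1 - rho) Y' /\ swept m n m X Y'.
Proof.
move=> r01 eY sY.
suff H i : (i <= m)%N -> exists Y', exp_env rho (1 - rho) Y' /\ swept m n i X Y'.
  exact: H.
elim: i => [_|i ih im]; first by exists Y.
have [Y' [eY' sY']] := ih (ltnW im).
exact: burke_step sY'.
Qed.

(** Rows are swept from the bottom. Afterwards the axes of [Y] carry the passage-time increments
    along the top and the right side of the m by n rectangle, and these are independent because [Y]
    is again an environment. *)
Lemma burke rho X m n : (0 < rho < 1)%R -> exp_env rho (1 - rho) X ->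
  exists Y, exp_env rho (1 - rho) Y /\ swept m n 0 X Y.
Proof.
move=> r01 eX; elim: n => [|n [Y [eY sY]]].
  exists X; split => // t L; split => //.
  - move=> k _ _; rewrite /L lppS0 addrAC subrr add0r//.
  - by rewrite /L lpp0S addrAC subrr add0r.
have [Y' [eY' sY']] := burke_row r01 eY sY.
exists Y'; split => // t L; have [h1 h2 h3 h4 h5] := sY' t; split => //.
- move=> k _ km; exact: h1.
- by move=> j; rewrite ltnS leq_eqVlt => /orP[/eqP ->|]; [exact: h4|exact: h3].
- by rewrite h5 ?ltnSn// /L lpp0S addrAC subrr add0r.
- move=> p q pq; apply: h5; case/or3P: pq => [pq|->|/andP[/eqP -> _]]; rewrite ?orbT//.
  + by rewrite (ltn_trans _ pq).
  + by rewrite ltnSn.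
Qed.

(** After the sweep the horizontal axis already stores the increments of row n and stays in place;
    all other sites move up by n. The origin is sent to (0, n), which is why the law at the origin
    has to be left free. *)
Definition shift_index n (z : nat * nat) : nat * nat :=
  if (z.1 != 0%N) && (z.2 == 0%N) then z else (z.1, n + z.2)%N.

Lemma exp_env_shift_index a b n X :
  exp_env a b X -> exp_env a b (X \o shift_index n).
Proof.
move=> [[m0 indX] X0]; split; last by move=> z t; exact: X0.
have sI : injective (shift_index n).
  move=> [i j] [i' j']; rewrite /shift_index /=.
  by case: i i' j j' => [|i] [|i'] [|j] [|j'] //= [] *; congr (_, _); lia.
exists (env_law a b m0 (0, n)%N).
apply: eq_indep_family (indep_family_reindex sI indX) => -[i j] A mA /=.
rewrite /env_law /shift_index /=.
by case: i j => [|i] [|j]; rewrite ?addn0 ?addnS ?xpair_eqE.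
Qed.

(* Burke's theorem: seen from the corner (0, n), a stationary environment is
   again stationary. *)
Lemma stationary_shift rho X m n k : (0 < rho < 1)%R -> exp_env rho (1 - rho) X ->
  exists Z, exp_env rho (1 - rho) Z /\
   forall t, lpp (weights Z t) m k =
     (lpp (weights X t) m (n + k)%N - lpp (weights X t) 0 n)%R.
Proof.
move=> r01 eX; have [Y [eY sY]] := burke m n r01 eX.
exists (Y \o shift_index n); split; first exact: exp_env_shift_index.
move=> t; have [_ h2 _ _ h5] := sY t; have [_ _ _ h4' _] := sY t.
apply: lpp_shift => [i im|j jk|i j im jk]; rewrite /weights /= /shift_index /=.
- exact: h2.
- case: j jk => [|j] jk; last by rewrite h5//; apply/orP; left; lia.
  by rewrite addn1 h4' lpp0S addrAC subrr add0r.
- by rewrite h5//; lia.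
Qed.

End Environments.

(** * Moments of exponential variables *)

Lemma is_derive_exprn (R : realType) n (x : R) :
  is_derive x 1 (fun y : R => y ^+ n) (n%:R * x ^+ n.-1).
Proof.
apply: DeriveDef; first exact: exprn_derivable.
by rewrite exp_derive /GRing.scale/= mulr1.
Qed.

Section ExpMoments.
Context {R : realType}.
Local Notation leb := (@lebesgue_measure R).
Variables (r : R) (r0 : 0 < r).

(** Integration by parts: [expR (- r * x) * exp_tail k x] is the integral of y^k r e^(-ry) over [x,
    +oo[. *)
Fixpoint exp_tail (k : nat) (x : R) : R :=
  if k is k'.+1 then x ^+ k + k%:R / r * exp_tail k' x else 1.

Lemma exp_tail0 k : exp_tail k 0 = k`!%:R / r ^+ k.
Proof.
elim: k => [|k ih]; first by rewrite /= fact0 expr0 divr1.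
rewrite /= ih expr0n add0r factS natrM exprS invfM; by rewrite mulrACA.
Qed.

Lemma is_derive_exp_tail k (x : R) :
  is_derive x 1 (exp_tail k) (r * exp_tail k x - r * x ^+ k).
Proof.
elim: k => [|k ih] /=.
  rewrite expr0 subrr; exact: is_derive_cst.
have h1 := is_derive_exprn k.+1 x.
have h2 : is_derive x 1 (fun y : R => k.+1%:R / r * exp_tail k y)
    (k.+1%:R / r * (r * exp_tail k x - r * x ^+ k)).
  by apply: is_derive_eq; rewrite /=.
apply: (is_derive_eq (is_deriveD h1 h2)).
by rewrite /=; field; rewrite gt_eqF.
Qed.

Lemma is_derive_expRM (c x : R) :
  is_derive x 1 (fun y : R => expR (c * y)) (c * expR (c * x)).
Proof.
have h : is_derive x 1 (fun y : R => c * y) c.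
  by apply: is_derive_eq; rewrite /GRing.scale/= mulr1.
by apply: is_derive_eq; rewrite mulrC.
Qed.

Lemma is_derive_exp_tail_expR k (x : R) :
  is_derive x 1 (fun y => - (expR (- r * y) * exp_tail k y))
    (x ^+ k * (r * expR (- r * x))).
Proof.
have h1 := is_derive_exp_tail k x.
have h2 := is_derive_expRM (- r) x.
apply: (is_derive_eq (is_deriveN (is_deriveM h2 h1))).
by rewrite /GRing.scale/=; ring.
Qed.

Lemma cvg_expRM (c : R) : 0 < c -> expR (- (c * x)) @[x --> +oo] --> (0 : R).
Proof.
move=> c0; apply: (@cvg_comp _ _ _ (fun x : R => c * x) (fun y => expR (- y)) _ (pinfty_nbhs R)); last exact: cvgr_expR.
exact: gt0_cvgMry.
Qed.

Lemma cvg_exprn_expR k : x ^+ k * expR (- (r * x)) @[x --> +oo] --> (0 : R).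
Proof.
(* Half of the exponential absorbs the power: (r x / 2)^k <= (k+1)! e^(r x / 2) by the exponential
   series. The factorial of k+1 instead of k is harmless. *)
pose C : R := k.+1`!%:R * (2 / r) ^+ k.
have C0 : 0 <= C by rewrite mulr_ge0// exprn_ge0// divr_ge0// ltW.
have r2 : 0 < r / 2 by rewrite divr_gt0.
have hC : C * expR (- (r / 2 * x)) @[x --> +oo] --> (0 : R).
  rewrite -(mulr0 C); apply: cvgM; [exact: cvg_cst|exact: cvg_expRM].
apply: (@squeeze_cvgr _ _ _ _ (fun=> 0) (fun x => C * expR (- (r / 2 * x)))); [|exact: cvg_cst|exact: hC].
near=> x.
have x0 : 0 <= x by near: x; exact: nbhs_pinfty_ge.
rewrite mulr_ge0 ?exprn_ge0 ?expR_ge0//=.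
have -> : expR (- (r * x)) = expR (- (r / 2 * x)) * expR (- (r / 2 * x)).
  by rewrite -expRD; congr expR; field.
rewrite mulrA ler_wpM2r ?expR_ge0//.
rewrite expRN ler_pdivrMr ?expR_gt0//.
have y0 : 0 <= r / 2 * x by rewrite mulr_ge0// ltW.
have hy : (r / 2 * x) ^+ k / k.+1`!%:R <= expR (r / 2 * x).
  case: k {C C0 hC} => [|k].
    by rewrite expr0 (_ : 1`! = 1%N)// divr1 -[leLHS]expR0 ler_expR.
  apply: le_trans (expR_ge1Dxn k y0).
  rewrite (@le_trans _ _ ((r / 2 * x) ^+ k.+1 / k.+1`!%:R))//; last by rewrite lerDr.
  rewrite ler_wpM2l ?exprn_ge0// lef_pV2 ?posrE ?ltr0n ?fact_gt0// ler_nat.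
  by rewrite factS leq_pmull.
have f0 : (0 : R) < k.+1`!%:R by rewrite ltr0n fact_gt0.
move: hy; rewrite ler_pdivrMr// => hy.
have -> : x ^+ k = (2 / r) ^+ k * (r / 2 * x) ^+ k.
  by rewrite -exprMn; congr (_ ^+ _); field; rewrite gt_eqF.
rewrite /C mulrC [leRHS]mulrC mulrA ler_pM2r ?exprn_gt0 ?divr_gt0//.
Unshelve. all: by end_near. Qed.

Lemma cvg_exp_tail_expR k : - (expR (- r * x) * exp_tail k x) @[x --> +oo] --> (0 : R).
Proof.
rewrite -oppr0; apply: cvgN; elim: k => [|k ih].
  rewrite /=; under eq_fun do rewrite mulr1 mulNr; exact: cvg_expRM.
rewrite /=; under eq_fun do rewrite mulrDr mulrCA.
rewrite -(addr0 0); apply: cvgD.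
  by under eq_fun do rewrite mulrC mulNr; exact: cvg_exprn_expR.
rewrite -(mulr0 (k.+1%:R / r)); apply: cvgM => //; exact: cvg_cst.
Qed.

(** The absolute value equals x on the support of the law and makes the integrand nonnegative on the
    whole line, as Tonelli's theorem requires; later integrals against the law are written with it
    for the same reason. *)
Lemma integral_exp_law_norm k :
  (\int[exp_law r0]_x (`|x| ^+ k)%:E = (k`!%:R / r ^+ k)%:E)%E.
Proof.
have mk : measurable_fun setT (fun x : R => (`|x| ^+ k)%:E).
  apply/measurable_EFinP; apply: measurable_funX; exact: normr_measurable.
apply: (etrans (integral_exp_law r0 mk _)); first by move=> x; rewrite lee_fin exprn_ge0.
transitivity (\int[leb]_(x in `[0%R, +oo[) (x ^+ k * (r * expR (- r * x)))%:E)%E.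
  rewrite [RHS]integral_mkcond; apply: eq_integral => x _.
  rewrite patchE /exponential_pdf patchE.
  case: ifPn => [|_]; last by rewrite mule0.
  by rewrite inE/= in_itv/= andbT => x0; rewrite -EFinM ger0_norm.
have cF (x : R) : {for x, continuous (fun y => - (expR (- r * y) * exp_tail k y))}.
  have [h _] := is_derive_exp_tail_expR k x.
  by apply: differentiable_continuous; apply/derivable1_diffP.
have cf : continuous (fun x : R => x ^+ k * (r * expR (- r * x))).
  move=> x; apply: differentiable_continuous; apply/derivable1_diffP.
  have h := is_deriveM (is_derive_exprn k x) (is_derive_expRM (- r) x).
  have [h' _] := is_deriveM (is_derive_cst r x 1) h.
  move: h'; rewrite (_ : _ * _ = fun x => x ^+ k * (r * expR (- r * x)))//.
  by apply/funext => y; rewrite /= mulrCA.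
rewrite (ge0_continuous_FTC2y (F := fun y => - (expR (- r * y) * exp_tail k y)) (l := 0)).
- by rewrite mulr0 expR0 mul1r exp_tail0 EFinN oppeK add0e.
- by move=> x x0; rewrite !mulr_ge0 ?exprn_ge0 ?expR_ge0// ltW.
- exact: continuous_subspaceT.
- exact: cvg_exp_tail_expR.
- by move=> x _; have [] := is_derive_exp_tail_expR k x.
- by apply: cvg_at_right_filter; exact: cF.
- by move=> x _; rewrite derive1E; have [_ ->] := is_derive_exp_tail_expR k x.
Qed.

End ExpMoments.

Section CenteredMoments.
Local Open Scope ereal_scope.
Context {R : realType}.
Variables (r : R) (r0 : (0 < r)%R).
Local Notation mu := (exp_law r0).

Lemma integrable_exp_law_norm k : mu.-integrable setT (fun x => (`|x| ^+ k)%:E).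
Proof.
apply/integrableP; split.
  by apply/measurable_EFinP; apply: measurable_funX; exact: normr_measurable.
have E : \int[mu]_x `|(`|x| ^+ k)%:E| = \int[mu]_x (`|x| ^+ k)%:E.
  by apply: eq_integral => x _; rewrite gee0_abs// lee_fin exprn_ge0.
by rewrite E integral_exp_law_norm ltry.
Qed.

Lemma integrable_exp_law_poly n (c : nat -> R) :
  mu.-integrable setT (fun x => (\sum_(k < n) c k * `|x| ^+ k)%:E).
Proof.
elim: n => [|n ih].
  by under eq_fun do rewrite big_ord0; exact: integrable0.
under eq_fun do rewrite big_ord_recr/= EFinD EFinM.
apply: integrableD => //; apply: integrableZl => //.
exact: integrable_exp_law_norm.
Qed.

Lemma integral_exp_law_poly n (c : nat -> R) :
  \int[mu]_x (\sum_(k < n) c k * `|x| ^+ k)%:E =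
  (\sum_(k < n) c k * (k`!%:R / r ^+ k))%:E.
Proof.
elim: n => [|n ih].
  by under eq_integral do rewrite big_ord0; rewrite integral0 big_ord0.
under eq_integral do rewrite big_ord_recr/= EFinD EFinM.
rewrite integralD//; last 2 first.
- exact: integrable_exp_law_poly.
- by apply: integrableZl => //; exact: integrable_exp_law_norm.
by rewrite ih integralZl ?integral_exp_law_norm// ?big_ord_recr//; exact: integrable_exp_law_norm.
Qed.

Lemma integral_exp_law_center2 w :
  \int[mu]_x ((w + (`|x| - r^-1)) ^+ 2)%:E = (w ^+ 2 + r^-1 ^+ 2)%:E.
Proof.
pose c k : R := nth 0%R [:: (w - r^-1) ^+ 2; 2 * (w - r^-1); 1]%R k.
transitivity (\int[mu]_x (\sum_(k < 3) c k * `|x| ^+ k)%:E).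
  by apply: eq_integral => x _; rewrite !big_ord_recr big_ord0 /c /=; congr EFin; ring.
rewrite integral_exp_law_poly !big_ord_recr big_ord0 /c /=; congr EFin.
rewrite !factS fact0; field; by rewrite gt_eqF.
Qed.

(** With s = 1/r the exact value is w^4 + 6 s^2 w^2 + 8 s^3 w + 9 s^4. The odd term is absorbed by 8
    s^3 w <= 4 s^2 w^2 + 4 s^4, whence the constants 10 and 13. *)
Lemma integral_exp_law_center4 w :
  \int[mu]_x ((w + (`|x| - r^-1)) ^+ 4)%:E <=
  (w ^+ 4 + 10 * r^-1 ^+ 2 * w ^+ 2 + 13 * r^-1 ^+ 4)%:E.
Proof.
pose v := (w - r^-1)%R.
pose c k : R := nth 0%R [:: v ^+ 4; 4 * v ^+ 3; 6 * v ^+ 2; 4 * v; 1]%R k.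
have -> : \int[mu]_x ((w + (`|x| - r^-1)) ^+ 4)%:E =
    \int[mu]_x (\sum_(k < 5) c k * `|x| ^+ k)%:E.
  by apply: eq_integral => x _; rewrite !big_ord_recr big_ord0 /c /v /=; congr EFin; ring.
rewrite integral_exp_law_poly !big_ord_recr big_ord0 /c /v /= lee_fin.
rewrite !factS fact0.
set s := (r^-1)%R.
rewrite -subr_ge0 [X in (0 <= X)%R](_ : _ = 4 * s ^+ 2 * (w - s) ^+ 2)%R.
  by apply: mulr_ge0; [apply: mulr_ge0|]; rewrite ?exprn_even_ge0.
rewrite /s; field; by rewrite gt_eqF.
Qed.

End CenteredMoments.

Lemma integral_probability_cst d (T : measurableType d) (R : realType)
  (P : probability T R) (c : \bar R) : (\int[P]_t c = c)%E.
Proof.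
apply: (etrans (integral_cst _ measurableT c)).
rewrite -[RHS]mule1; congr (_ * _)%E; exact: probability_setT.
Qed.

Section CenteredSums.
Local Open Scope ereal_scope.
Context d (T : measurableType d) (R : realType) (P : probability T R).
Variables (K : eqType) (mu : K -> set R -> \bar R) (X : K -> T -> R).
Hypotheses (indX : indep_family P mu X) (X0 : forall k t, (0 <= X k t)%R).

Lemma indep_law_eq (m m' : set R -> \bar R) (Y W : T -> R) : m = m' ->
  indep_law P m Y W -> indep_law P m' Y W.
Proof. by move=> ->. Qed.

Definition csum (f : nat -> K) (r : R) n t := (\sum_(k < n) (X (f k) t - r^-1))%R.

Lemma csumS f r n t : csum f r n.+1 t = (csum f r n t + (X (f n) t - r^-1))%R.
Proof. by rewrite /csum big_ord_recr. Qed.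

Lemma measurable_cylinders_csum (D : pred K) f r n : (forall k, (k < n)%N -> D (f k)) ->
  @measurable_fun _ _ (g_sigma_algebraType (cylinders X D)) R setT (csum f r n).
Proof.
move=> Df; apply: measurable_sum => k; apply: measurable_funB => //.
by apply: measurable_cylinders_coord; exact: Df.
Qed.

Variables (f : nat -> K) (r : R) (r0 : (0 < r)%R).
Hypotheses (finj : injective f) (muf : forall k, mu (f k) = exponential_prob r).

Lemma measurable_csum n : measurable_fun setT (csum f r n).
Proof.
apply: measurable_sum => k; apply: measurable_funB => //; exact: indX.1.
Qed.

Lemma indep_csum n : indep_law P (exp_law r0) (X (f n)) (csum f r n).
Proof.
apply: (indep_law_eq (muf n)).
apply: (indep_family_pair indX (D := fun k => k \in map f (iota 0 n))).
  rewrite mem_map// mem_iota /= add0n ltnn//.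
apply: measurable_cylinders_csum => k kn.
by rewrite mem_map// mem_iota.
Qed.

(** The last summand is independent of the previous ones and can be integrated out first. Even
    powers keep the integrand nonnegative. *)
Lemma csum_pow_rec n k : ~~ odd k ->
  \int[P]_t ((csum f r n.+1 t) ^+ k)%:E =
  \int[P]_t \int[exp_law r0]_x ((csum f r n t + (`|x| - r^-1)) ^+ k)%:E.
Proof.
move=> ok; pose F (z : R * R) := ((z.2 + (`|z.1| - r^-1)) ^+ k)%:E.
have mF : measurable_fun setT F.
  apply/measurable_EFinP; apply: measurable_funX; apply: measurable_funD => //.
  apply: measurable_funB => //; exact: (measurableT_comp (@normr_measurable R setT) measurable_fst).
have F0 z : 0 <= F z by rewrite lee_fin exprn_even_ge0.
apply: (etrans _ (indep_law_integral (indep_csum n) mF F0)).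
by apply: eq_integral => t _; rewrite csumS /F /= ger0_norm.
Qed.

Lemma measurable_csum_pow n k : measurable_fun setT (fun t => ((csum f r n t) ^+ k)%:E).
Proof.
by apply/measurable_EFinP; apply: measurable_funX; exact: measurable_csum.
Qed.

Lemma csum_sqr n : \int[P]_t ((csum f r n t) ^+ 2)%:E = (n%:R * r^-1 ^+ 2)%:E.
Proof.
elim: n => [|n ih].
  by under eq_integral do rewrite /csum big_ord0 expr0n/=; rewrite integral0 mul0r.
rewrite csum_pow_rec//.
under eq_integral do rewrite integral_exp_law_center2 EFinD.
rewrite ge0_integralD//; last 3 first.
- by move=> t _; rewrite lee_fin exprn_even_ge0.
- exact: measurable_csum_pow.
- by move=> t _; rewrite lee_fin exprn_even_ge0.
rewrite ih integral_probability_cst -EFinD; congr EFin.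
by rewrite -natr1 mulrDl mul1r.
Qed.

Lemma csum_pow4 n : \int[P]_t ((csum f r n t) ^+ 4)%:E <= (13 * n%:R ^+ 2 * r^-1 ^+ 4)%:E.
Proof.
(* One more summand adds at most 10 n + 13 in units of r^-4, since the second moment is n r^-2. The
   polynomial 5 n^2 + 8 n has exactly these increments. *)
suff H : \int[P]_t ((csum f r n t) ^+ 4)%:E <= ((5 * n%:R ^+ 2 + 8 * n%:R) * r^-1 ^+ 4)%:E.
  apply: (le_trans H); rewrite lee_fin ler_wpM2r ?exprn_even_ge0//.
  have : ((n%:R : R) <= n%:R ^+ 2)%R by rewrite -natrX ler_nat; case: (n) => // k; rewrite expnS expn1 leq_pmulr.
  lra.
elim: n => [|n ih].
  by under eq_integral do rewrite /csum big_ord0 expr0n/=; rewrite integral0 lee_fin expr0n/= !mulr0 addr0 mul0r.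
have e0 (x : R) k : ~~ odd k -> 0 <= (x ^+ k)%:E by move=> ?; rewrite lee_fin exprn_even_ge0.
have c1 : 0 <= (10 * r^-1 ^+ 2)%:E by rewrite EFinM mule_ge0// ?e0// lee_fin.
have c2 : 0 <= (13 * r^-1 ^+ 4)%:E by rewrite EFinM mule_ge0// ?e0// lee_fin.
have mS k := measurable_csum_pow n k.
rewrite csum_pow_rec//.
apply: (@le_trans _ _ (\int[P]_t ((csum f r n t ^+ 4)%:E +
   ((10 * r^-1 ^+ 2)%:E * (csum f r n t ^+ 2)%:E + (13 * r^-1 ^+ 4)%:E)))).
  apply: ge0_le_integral => //.
  - by move=> t _; apply: integral_ge0 => x _; exact: e0.
  - have mF : measurable_fun setT (fun z : R * R => ((z.2 + (`|z.1| - r^-1)) ^+ 4)%:E).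
      apply/measurable_EFinP; apply: measurable_funX; apply: measurable_funD => //.
      apply: measurable_funB => //; exact: (measurableT_comp (@normr_measurable R setT) measurable_fst).
    have h := @measurable_fun_fubini_tonelli_G _ _ (measurableTypeR R) R R (exp_law r0) _ mF (fun z => e0 _ 4%N isT).
    exact: (measurableT_comp h (measurable_csum n)).
  - apply: emeasurable_funD => //; apply: emeasurable_funD => //.
    exact: emeasurable_funM.
  - by move=> t _ /=; apply: (le_trans (integral_exp_law_center4 r0 _)); rewrite -EFinM -!EFinD addrA.
rewrite ge0_integralD//; last 3 first.
- by move=> t _; exact: e0.
- by move=> t _; rewrite adde_ge0// mule_ge0// e0.
- by apply: emeasurable_funD => //; exact: emeasurable_funM.
rewrite ge0_integralD//; last 2 first.
- by move=> t _; rewrite mule_ge0// e0.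
- exact: emeasurable_funM.
rewrite ge0_integralZl//; last by move=> t _; exact: e0.
rewrite csum_sqr integral_probability_cst -EFinM -EFinD.
apply: (le_trans (leeD2r _ ih)); rewrite -EFinD lee_fin -natr1.
rewrite le_eqVlt; apply/orP; left; apply/eqP; ring.
Qed.

End CenteredSums.

(** * Square integrable variables and vanishing covariances *)

Section SquareIntegrable.
Context d (T : measurableType d) (R : realType) (P : probability T R).
Implicit Types f g : T -> R.

Definition sqint f := measurable_fun setT f /\
  P.-integrable setT (fun t => ((f t) ^+ 2)%:E).

Lemma sqintP f : measurable_fun setT f ->
  (\int[P]_t ((f t) ^+ 2)%:E < +oo)%E -> sqint f.
Proof.
move=> mf f2; split => //; apply/integrableP; split.
  by apply/measurable_EFinP; exact: measurable_funX.
apply: le_lt_trans f2; rewrite le_eqVlt; apply/orP; left; apply/eqP.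
by apply: eq_integral => t _; rewrite gee0_abs// lee_fin sqr_ge0.
Qed.

Lemma integrable_le f g : measurable_fun setT f -> (forall t, `|f t| <= g t) ->
  P.-integrable setT (EFin \o g) -> P.-integrable setT (EFin \o f).
Proof.
move=> mf fg ig; apply: le_integrable ig => //; first exact/measurable_EFinP.
move=> t _ /=; rewrite lee_fin; apply: (le_trans (fg t)); exact: ler_norm.
Qed.

Lemma sqint_cst c : sqint (fun=> c).
Proof.
split; first exact: measurable_cst.
exact: finite_measure_integrable_cst.
Qed.

Lemma sqintZ c f : sqint f -> sqint (fun t => c * f t).
Proof.
move=> [mf if2]; split; first exact: measurable_funM.
rewrite (_ : (fun t => _) = (fun t => (c ^+ 2)%:E * ((f t) ^+ 2)%:E)%E).
  exact: integrableZl.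
by apply/funext => t; rewrite -EFinM exprMn.
Qed.

Lemma sqintD f g : sqint f -> sqint g -> sqint (fun t => f t + g t).
Proof.
move=> [mf if2] [mg ig2].
have mfg : measurable_fun setT (fun t => f t + g t) by exact: measurable_funD.
split => //.
apply: (@integrable_le _ (fun t => 2 * (f t) ^+ 2 + 2 * (g t) ^+ 2)).
- exact: measurable_funX.
- move=> t; rewrite ger0_norm ?sqr_ge0// -subr_ge0.
  rewrite [X in 0 <= X](_ : _ = (f t - g t) ^+ 2) ?sqr_ge0//; ring.
- rewrite /comp; under eq_fun do rewrite EFinD !EFinM.
  by apply: integrableD => //; exact: integrableZl.
Qed.

Lemma sqintB f g : sqint f -> sqint g -> sqint (fun t => f t - g t).
Proof.
move=> sf sg; rewrite (_ : (fun t => _) = fun t => f t + -1 * g t).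
  by apply: sqintD => //; exact: sqintZ.
by apply/funext => t; rewrite mulN1r.
Qed.

Lemma sqint_mul f g : sqint f -> sqint g ->
  P.-integrable setT (EFin \o (fun t => f t * g t)).
Proof.
move=> [mf if2] [mg ig2].
apply: (@integrable_le _ (fun t => (f t) ^+ 2 + (g t) ^+ 2)).
- exact: measurable_funM.
- move=> t; rewrite normrM -(real_normK (num_real (f t))) -(real_normK (num_real (g t))).
  move: (normr_ge0 (f t)) (normr_ge0 (g t)).
  move: `|f t| `|g t| => a b a0 b0; rewrite -subr_ge0.
  rewrite [X in 0 <= X](_ : _ = (a - b) ^+ 2 + a * b); last by ring.
  by rewrite addr_ge0 ?sqr_ge0// mulr_ge0.
- rewrite /comp; under eq_fun do rewrite EFinD; exact: integrableD.
Qed.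

Lemma sqint_integrable f : sqint f -> P.-integrable setT (EFin \o f).
Proof.
move=> sf; have := sqint_mul sf (sqint_cst 1).
by rewrite (_ : (fun t => _) = f)//; apply/funext => t; rewrite mulr1.
Qed.

Lemma sqint_le f g : measurable_fun setT f -> (forall t, `|f t| <= `|g t|) ->
  sqint g -> sqint f.
Proof.
move=> mf fg [mg ig]; split => //.
apply: (@integrable_le _ (fun t => (g t) ^+ 2)) => //; first exact: measurable_funX.
move=> t; rewrite normrX -(real_normK (num_real (g t))) ler_pXn2r ?nnegrE//.
Qed.

Lemma sqint_max f g : sqint f -> sqint g -> sqint (fun t => Num.max (f t) (g t)).
Proof.
move=> sf sg; apply: (@sqint_le _ (fun t => `|f t| + `|g t|)).
- by apply: measurable_maxr; [exact: sf.1|exact: sg.1].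
- move=> t; rewrite [leRHS]ger0_norm ?addr_ge0// maxEle.
  by case: ifP => _; [rewrite lerDr|rewrite lerDl].
- apply: sqintD.
    apply: (sqint_le _ _ sf) => [|t]; last by rewrite normr_id.
    exact: (measurableT_comp (@normr_measurable R setT) sf.1).
  apply: (sqint_le _ _ sg) => [|t]; last by rewrite normr_id.
  exact: (measurableT_comp (@normr_measurable R setT) sg.1).
Qed.

Section CenteredProduct.
Variables (r : R) (r0 : 0 < r) (X W : T -> R).
Hypotheses (XW : indep_law P (exp_law r0) X W) (X0 : forall t, 0 <= X t).

Lemma sqint_exp : sqint X.
Proof.
apply: sqintP; first by case: XW.
have mF : measurable_fun setT (fun z : R * R => (`|z.1| ^+ 2)%:E).
  apply/measurable_EFinP; apply: measurable_funX.
  exact: (measurableT_comp (@normr_measurable R setT) measurable_fst).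
have F0 (z : R * R) : (0 <= (`|z.1| ^+ 2)%:E)%E by rewrite lee_fin exprn_even_ge0.
have E := indep_law_integral XW mF F0.
rewrite (_ : (\int[P]_t _)%E = (2%:R / r ^+ 2)%:E) ?ltry//.
transitivity (\int[P]_t (`|X t| ^+ 2)%:E)%E.
  by apply: eq_integral => t _; rewrite ger0_norm.
apply: (etrans E); rewrite /=.
transitivity (\int[P]_t (2`!%:R / r ^+ 2)%:E)%E.
  by apply: eq_integral => t _; exact: integral_exp_law_norm.
exact: integral_probability_cst.
Qed.

Lemma integral_indep_ge0 (g : R -> R) : measurable_fun setT g -> (forall w, 0 <= g w) ->
  (\int[P]_t (X t * g (W t))%:E = (r^-1)%:E * \int[P]_t (g (W t))%:E)%E.
Proof.
move=> mg g0.
have mW : measurable_fun setT W by case: XW.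
have mF : measurable_fun setT (fun z : R * R => (`|z.1| * g z.2)%:E).
  apply/measurable_EFinP; apply: measurable_funM.
    exact: (measurableT_comp (@normr_measurable R setT) measurable_fst).
  exact: (measurableT_comp mg measurable_snd).
have F0 (z : R * R) : (0 <= (`|z.1| * g z.2)%:E)%E by rewrite lee_fin mulr_ge0.
have E := indep_law_integral XW mF F0.
transitivity (\int[P]_t (`|X t| * g (W t))%:E)%E.
  by apply: eq_integral => t _; rewrite ger0_norm.
apply: (etrans E); rewrite /=.
rewrite -ge0_integralZl//; last 3 first.
- by apply/measurable_EFinP; exact: (measurableT_comp mg mW).
- by move=> t _; rewrite lee_fin.
- by rewrite lee_fin invr_ge0 ltW.
apply: eq_integral => t _.
under eq_integral do rewrite EFinM.
rewrite ge0_integralZr//.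
- congr (_ * _)%E; transitivity (\int[exp_law r0]_x (`|x| ^+ 1)%:E)%E.
    by apply: eq_integral => x _; rewrite expr1.
  apply: (etrans (integral_exp_law_norm r0 1)).
  by rewrite (_ : 1`!%:R = 1 :> R)// expr1 div1r.
- by apply/measurable_EFinP; exact: normr_measurable.
- by rewrite lee_fin.
Qed.

(** The factorisation is available for nonnegative functions of [W], so [W] is split into its
    positive and negative parts. *)
Lemma Rintegral_centered_indep : sqint W -> \int[P]_t ((X t - r^-1) * W t) = 0.
Proof.
move=> sW; pose Wp t := Num.max (W t) 0; pose Wn t := Num.max (- W t) 0.
have sWp : sqint Wp by apply: sqint_max => //; exact: sqint_cst.
have sWn : sqint Wn.
  apply: sqint_max; last exact: sqint_cst.
  by rewrite (_ : (fun t => _) = (fun t => -1 * W t));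
    [exact: sqintZ|apply/funext => t; rewrite mulN1r].
have WE t : W t = Wp t - Wn t.
  by rewrite /Wp /Wn; case: (leP (W t) 0); case: (leP (- W t) 0); lra.
have sX := sqint_exp.
have key (g : R -> R) : measurable_fun setT g -> (forall w, 0 <= g w) ->
    sqint (g \o W) -> \int[P]_t (X t * g (W t)) = r^-1 * \int[P]_t (g (W t)).
  move=> mg g0 sg; rewrite /Rintegral integral_indep_ge0// fineM//.
  exact: integrable_fin_num (sqint_integrable sg).
have kp := key (fun w => Num.max w 0) _ _ sWp.
have kn := key (fun w => Num.max (- w) 0) _ _ sWn.
have mp : measurable_fun setT (fun w : R => Num.max w 0).
  by apply: measurable_maxr => //; exact: measurable_cst.
have mn : measurable_fun setT (fun w : R => Num.max (- w) 0).
  by apply: measurable_maxr => //; exact: measurable_cst.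
have p0 (w : R) : 0 <= Num.max w 0 by rewrite le_max lexx orbT.
rewrite (_ : (fun t => _) = (fun t => (X t * Wp t - X t * Wn t) - r^-1 * (Wp t - Wn t))); last first.
  by apply/funext => t; rewrite {1}WE; ring.
have i1 := sqint_mul sX sWp; have i2 := sqint_mul sX sWn.
have ip := sqint_integrable sWp; have in_ := sqint_integrable sWn.
have iB : P.-integrable setT (EFin \o (fun t => X t * Wp t - X t * Wn t)).
  by rewrite /comp; under eq_fun do rewrite EFinB; exact: integrableB.
have iB' : P.-integrable setT (EFin \o (fun t => Wp t - Wn t)).
  by rewrite /comp; under eq_fun do rewrite EFinB; exact: integrableB.
rewrite RintegralB//; last first.
  by rewrite /comp; under eq_fun do rewrite EFinM; exact: integrableZl.
rewrite RintegralZl// !RintegralB//.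
by rewrite kp// kn//; ring.
Qed.

End CenteredProduct.

Lemma Rintegral_sum n (f : nat -> T -> R) :
  (forall k, (k < n)%N -> P.-integrable setT (EFin \o f k)) ->
  P.-integrable setT (EFin \o (fun t => \sum_(k < n) f k t)) /\
  \int[P]_t (\sum_(k < n) f k t) = \sum_(k < n) \int[P]_t f k t.
Proof.
elim: n => [|n ih] h.
  rewrite (_ : (fun t => _) = (fun=> 0)); last by apply/funext => t; rewrite big_ord0.
  split; first exact: integrable0.
  by rewrite big_ord0 Rintegral_cst// mul0r.
have [i1 i2] := ih (fun k kn => h k (ltnW kn)).
rewrite (_ : (fun t => _) = (fun t => \sum_(k < n) f k t + f n t)); last first.
  by apply/funext => t; rewrite big_ord_recr.
have hn := h n (ltnSn n).
split; first by rewrite /comp; under eq_fun do rewrite EFinD; exact: integrableD.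
by rewrite RintegralD// i2 big_ord_recr.
Qed.

End SquareIntegrable.

Section CenteredSumProduct.
Context d (T : measurableType d) (R : realType) (P : probability T R).
Variables (K : eqType) (mu : K -> set R -> \bar R) (X : K -> T -> R).
Hypotheses (indX : indep_family P mu X) (X0 : forall k t, 0 <= X k t).
Variables (f : nat -> K) (r : R) (r0 : 0 < r).
Hypotheses (finj : injective f) (muf : forall k, mu (f k) = exponential_prob r).

Lemma sqint_csum n : sqint P (csum X f r n).
Proof.
apply: sqintP; first exact: (measurable_csum indX).
by rewrite (csum_sqr indX)// ltry.
Qed.

Lemma Rintegral_csum_indep (D : pred K) n (W : T -> R) :
  (forall k, ~~ D (f k)) ->
  @measurable_fun _ _ (g_sigma_algebraType (cylinders X D)) R setT W ->
  sqint P W -> \int[P]_t (csum X f r n t * W t) = 0.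
Proof.
move=> Df mW sW.
have indk k : indep_law P (exp_law r0) (X (f k)) W.
  apply: (indep_law_eq (muf k)); exact: (indep_family_pair indX (Df k) mW).
have hi k : (k < n)%N ->
    P.-integrable setT (EFin \o (fun t => (X (f k) t - r^-1) * W t)).
  move=> _; apply: sqint_mul => //; apply: sqintB; last exact: sqint_cst.
  exact: (sqint_exp (indk k)).
have [_ E] := Rintegral_sum hi.
rewrite (_ : (fun t => _) = (fun t => \sum_(k < n) (X (f k) t - r^-1) * W t)); last first.
  by apply/funext => t; rewrite /csum mulr_suml.
rewrite E big1// => k _; exact: (Rintegral_centered_indep (indk k)).
Qed.

End CenteredSumProduct.

(** * Variance and exit points of the stationary model *)

Lemma measurable_lpp d (T : measurableType d) (R : realType)
    (w : nat -> nat -> T -> R) m n :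
  (forall i j, measurable_fun setT (w i j)) ->
  measurable_fun setT (fun t => lpp (fun i j => w i j t) m n).
Proof.
move=> mw; elim: m n => [|m ihm] n.
  by under eq_fun do rewrite lpp0l; exact: measurable_sum.
elim: n => [|n ihn].
  by under eq_fun do rewrite lppS0; exact: measurable_funD.
under eq_fun do rewrite lppSS; apply: measurable_funD => //.
exact: measurable_maxr.
Qed.

Lemma measurable_Lup d (T : measurableType d) (R : realType)
    (w : nat -> nat -> T -> R) m n :
  (forall i j, measurable_fun setT (w i j.+1)) ->
  measurable_fun setT (fun t => Lup (fun i j => w i j t) m n).
Proof.
move=> mw; apply: measurable_funD; first exact: mw.
by rewrite /shift_up; apply: (measurable_lpp (w := fun i j => w i j.+1)).
Qed.

(** A path that starts to the right never meets the vertical axis again, so only weights with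
    positive first coordinate are compared. *)
Lemma le_Lright (R : realType) (w w' : nat -> nat -> R) m n :
  (forall i j, w i.+1 j <= w' i.+1 j) -> Lright w m n <= Lright w' m n.
Proof.
move=> ww; rewrite /Lright /Lup lerD//; first exact: ww.
by apply: le_lpp => i j _; exact: ww.
Qed.

Definition vaxis (k : nat) : nat * nat := (0, k.+1)%N.
Definition haxis (k : nat) : nat * nat := (k.+1, 0)%N.

Lemma vaxis_inj : injective vaxis. Proof. by move=> i j []. Qed.
Lemma haxis_inj : injective haxis. Proof. by move=> i j []. Qed.

Section StationaryVariance.
Context d (T : measurableType d) (R : realType) (P : probability T R).
Implicit Types (X Y : nat * nat -> T -> R) (rho : R).

Lemma env_law_vaxis a b (m0 : set R -> \bar R) k :
  env_law a b m0 (vaxis k) = exponential_prob a.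
Proof. by []. Qed.

Lemma env_law_haxis a b (m0 : set R -> \bar R) k :
  env_law a b m0 (haxis k) = exponential_prob b.
Proof. by []. Qed.

Definition lpp_mean rho m n : R := m%:R / (1 - rho) + n%:R / rho.

Definition lpp_bar rho X m n t : R := lpp (weights X t) m n - lpp_mean rho m n.

Lemma csum_vaxis X a n t :
  csum X vaxis a n t = lpp (weights X t) 0 n - n%:R / a.
Proof.
elim: n => [|n ih]; first by rewrite /csum big_ord0 lpp00 mul0r subrr.
by rewrite csumS ih lpp0S /weights /vaxis -natr1; ring.
Qed.

Lemma csum_haxis X b m t :
  csum X haxis b m t = lpp (weights X t) m 0 - m%:R / b.
Proof.
elim: m => [|m ih]; first by rewrite /csum big_ord0 lpp00 mul0r subrr.
by rewrite csumS ih lppS0 /weights /haxis -natr1; ring.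
Qed.

(** The passage time to the corner is read along the two boundary routes: left side then top (W +
    N), or bottom then right side (S + E). The bottom and left sums come from [X], the top and right
    ones from the swept environment [Y]. *)
Lemma stationary_decomposition rho X m n : 0 < rho < 1 ->
  exp_env P rho (1 - rho) X ->
  exists Y, exp_env P rho (1 - rho) Y /\ forall t,
    lpp_bar rho X m n t = csum X vaxis rho n t + csum Y haxis (1 - rho) m t /\
    lpp_bar rho X m n t = csum X haxis (1 - rho) m t + csum Y vaxis rho n t.
Proof.
move=> r01 eX; have [Y [eY sY]] := burke m n r01 eX.
exists Y; split => // t; have [_ h2 h3 _ _] := sY t.
have tel (a : nat -> R) k y : (forall i, (i < k)%N -> y i = a i.+1 - a i) ->
    \sum_(i < k) y i = a k - a 0%N.
  move=> ya; rewrite (eq_bigr (fun i : 'I_k => a i.+1 - a i)); last first.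
    by move=> i _; rewrite ya.
  by rewrite -(big_mkord xpredT (fun i => a i.+1 - a i)) telescope_sumr.
have csE (f : nat -> nat * nat) b k : csum Y f b k t = \sum_(i < k) Y (f i) t - k%:R / b.
  by rewrite /csum sumrB sumr_const card_ord mulr_natl.
rewrite (csum_vaxis X) (csum_haxis X) !csE /lpp_bar /lpp_mean.
have T1 : \sum_(i < m) Y (haxis i) t = lpp (weights X t) m n - lpp (weights X t) 0 n.
  exact: (tel (fun i => lpp (weights X t) i n) m (fun i => Y (haxis i) t) (fun i im => h2 i isT im)).
have T2 : \sum_(j < n) Y (vaxis j) t = lpp (weights X t) m n - lpp (weights X t) m 0.
  exact: (tel (fun j => lpp (weights X t) m j) n (fun j => Y (vaxis j) t) (fun j jn => h3 j jn)).
rewrite T1 T2.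
by split; ring.
Qed.

Lemma pow4_add (a b : R) : (a + b) ^+ 4 <= 8 * (a ^+ 4 + b ^+ 4).
Proof.
have h (x y : R) : (x + y) ^+ 2 <= 2 * (x ^+ 2 + y ^+ 2).
  rewrite -subr_ge0 [X in 0 <= X](_ : _ = (x - y) ^+ 2) ?sqr_ge0//; ring.
have -> : (a + b) ^+ 4 = ((a + b) ^+ 2) ^+ 2 by rewrite -exprM.
apply: (@le_trans _ _ ((2 * (a ^+ 2 + b ^+ 2)) ^+ 2)).
  apply: lerXn2r (h a b); rewrite nnegrE ?sqr_ge0//.
  by rewrite mulr_ge0 ?addr_ge0 ?sqr_ge0.
rewrite exprMn; apply: (le_trans (ler_wpM2l _ (h _ _))); first by rewrite sqr_ge0.
by rewrite le_eqVlt; apply/orP; left; apply/eqP; ring.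
Qed.

Lemma integral_pow4_add (f g : T -> R) (a b : R) :
  measurable_fun setT f -> measurable_fun setT g ->
  (\int[P]_t ((f t) ^+ 4)%:E <= a%:E)%E -> (\int[P]_t ((g t) ^+ 4)%:E <= b%:E)%E ->
  (\int[P]_t ((f t + g t) ^+ 4)%:E <= (8 * (a + b))%:E)%E.
Proof.
move=> mf mg fa gb.
have m4 (h : T -> R) : measurable_fun setT h -> measurable_fun setT (fun t => ((h t) ^+ 4)%:E).
  by move=> mh; apply/measurable_EFinP; exact: measurable_funX.
have p0 (x : R) : (0 <= (x ^+ 4)%:E)%E by rewrite lee_fin exprn_even_ge0.
apply: (@le_trans _ _ (\int[P]_t (8%:E * (((f t) ^+ 4)%:E + ((g t) ^+ 4)%:E)))%E).
  apply: ge0_le_integral => //.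
  - apply: m4; exact: measurable_funD.
  - apply: emeasurable_funM => //; apply: emeasurable_funD; exact: m4.
  - by move=> t _; rewrite -EFinD -EFinM lee_fin pow4_add.
rewrite ge0_integralZl//; last 2 first.
- by apply: emeasurable_funD; exact: m4.
- by move=> t _; rewrite adde_ge0.
rewrite ge0_integralD//; last 2 first.
- exact: m4.
- exact: m4.
rewrite EFinM EFinD; apply: lee_wpmul2l; first by rewrite lee_fin.
exact: (leeD fa gb).
Qed.

(** The two sums of the decomposition are dependent, so their fourth moments are combined by
    convexity. The resulting quadratic order in the size is all that the exit estimate uses. *)
Lemma lpp_bar_pow4 rho X m n : 0 < rho < 1 -> exp_env P rho (1 - rho) X ->
  (\int[P]_t ((lpp_bar rho X m n t) ^+ 4)%:E <=
   (8 * (13 * n%:R ^+ 2 * rho^-1 ^+ 4 + 13 * m%:R ^+ 2 * (1 - rho)^-1 ^+ 4))%:E)%E.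
Proof.
move=> r01 eX; have [Y [eY h]] := stationary_decomposition m n r01 eX.
have /andP[r0 r1] := r01; have r1' : 0 < 1 - rho by rewrite subr_gt0.
have [[mX indX] X0] := eX; have [[mY indY] Y0] := eY.
rewrite (_ : (fun t => _) = (fun t => ((csum X vaxis rho n t + csum Y haxis (1 - rho) m t) ^+ 4)%:E)); last first.
  by apply/funext => t; rewrite (h t).1.
apply: integral_pow4_add.
- exact: (measurable_csum indX).
- exact: (measurable_csum indY).
- exact: (csum_pow4 indX X0 r0 vaxis_inj (env_law_vaxis _ _ _)).
- exact: (csum_pow4 indY Y0 r1' haxis_inj (env_law_haxis _ _ _)).
Qed.

Lemma measurable_weights a b X i j : exp_env P a b X ->
  measurable_fun setT (fun t => weights X t i j).
Proof. by move=> [[m0 [mX _]] _]; exact: mX. Qed.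

Lemma measurable_lpp_bar a b rho X m n : exp_env P a b X ->
  measurable_fun setT (lpp_bar rho X m n).
Proof.
move=> eX; apply: measurable_funB => //.
by apply: (measurable_lpp (w := fun i j t => weights X t i j)) => i j; exact: measurable_weights eX.
Qed.

Lemma sqint_lpp_bar rho X m n : 0 < rho < 1 -> exp_env P rho (1 - rho) X ->
  sqint P (lpp_bar rho X m n).
Proof.
move=> r01 eX; have [Y [eY h]] := stationary_decomposition m n r01 eX.
have /andP[r0 r1] := r01; have r1' : 0 < 1 - rho by rewrite subr_gt0.
have [[mX indX] X0] := eX; have [[mY indY] Y0] := eY.
rewrite (_ : lpp_bar _ _ _ _ = (fun t => csum X vaxis rho n t + csum Y haxis (1 - rho) m t)); last first.
  by apply/funext => t; rewrite (h t).1.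
apply: sqintD.
- exact: (sqint_csum indX X0 r0 vaxis_inj (env_law_vaxis _ _ _)).
- exact: (sqint_csum indY Y0 r1' haxis_inj (env_law_haxis _ _ _)).
Qed.

(* Expanding twice the square of L = W + N = S + E leaves the covariance of
   the bottom increments S with L. *)
Lemma lpp_bar_sqr rho X m n : 0 < rho < 1 -> exp_env P rho (1 - rho) X ->
  \int[P]_t ((lpp_bar rho X m n t) ^+ 2) =
  n%:R / rho ^+ 2 - m%:R / (1 - rho) ^+ 2 +
  2 * \int[P]_t (csum X haxis (1 - rho) m t * lpp_bar rho X m n t).
Proof.
move=> r01 eX; have [Y [eY h]] := stationary_decomposition m n r01 eX.
have /andP[r0 r1] := r01; have r1' : 0 < 1 - rho by rewrite subr_gt0.
have [[mX indX] X0] := eX; have [[mY indY] Y0] := eY.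
have sW := sqint_csum indX X0 r0 vaxis_inj (env_law_vaxis _ _ _) n.
have sS := sqint_csum indX X0 r1' haxis_inj (env_law_haxis _ _ _) m.
have sE := sqint_csum indY Y0 r0 vaxis_inj (env_law_vaxis _ _ _) n.
have sN := sqint_csum indY Y0 r1' haxis_inj (env_law_haxis _ _ _) m.
have sL := sqint_lpp_bar m n r01 eX.
have zero Z mZ (indZ : indep_family P (env_law rho (1 - rho) mZ) Z) :
    (forall z t, 0 <= Z z t) ->
    \int[P]_t (csum Z haxis (1 - rho) m t * csum Z vaxis rho n t) = 0.
  move=> Z0.
  apply: (Rintegral_csum_indep indZ Z0 r1' (env_law_haxis _ _ _) (D := fun z => z.2 != 0%N)) => //.
    exact: measurable_cylinders_csum.
  exact: (sqint_csum indZ Z0 r0 vaxis_inj (env_law_vaxis _ _ _)).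
have sq2 Z f b k (b0 : 0 < b) mZ (indZ : indep_family P (env_law rho (1 - rho) mZ) Z) :
    (forall z t, 0 <= Z z t) -> injective f ->
    (forall i, env_law rho (1 - rho) mZ (f i) = exponential_prob b) ->
    \int[P]_t (csum Z f b k t ^+ 2) = k%:R / b ^+ 2.
  move=> Z0 fi fE; rewrite /Rintegral (csum_sqr indZ Z0 b0 fi fE)/=.
  by rewrite exprVn.
set W := csum X vaxis rho n in sW *.
set S := csum X haxis (1 - rho) m in sS *.
set E := csum Y vaxis rho n in sE *.
set N := csum Y haxis (1 - rho) m in sN *.
set L := lpp_bar rho X m n in sL *.
(* The bracket N E + S L - S W equals N (E + S) = N L, and W^2 - N^2 + 2 N L = L^2. In this form N E
   and S W have mean zero, since the two axes of one environment are independent. *)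
rewrite (_ : (fun t => L t ^+ 2) = (fun t => (W t ^+ 2 - N t ^+ 2) +
   2 * ((N t * E t + S t * L t) - S t * W t))); last first.
  apply/funext => t; have [h1 h2] := h t.
  rewrite -/L -/W -/N -/S -/E in h1 h2.
  have eE : E t = W t + N t - S t by rewrite -h1 h2; ring.
  by rewrite eE h1; ring.
have iNE := sqint_mul sN sE; have iSL := sqint_mul sS sL; have iSW := sqint_mul sS sW.
have iadd (f g : T -> R) : P.-integrable setT (EFin \o f) -> P.-integrable setT (EFin \o g) ->
    P.-integrable setT (EFin \o (fun t => f t + g t)).
  by move=> i1 i2; rewrite /comp; under eq_fun do rewrite EFinD; exact: integrableD.
have isub (f g : T -> R) : P.-integrable setT (EFin \o f) -> P.-integrable setT (EFin \o g) ->
    P.-integrable setT (EFin \o (fun t => f t - g t)).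
  by move=> i1 i2; rewrite /comp; under eq_fun do rewrite EFinB; exact: integrableB.
have imul c (f : T -> R) : P.-integrable setT (EFin \o f) ->
    P.-integrable setT (EFin \o (fun t => c * f t)).
  by move=> i1; rewrite /comp; under eq_fun do rewrite EFinM; exact: integrableZl.
have iWN := isub _ _ sW.2 sN.2.
have i1 := iadd _ _ iNE iSL; have i2 := isub _ _ i1 iSW.
rewrite RintegralD//; last exact: imul.
rewrite RintegralZl// RintegralB//; [|exact: sW.2|exact: sN.2].
rewrite RintegralB// RintegralD//.
rewrite (zero Y mY)// (zero X mX)//.
rewrite (sq2 X vaxis rho n r0 mX)//; last exact: vaxis_inj.
rewrite (sq2 Y haxis (1 - rho) m r1' mY)//; last exact: haxis_inj.
by rewrite add0r subr0.
Qed.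

End StationaryVariance.

(** The derivative in p of x/(1-p) + y/p at p = rho is x/(1-rho)^2 - y/rho^2, at most -kappa N under
    the gap condition. A small increase of the parameter thus lowers the mean linearly in N,
    uniformly in x and y. *)
Lemma mean_gap (R : realType) (rho kappa : R) : 0 < rho < 1 -> 0 < kappa ->
  exists rho' c, [/\ rho < rho', rho' < 1, 0 < c & forall N x y : R,
    0 <= x -> x <= N -> 0 <= y -> y <= N ->
    kappa * N <= y / rho ^+ 2 - x / (1 - rho) ^+ 2 ->
    c * N <= (x / (1 - rho) + y / rho) - (x / (1 - rho') + y / rho')].
Proof.
move=> /andP[r0 r1] k0; pose s := 1 - rho; have s0 : 0 < s by rewrite subr_gt0.
(* [A * N] bounds the second-order remainder per unit of [dl^2]. The choice [dl * A <= kappa / 2]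
   keeps half of the first-order gain, and [dl <= s / 2] keeps the new parameter below 1. *)
pose A := rho^-1 ^+ 3 + 2 * s^-1 ^+ 3.
have ri0 : 0 < rho^-1 by rewrite invr_gt0.
have si0 : 0 < s^-1 by rewrite invr_gt0.
have A0 : 0 < A by rewrite addr_gt0 ?mulr_gt0 ?exprn_gt0.
pose dl := Num.min (s / 2) (kappa / (2 * A)).
have dl0 : 0 < dl by rewrite lt_min !divr_gt0// mulr_gt0.
have dls : dl <= s / 2 by rewrite ge_min lexx.
have dlA : dl * A <= kappa / 2.
  have : dl <= kappa / (2 * A) by rewrite ge_min lexx orbT.
  by rewrite invfM mulrA ler_pdivlMr.
exists (rho + dl), (dl * kappa / 2); split.
- by rewrite ltrDl.
- by move: dls; rewrite /s; lra.
- by rewrite divr_gt0// mulr_gt0.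
move=> N x y x0 xN y0 yN gap.
have rd0 : 0 < rho + dl by rewrite addr_gt0.
have sd0 : 0 < s - dl by move: dls s0; lra.
have -> : 1 - (rho + dl) = s - dl by rewrite /s opprD addrA.
rewrite -/s in gap *.
have a1 : rho^-1 - dl * rho^-1 ^+ 2 <= (rho + dl)^-1.
  rewrite -subr_ge0 [X in 0 <= X](_ : _ = dl ^+ 2 * rho^-1 ^+ 2 * (rho + dl)^-1).
    by rewrite mulr_ge0 ?invr_ge0 ?(ltW rd0)// mulr_ge0 ?sqr_ge0.
  by field; rewrite !gt_eqF.
have a2 : (s - dl)^-1 <= s^-1 + 2 * dl * s^-1 ^+ 2.
  rewrite -subr_ge0 [X in 0 <= X](_ : _ = 2 * dl * (s / 2 - dl) * s^-1 ^+ 2 * (s - dl)^-1).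
    rewrite mulr_ge0 ?invr_ge0 ?(ltW sd0)// mulr_ge0 ?sqr_ge0//.
    by rewrite mulr_ge0 ?subr_ge0// mulr_ge0// ltW.
  by field; rewrite !gt_eqF.
have -> : x / s + y / rho - (x / (s - dl) + y / (rho + dl)) =
    dl * (y * rho^-1 * (rho + dl)^-1 - x * s^-1 * (s - dl)^-1).
  by field; rewrite !gt_eqF.
have b1 : y * rho^-1 * (rho^-1 - dl * rho^-1 ^+ 2) <= y * rho^-1 * (rho + dl)^-1.
  by rewrite ler_wpM2l// mulr_ge0// ltW.
have b2 : x * s^-1 * (s - dl)^-1 <= x * s^-1 * (s^-1 + 2 * dl * s^-1 ^+ 2).
  by rewrite ler_wpM2l// mulr_ge0// ltW.
have b3 : y * rho^-1 ^+ 3 <= N * rho^-1 ^+ 3 by rewrite ler_wpM2r// exprn_ge0// ltW.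
have b4 : x * s^-1 ^+ 3 <= N * s^-1 ^+ 3 by rewrite ler_wpM2r// exprn_ge0// ltW.
have N0 : 0 <= N by exact: le_trans xN.
have b5 : N * (dl * A) <= N * (kappa / 2) by rewrite ler_wpM2l.
rewrite -mulrA -mulrA ler_pM2l//.
apply: le_trans (lerB b1 b2).
have e1 : y * rho^-1 * (rho^-1 - dl * rho^-1 ^+ 2) - x * s^-1 * (s^-1 + 2 * dl * s^-1 ^+ 2)
   = (y / rho ^+ 2 - x / s ^+ 2) - dl * (y * rho^-1 ^+ 3 + 2 * (x * s^-1 ^+ 3)).
  by field; rewrite !gt_eqF.
rewrite e1.
have b6 : dl * (y * rho^-1 ^+ 3 + 2 * (x * s^-1 ^+ 3)) <= N * (dl * A).
  have -> : N * (dl * A) = dl * (N * rho^-1 ^+ 3 + 2 * (N * s^-1 ^+ 3)) by rewrite /A; ring.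
  rewrite ler_pM2l//; lra.
lra.
Qed.

Lemma mul_cube_le (R : realType) (a b : R) : 0 <= a -> 0 <= b -> a * b ^+ 3 <= a ^+ 4 + b ^+ 4.
Proof.
move=> a0 b0; have [ab|ba] := leP a b.
  apply: (@le_trans _ _ (b * b ^+ 3)); first by rewrite ler_wpM2r// exprn_ge0.
  by rewrite -exprS lerDr exprn_ge0.
apply: (@le_trans _ _ (a * a ^+ 3)).
  by rewrite ler_wpM2l// lerXn2r ?nnegrE// ltW.
by rewrite -exprS lerDl exprn_ge0.
Qed.

(* If the geodesic leaves along the horizontal axis then L is at most the passage
   time L' of the stationary model of a larger parameter rho', whose horizontal
   weights are larger; yet the mean of L' is smaller by an amount of order N, so
   that fourth moments make this event unlikely. *)
Lemma stationary_exit (R : realType) (rho kappa : R) : 0 < rho < 1 -> 0 < kappa ->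
  exists K, 0 <= K /\ forall (N : R) (m n : nat), 1 <= N -> m%:R <= N -> n.+1%:R <= N ->
  kappa * N <= n.+1%:R / rho ^+ 2 - m%:R / (1 - rho) ^+ 2 ->
  forall (d : measure_display) (T : measurableType d) (P : probability T R)
    (X : nat * nat -> T -> R), exp_env P rho (1 - rho) X ->
  \int[P]_t ((lpp_bar rho X m n.+1 t) ^+ 2) <=
     n.+1%:R / rho ^+ 2 - m%:R / (1 - rho) ^+ 2 + K /\
  (P [set t | Lup (weights X t) m n != lpp (weights X t) m n.+1] <= (K / N ^+ 2)%:E)%E.
Proof.
move=> r01 k0; have /andP[r0 r1] := r01; have s0 : 0 < 1 - rho by rewrite subr_gt0.
have [rho' [c [rr' r'1 c0 gap]]] := mean_gap r01 k0.
have r'0 : 0 < rho' by exact: lt_trans rr'.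
have s'0 : 0 < 1 - rho' by rewrite subr_gt0.
have r'01 : 0 < rho' < 1 by rewrite r'0.
(* Roles of the constants: [C0 * N] bounds the mean of L, and [C1 * Q] bounds L - U on the exit
   event. [Bf p * N^2], [BS * N^2] and [B * N^2] bound the fourth moments of a centred passage time,
   of S and of Q. [K1] bounds the covariance and [K2] the exit probability. *)
pose C0 := (1 - rho)^-1 + rho^-1.
have C00 : 0 <= C0 by rewrite addr_ge0// invr_ge0 ltW.
pose C1 := 1 + C0 / c.
have C10 : 0 <= C1 by rewrite addr_ge0// divr_ge0// ltW.
pose Bf (p : R) := 8 * (13 * p^-1 ^+ 4 + 13 * (1 - p)^-1 ^+ 4).
have Bf0 p : 0 <= Bf p by rewrite mulr_ge0// addr_ge0// mulr_ge0// exprn_even_ge0.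
pose B := 8 * (Bf rho + Bf rho').
have B0 : 0 <= B by rewrite mulr_ge0// addr_ge0.
pose BS := 13 * (1 - rho)^-1 ^+ 4.
have BS0 : 0 <= BS by rewrite mulr_ge0// exprn_even_ge0.
pose K1 := C1 / c ^+ 2 * (BS + B).
have K10 : 0 <= K1 by rewrite !mulr_ge0// ?addr_ge0// invr_ge0 sqr_ge0.
pose K2 := B / c ^+ 4.
have K20 : 0 <= K2 by rewrite mulr_ge0// invr_ge0 exprn_even_ge0.
exists (2 * K1 + K2); split; first by rewrite addr_ge0// mulr_ge0.
move=> N m n N1 mN nN hgap d T P X eX.
have N0 : 0 < N by exact: lt_le_trans N1.
have eX' : exp_env P rho' (1 - rho') (rescale (rho / rho') ((1 - rho) / (1 - rho')) X).
  exact: exp_env_rescale.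
set X' := rescale _ _ X in eX'.
pose L t := lpp (weights X t) m n.+1; pose U t := Lup (weights X t) m n.
pose L' t := lpp (weights X' t) m n.+1.
pose Lb := lpp_bar rho X m n.+1; pose Lb' := lpp_bar rho' X' m n.+1.
pose S := csum X haxis (1 - rho) m.
pose Q t := `|Lb t| + `|Lb' t|.
have [[m0 indX] X0] := eX.
have Q0 t : 0 <= Q t by rewrite addr_ge0.
have UL t : U t <= L t by exact: Lup_le_lpp.
have U0 t : 0 <= U t.
  rewrite /U /Lup addr_ge0 ?X0// lpp_ge0// => i j; exact: X0.
(* Rescaling enlarges the horizontal weights but shrinks the vertical ones; the comparison is valid
   because L is then attained by a path that starts to the right. *)
have LL' t : U t != L t -> L t <= L' t.
  case: m @L @U @L' @Lb @Lb' @S @Q Q0 UL U0 mN hgap => [|m] L U L' Lb Lb' S Q Q0 UL U0 mN hgap.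
    by rewrite /U /L Lup_sum lpp0l eqxx.
  rewrite /U /L lpp_max_first_step maxEle; case: ifPn => [_ _|]; last by rewrite eqxx.
  apply: le_trans (Lright_le_lpp _ _ _).
  apply: le_Lright => i j; rewrite /weights /X' /rescale /=.
  case: ifP => _; last by rewrite mul1r.
  by rewrite ler_peMl ?X0// ler_pdivlMr// mul1r lerB// ltW.
have m0' : (0 : R) <= m%:R by []. have n0' : (0 : R) <= n.+1%:R by [].
have gapN := gap N _ _ m0' mN n0' nN hgap.
(* As L <= L' while the mean of L exceeds that of L' by at least c N, one of the two centred passage
   times must be large. *)
have QN t : U t != L t -> c * N <= Q t.
  move=> /LL' LLt; apply: (le_trans gapN).
  have e1 : Lb t = L t - (m%:R / (1 - rho) + n.+1%:R / rho) by [].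
  have e2 : Lb' t = L' t - (m%:R / (1 - rho') + n.+1%:R / rho') by [].
  have := ler_norm (Lb' t); have : - Lb t <= `|Lb t| by rewrite -normrN ler_norm.
  rewrite /Q; lra.
have mean_le : m%:R / (1 - rho) + n.+1%:R / rho <= C0 * N.
  have h1 : m%:R / (1 - rho) <= N / (1 - rho) by rewrite ler_pM2r ?invr_gt0.
  have h2 : n.+1%:R / rho <= N / rho by rewrite ler_pM2r ?invr_gt0.
  by rewrite /C0; move: h1 h2; lra.
have DQ t : U t != L t -> L t - U t <= C1 * Q t.
  move=> ne; have hq := QN t ne.
  have e1 : Lb t = L t - (m%:R / (1 - rho) + n.+1%:R / rho) by [].
  have h1 : Lb t <= Q t by rewrite /Q (le_trans (ler_norm _))// lerDl.
  have h2 : C0 * N <= C0 / c * Q t.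
    rewrite -mulrA ler_wpM2l// mulrC ler_pdivlMr// mulrC//.
  have := U0 t; rewrite /C1; lra.
have cN0 : 0 < c * N by rewrite mulr_gt0.
(* Off the exit event the left side vanishes. On it, L - U <= C1 Q, and the factor (Q/(cN))^2 >= 1
   can be inserted for free; this gains N^-2, which cancels the order N^2 of the fourth moments. *)
have SD t : S t * (L t - U t) <= C1 / (c * N) ^+ 2 * (S t ^+ 4 + Q t ^+ 4).
  have rhs0 : 0 <= C1 / (c * N) ^+ 2 * (S t ^+ 4 + Q t ^+ 4).
    by rewrite mulr_ge0 ?addr_ge0 ?exprn_even_ge0// divr_ge0// sqr_ge0.
  have [->|ne] := eqVneq (U t) (L t); first by rewrite subrr mulr0.
  have D0 : 0 <= L t - U t by rewrite subr_ge0.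
  apply: (@le_trans _ _ (`|S t| * (L t - U t))).
    by rewrite ler_wpM2r// ler_norm.
  have h1 : L t - U t <= C1 / (c * N) ^+ 2 * Q t ^+ 3.
    apply: (le_trans (DQ t ne)); rewrite -mulrA ler_wpM2l//.
    rewrite mulrC ler_pdivlMr ?exprn_gt0// [Q t ^+ 3]exprS ler_wpM2l//.
    by rewrite lerXn2r ?nnegrE ?(ltW cN0)// QN.
  apply: (le_trans (ler_wpM2l (normr_ge0 _) h1)).
  rewrite mulrCA ler_wpM2l ?divr_ge0 ?sqr_ge0//.
  apply: (le_trans (mul_cube_le (normr_ge0 _) (Q0 t))).
  by rewrite lerD2r -normrX ger0_norm// exprn_even_ge0.
have mLb : measurable_fun setT Lb by exact: measurable_lpp_bar eX.
have mLb' : measurable_fun setT Lb' by exact: measurable_lpp_bar eX'.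
have mS : measurable_fun setT S by exact: (measurable_csum indX).
have mQ : measurable_fun setT Q.
  by apply: measurable_funD; [exact: (measurableT_comp (@normr_measurable R setT) mLb)|
    exact: (measurableT_comp (@normr_measurable R setT) mLb')].
have m4 (f : T -> R) : measurable_fun setT f -> measurable_fun setT (fun t => ((f t) ^+ 4)%:E).
  by move=> mf; apply/measurable_EFinP; exact: measurable_funX.
have p40 (x : R) : (0 <= (x ^+ 4)%:E)%E by rewrite lee_fin exprn_even_ge0.
have sqN (k : nat) : k%:R <= N -> (k%:R : R) ^+ 2 <= N ^+ 2.
  by move=> kN; rewrite lerXn2r ?nnegrE// ltW.
have c13 (k : nat) (a : R) : k%:R <= N -> 0 <= a ->
    13 * k%:R ^+ 2 * a <= 13 * a * N ^+ 2.
  move=> kN a0; have := ler_wpM2r a0 (sqN k kN); lra.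
have Bb p Z : 0 < p < 1 -> exp_env P p (1 - p) Z ->
    (\int[P]_t ((lpp_bar p Z m n.+1 t) ^+ 4)%:E <= (Bf p * N ^+ 2)%:E)%E.
  move=> p01 eZ; apply: (le_trans (lpp_bar_pow4 m n.+1 p01 eZ)); rewrite lee_fin /Bf.
  rewrite -[leRHS]mulrA ler_wpM2l// [leRHS]mulrDl lerD//.
    by apply: c13 => //; rewrite exprn_even_ge0.
  by apply: c13 => //; rewrite exprn_even_ge0.
have iS4 : (\int[P]_t ((S t) ^+ 4)%:E <= (BS * N ^+ 2)%:E)%E.
  have := csum_pow4 indX X0 s0 haxis_inj (env_law_haxis _ _ _) m.
  move=> /le_trans; apply; rewrite lee_fin /BS.
  by apply: c13 => //; rewrite exprn_even_ge0.
have iQ4 : (\int[P]_t ((Q t) ^+ 4)%:E <= (B * N ^+ 2)%:E)%E.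
  have nrm (f : T -> R) : (\int[P]_t (`|f t| ^+ 4)%:E = \int[P]_t ((f t) ^+ 4)%:E)%E.
    by apply: eq_integral => t _; rewrite -normrX ger0_norm// exprn_even_ge0.
  have := integral_pow4_add (P := P) (a := Bf rho * N ^+ 2) (b := Bf rho' * N ^+ 2)
    (measurableT_comp (@normr_measurable R setT) mLb)
    (measurableT_comp (@normr_measurable R setT) mLb').
  rewrite -mulrDl mulrA; apply.
    by rewrite nrm; exact: Bb.
  by rewrite nrm; exact: Bb.
split; last first.
  have mA : measurable [set t | U t != L t].
    have mU : measurable_fun setT U.
      apply: (measurable_Lup (w := fun i j t => weights X t i j)) => i j.
      exact: measurable_weights eX.
    have mL : measurable_fun setT L.
      apply: (measurable_lpp (w := fun i j t => weights X t i j)) => i j.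
      exact: measurable_weights eX.
    have -> : [set t | U t != L t] = (fun t => U t == L t) @^-1` [set false].
      by apply/seteqP; split => t /=; [move/negbTE|move=> ->].
    rewrite -[_ @^-1` _]setTI; exact: (measurable_fun_eqr mU mL).
  (* Markov's inequality for Q^4, whose mean is O(N^2), against the threshold (c N)^4. *)
  rewrite (measure_integral_indic P mA).
  apply: (@le_trans _ _ (\int[P]_t (((c * N) ^+ 4)^-1%:E * ((Q t) ^+ 4)%:E))%E).
    apply: ge0_le_integral => //.
    - by apply/measurable_EFinP; exact: measurable_indic.
    - by apply: emeasurable_funM => //; exact: m4.
    - move=> t _; rewrite -EFinM lee_fin indicE; case: (boolP (t \in _)) => [|_]; last first.
        by rewrite mulr_ge0 ?exprn_even_ge0// invr_ge0 exprn_even_ge0.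
      rewrite inE/= => ne; rewrite mulrC ler_pdivlMr ?exprn_gt0// mul1r.
      by rewrite lerXn2r ?nnegrE ?(ltW cN0)// QN.
  rewrite ge0_integralZl//; last 2 first.
  - exact: m4.
  - by rewrite lee_fin invr_ge0 exprn_even_ge0.
  apply: (@le_trans _ _ (((c * N) ^+ 4)^-1%:E * (B * N ^+ 2)%:E)%E).
    by apply: lee_wpmul2l => //; rewrite lee_fin invr_ge0 exprn_even_ge0.
  rewrite -EFinM lee_fin.
  have -> : ((c * N) ^+ 4)^-1 * (B * N ^+ 2) = K2 / N ^+ 2.
    by rewrite /K2; field; rewrite !gt_eqF.
  by apply: ler_wpM2r; rewrite ?invr_ge0 ?sqr_ge0// lerDr mulr_ge0.
rewrite lpp_bar_sqr// lerD2l.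
rewrite -/S -/Lb.
suff H : \int[P]_t (S t * Lb t) <= K1 by move: H K20; lra.
(* U uses no weight of the horizontal axis, so it is independent of S, and the covariance of S with
   L reduces to the mean of S (L - U). *)
pose V t := U t - (m%:R / (1 - rho) + n.+1%:R / rho).
have sS : sqint P S := sqint_csum indX X0 s0 haxis_inj (env_law_haxis _ _ _) m.
have sLb : sqint P Lb by exact: sqint_lpp_bar.
have sL : sqint P L.
  rewrite (_ : L = fun t => Lb t + (m%:R / (1 - rho) + n.+1%:R / rho)).
    by apply: sqintD => //; exact: sqint_cst.
  by apply/funext => t; rewrite /Lb /lpp_bar /lpp_mean subrK.
pose DX : pred (nat * nat) := fun z => z.2 != 0%N.
have mUD : @measurable_fun _ _ (g_sigma_algebraType (cylinders X DX)) R setT U.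
  apply: (@measurable_Lup _ (g_sigma_algebraType (cylinders X DX)) R (fun i j t => weights X t i j)).
  by move=> i j; exact: measurable_cylinders_coord.
have sU : sqint P U.
  apply: (sqint_le _ _ sL) => [|t]; first exact: (measurable_cylinders indX mUD).
  by rewrite !ger0_norm// (le_trans (U0 t)).
have sV : sqint P V by apply: sqintB => //; exact: sqint_cst.
have sD : sqint P (fun t => L t - U t) by exact: sqintB.
have SV0 : \int[P]_t (S t * V t) = 0.
  apply: (Rintegral_csum_indep indX X0 s0 (env_law_haxis _ _ _) (D := DX)) => //.
  by apply: measurable_funB => //; exact: measurable_cst.
have iSD := sqint_mul sS sD; have iSV := sqint_mul sS sV.
rewrite (_ : (fun t => S t * Lb t) = (fun t => S t * (L t - U t) + S t * V t)); last first.
  by apply/funext => t; rewrite /V /Lb /lpp_bar /lpp_mean -/(L t); ring.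
rewrite RintegralD// SV0 addr0.
pose g t := C1 / (c * N) ^+ 2 * (S t ^+ 4 + Q t ^+ 4).
have a0 : 0 <= C1 / (c * N) ^+ 2 by rewrite divr_ge0// sqr_ge0.
have ig : (\int[P]_t (g t)%:E <= K1%:E)%E.
  rewrite /g; under eq_integral do rewrite EFinM EFinD.
  rewrite ge0_integralZl//; last 2 first.
  - by apply: emeasurable_funD; exact: m4.
  - by move=> t _; rewrite adde_ge0.
  rewrite ge0_integralD//; last 2 first.
  - exact: m4.
  - exact: m4.
  apply: (@le_trans _ _ ((C1 / (c * N) ^+ 2)%:E * (BS * N ^+ 2 + B * N ^+ 2)%:E)%E).
    rewrite EFinD; apply: lee_wpmul2l; first by rewrite lee_fin.
    exact: (leeD iS4 iQ4).
  rewrite -EFinM lee_fin le_eqVlt; apply/orP; left; apply/eqP; rewrite /K1.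
  by field; rewrite !gt_eqF.
have g0 t : 0 <= g t by rewrite mulr_ge0// addr_ge0// exprn_even_ge0.
have mg : measurable_fun setT g.
  by apply: measurable_funM => //; apply: measurable_funD; exact: measurable_funX.
have intg : P.-integrable setT (EFin \o g).
  apply/integrableP; split; first exact/measurable_EFinP.
  under eq_integral do rewrite /= ger0_norm//.
  by rewrite (le_lt_trans ig)// ltry.
apply: (@le_trans _ _ (\int[P]_t g t)).
  by apply: le_Rintegral => // t _; exact: SD.
rewrite /Rintegral -lee_fin fineK//.
exact: integrable_fin_num.
Qed.

(** * Gaussian distribution function and heat flow *)

Section Taylor.
Context {R : realType}.
Implicit Types f : R -> R.

Lemma mvt_le f f1 (a b C : R) : a <= b ->
  (forall z : R, a <= z <= b -> is_derive z 1 f (f1 z) /\ `|f1 z| <= C) ->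
  `|f b - f a| <= C * (b - a).
Proof.
move=> ab hab.
have [z | | z zab ->] := @MVT_segment R f f1 a b ab.
- by rewrite in_itv/= => /andP[az zb]; apply: (hab z _).1; rewrite !ltW.
- apply: derivable_within_continuous => z; rewrite in_itv/= => zab.
  by have [[]] := hab z zab.
- rewrite normrM (ger0_norm (_ : 0 <= b - a)) ?subr_ge0//.
  rewrite ler_wpM2r ?subr_ge0//; apply: (hab z _).2.
  by move: zab; rewrite in_itv.
Qed.

Lemma mvt_dist f f1 (x y C : R) :
  (forall z, `|z - x| <= `|y - x| -> is_derive z 1 f (f1 z) /\ `|f1 z| <= C) ->
  `|f y - f x| <= C * `|y - x|.
Proof.
move=> h.
have [xy|yx] := leP x y.
  rewrite [`|y - x|]ger0_norm ?subr_ge0//; apply: (@mvt_le f f1) => // z /andP[xz zy].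
  by apply: h; rewrite !ger0_norm ?subr_ge0// ?(le_trans xz)// lerD2r.
have e : `|y - x| = x - y by rewrite distrC ger0_norm ?subr_ge0 ?ltW.
rewrite distrC e; apply: (@mvt_le f f1) => [|z /andP[yz zx]]; first exact: ltW.
by apply: h; rewrite e distrC ger0_norm ?subr_ge0// lerD2l lerN2.
Qed.

Lemma is_derive_sub_linear f (c d1 z : R) : is_derive z 1 f d1 ->
  is_derive z 1 (fun z => f z - c * z) (d1 - c).
Proof.
move=> h; apply: (is_derive_eq (is_deriveB h (_ : is_derive z 1 (fun z => c * z) c))) => //.
by apply: is_derive_eq; rewrite /GRing.scale/= mulr1.
Qed.

(** This one-sided form serves the time variable of [heat], whose derivatives are bounded only for
    times above a positive threshold. *)
Lemma taylor1_right f f1 f2 (a b C : R) : 0 <= C -> a <= b ->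
  (forall z, a <= z <= b ->
    [/\ is_derive z 1 f (f1 z), is_derive z 1 f1 (f2 z) & `|f2 z| <= C]) ->
  `|f b - f a - f1 a * (b - a)| <= C * (b - a) ^+ 2.
Proof.
move=> C0 ab h.
have -> : f b - f a - f1 a * (b - a) = (f b - f1 a * b) - (f a - f1 a * a) by ring.
rewrite expr2 mulrA.
apply: (@mvt_le (fun z => f z - f1 a * z) (fun z => f1 z - f1 a)) => // z zab.
have [d1 _ _] := h z zab; split; first exact: is_derive_sub_linear.
move: zab => /andP[az zb].
apply: (@le_trans _ _ (C * (z - a))); last by rewrite ler_wpM2l// lerD2r.
apply: (@mvt_le f1 f2) => // t /andP[at_ tz].
by have [|_ ? ?] := h t _; [rewrite at_ (le_trans tz)|].
Qed.

Lemma taylor1 f f1 f2 (x y C : R) : 0 <= C ->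
  (forall z, `|z - x| <= `|y - x| ->
    [/\ is_derive z 1 f (f1 z), is_derive z 1 f1 (f2 z) & `|f2 z| <= C]) ->
  `|f y - f x - f1 x * (y - x)| <= C * `|y - x| ^+ 2.
Proof.
move=> C0 h.
have -> : f y - f x - f1 x * (y - x) = (f y - f1 x * y) - (f x - f1 x * x) by ring.
rewrite expr2 mulrA.
apply: (@mvt_dist (fun z => f z - f1 x * z) (fun z => f1 z - f1 x)) => z zx.
have [d1 _ _] := h z zx; split.
  exact: is_derive_sub_linear.
apply: (@le_trans _ _ (C * `|z - x|)); last by rewrite ler_wpM2l.
by apply: (@mvt_dist f1 f2) => t tz; have [_ ? ?] := h t (le_trans tz zx).
Qed.

(** Mean value estimates are nested: the derivative of the remainder is the remainder of one order
    less for the derivative. The factor 1/6 is lost on the way. *)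
Lemma taylor2 f f1 f2 f3 (x y C : R) : 0 <= C ->
  (forall z : R, [/\ is_derive z 1 f (f1 z), is_derive z 1 f1 (f2 z),
     is_derive z 1 f2 (f3 z) & `|f3 z| <= C]) ->
  `|f y - f x - f1 x * (y - x) - f2 x / 2 * (y - x) ^+ 2| <= C * `|y - x| ^+ 3.
Proof.
move=> C0 h.
have -> : f y - f x - f1 x * (y - x) - f2 x / 2 * (y - x) ^+ 2 =
    (f y - f1 x * y - f2 x / 2 * (y - x) ^+ 2) - (f x - f1 x * x - f2 x / 2 * (x - x) ^+ 2).
  by rewrite subrr; ring.
rewrite [X in _ <= _ * X]exprSr [leRHS]mulrA.
apply: (@mvt_dist (fun z => f z - f1 x * z - f2 x / 2 * (z - x) ^+ 2)
  (fun z => f1 z - f1 x - f2 x * (z - x))) => z zx.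
have [d1 d2 d3 _] := h z; split.
  have e1 : is_derive z 1 (fun z => f1 x * z) (f1 x).
    by apply: is_derive_eq; rewrite /GRing.scale/= mulr1.
  have e0 : is_derive z 1 (fun z => z - x) 1.
    by apply: is_derive_eq; rewrite subr0.
  have e2 : is_derive z 1 (fun z => f2 x / 2 * (z - x) ^+ 2) (f2 x * (z - x)).
    have e3 := @is_derive1_comp R (fun u => u ^+ 2) (fun u => u - x) z _ _ (is_derive_exprn 2 (z - x)) e0.
    have e4 := is_deriveM (is_derive_cst (f2 x / 2) z 1) e3.
    by apply: (is_derive_eq e4); rewrite /GRing.scale/= /cst/=; field.
  exact: (is_deriveB (is_deriveB d1 e1) e2).
apply: (@le_trans _ _ (C * `|z - x| ^+ 2)).
  by apply: (@taylor1 f1 f2 f3) => // t _; have [_ ? ? ?] := h t.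
by rewrite ler_wpM2l// lerXn2r ?nnegrE.
Qed.

End Taylor.

Section Gaussian.
Context {R : realType}.
Local Notation leb := (@lebesgue_measure R).

Definition gpeak : R := (Num.sqrt (2 * pi))^-1.
Definition gpdf (z : R) : R := gpeak * expR (- (z ^+ 2 / 2)).

Lemma gpeak_ge0 : 0 <= gpeak. Proof. by rewrite invr_ge0 sqrtr_ge0. Qed.

Lemma gpdfE z : gpdf z = normal_pdf 0 1 z.
Proof.
rewrite normal_pdfE ?oner_neq0// /gpdf /normal_peak /normal_fun subr0 expr1n mul1r.
by rewrite /gpeak -[pi *+ 2]mulr_natl mulNr.
Qed.

Lemma gpdf_ge0 z : 0 <= gpdf z. Proof. by rewrite gpdfE normal_pdf_ge0. Qed.

Lemma is_derive_gpdf (z : R) : is_derive z 1 gpdf (- z * gpdf z).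
Proof.
have e0 := is_deriveM (is_derive_cst (- (2^-1) : R) z 1) (is_derive_exprn 2 z).
pose g (y : R) : R := - (2^-1) * y ^+ 2.
have e1 : is_derive z 1 g (- z).
  by apply: (is_derive_eq e0); rewrite /GRing.scale/= /cst/=; field.
have e2 := @is_derive1_comp R expR g z _ _ (is_derive_expR (g z)) e1.
have e3 := is_deriveM (is_derive_cst gpeak z 1) e2.
have gE y : expR (- (y ^+ 2 / 2)) = expR (g y) by congr expR; rewrite /g; field.
have e4 : is_derive z 1 (cst gpeak * (expR \o g)) (- z * gpdf z).
  apply: (is_derive_eq e3); rewrite /GRing.scale/= /cst/= /gpdf gE.
  by move: (expR (g z)) gpeak => u v; ring.
rewrite (_ : gpdf = cst gpeak * (expR \o g)) in e4 *; first exact: e4.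
by apply/funext => y; rewrite /gpdf gE.
Qed.

Lemma gpdf_bounds z : [/\ gpdf z <= gpeak, z ^+ 2 * gpdf z <= 2 * gpeak &
  z ^+ 4 * gpdf z <= 8 * gpeak].
Proof.
have y0 : 0 <= z ^+ 2 / 2 by rewrite divr_ge0 ?sqr_ge0.
have k0 := gpeak_ge0.
have b0 : expR (- (z ^+ 2 / 2)) <= 1 by rewrite expR_le1 oppr_le0.
have E := expR_gt0 (z ^+ 2 / 2).
have mulE (a b : R) : a <= b * expR (z ^+ 2 / 2) -> a * gpdf z <= b * gpeak.
  move=> ab; rewrite /gpdf expRN mulrCA mulrC ler_wpM2r// ler_pdivrMr//.
split.
- by rewrite /gpdf ler_piMr.
- apply: mulE; have := expR_ge1Dx (z ^+ 2 / 2); lra.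
- apply: mulE; have := expR_ge1Dxn 1 y0; rewrite (_ : 2`!%:R = 2 :> R)//.
  have -> : z ^+ 4 = 4 * (z ^+ 2 / 2) ^+ 2 by field.
  lra.
Qed.

Definition gcdf (z : R) : R := \int[leb]_(t in `]-oo, z]) gpdf t.

Lemma integrable_gpdf (A : set R) : measurable A -> leb.-integrable A (EFin \o gpdf).
Proof.
move=> mA; apply: (@integrableS _ _ _ leb setT) => //.
rewrite (_ : EFin \o gpdf = fun x => (normal_pdf 0 1 x)%:E); first exact: integrable_normal_pdf.
by apply/funext => x; rewrite /= gpdfE.
Qed.

Lemma is_derive_gcdf (z : R) : is_derive z 1 gcdf (gpdf z).
Proof.
have z1 : z < z + 1 by rewrite ltrDl.
have cz : {for z, continuous gpdf}.
  have [h _] := is_derive_gpdf z.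
  by apply: differentiable_continuous; apply/derivable1_diffP.
have ig : leb.-integrable [set` `]-oo, (z + 1)]] (EFin \o gpdf) by exact: integrable_gpdf.
have [d1 d2] := continuous_FTC1 z1 ig (ltNyr _) cz.
by apply: DeriveDef; [exact: d1|rewrite -derive1E; exact: d2].
Qed.

Lemma gcdf_normal_prob z : (gcdf z)%:E = normal_prob 0 1 `]-oo, z].
Proof.
rewrite /gcdf /Rintegral fineK.
  by apply: eq_integral => x _; rewrite gpdfE.
by apply: integrable_fin_num; [|exact: integrable_gpdf].
Qed.

Lemma gcdf_ge0 z : 0 <= gcdf z.
Proof. by rewrite -lee_fin gcdf_normal_prob. Qed.

Lemma gcdf_le1 z : gcdf z <= 1.
Proof. rewrite -lee_fin gcdf_normal_prob; exact: probability_le1. Qed.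

Lemma gcdf_mono (x y : R) : x <= y -> gcdf x <= gcdf y.
Proof.
move=> xy; rewrite -lee_fin !gcdf_normal_prob le_measure ?inE//.
by apply: subset_itvl; rewrite bnd_simp.
Qed.

Lemma gcdf_tails e : 0 < e -> exists2 A, 0 < A & gcdf (- A) <= e /\ 1 - e <= gcdf A.
Proof.
move=> e0.
(* [gcdf] is the distribution function of the identity under the standard normal law, so the general
   limits of distribution functions at infinity apply. *)
pose N := @normal_prob R 0 1.
have mid : @measurable_fun _ _ (measurableTypeR R) R setT (fun x => x) by exact: measurable_id.
pose X : {RV N >-> R} := HB.pack (fun x : measurableTypeR R => x : R) (isMeasurableFun.Build _ _ _ _ _ mid).
have cE z : cdf X z = (gcdf z)%:E by rewrite gcdf_normal_prob.
have gE : gcdf = fine \o cdf X by apply/funext => z; exact: (congr1 fine (esym (cE z))).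
have g1 : gcdf z @[z --> +oo] --> (1 : R).
  by rewrite gE; exact: (fine_cvg (cvg_cdfy1 X)).
have g0 : gcdf (- z) @[z --> +oo] --> (0 : R).
  have : gcdf z @[z --> -oo] --> (0 : R) by rewrite gE; exact: (fine_cvg (cvg_cdfNy0 X)).
  by rewrite cvgNy_compNP.
move/cvgrPdist_le : g1 => /(_ e e0) g1; move/cvgrPdist_le : g0 => /(_ e e0) g0.
near (pinfty_nbhs R) => A.
exists A; first by near: A; exact: nbhs_pinfty_gt.
split.
  have : `|0 - gcdf (- A)| <= e by near: A.
  by rewrite sub0r normrN ger0_norm// gcdf_ge0.
have : `|1 - gcdf A| <= e by near: A.
by rewrite ger0_norm ?subr_ge0 ?gcdf_le1// lerBlDr -lerBlDl.
Unshelve. all: by end_near. Qed.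

Lemma integral_gaussian_tail (v a : R) : 0 < v ->
  (\int[leb]_(x in `[a, +oo[) (expR (- (x ^+ 2) / (2 * v)) / Num.sqrt (2 * pi * v))%:E =
   (1 - gcdf (a / Num.sqrt v))%:E)%E.
Proof.
move=> v0; set c := Num.sqrt v; have c0 : 0 < c by rewrite sqrtr_gt0.
have c2 : c ^+ 2 = v by rewrite sqr_sqrtr// ltW.
pose g (x : R) := expR (- (x ^+ 2) / (2 * v)) / Num.sqrt (2 * pi * v).
pose f : R -> \bar R := (EFin \o g) \_ `[a, +oo[.
pose h : R -> \bar R := (EFin \o gpdf) \_ `[(a / c), +oo[.
have mgpdf : measurable_fun setT gpdf.
  have := @measurable_normal_pdf R 0 1.
  by apply: eq_measurable_fun => x _; rewrite gpdfE.
have mg : measurable_fun setT g.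
  apply: measurable_funM => //; apply: measurableT_comp => //.
  apply: measurable_funM => //; apply: measurableT_comp => //; exact: measurable_funX.
have f0 x : (0 <= f x)%E.
  by rewrite /f patchE; case: ifP => _ //; rewrite lee_fin divr_ge0 ?expR_ge0 ?sqrtr_ge0.
have h0 x : (0 <= h x)%E.
  by rewrite /h patchE; case: ifP => _ //; rewrite lee_fin gpdf_ge0.
have fE y : f (c * y) = ((c^-1)%:E * h y)%E.
  rewrite /f /h !patchE !mem_setE !in_itv/= !andbT ler_pdivrMr// [y * c]mulrC.
  case: ifP => _; last by rewrite mule0.
  rewrite -EFinM; congr EFin.
  rewrite /g /gpdf /gpeak sqrtrM ?mulr_ge0 ?pi_ge0// -/c exprMn c2.
  have -> : - (v * y ^+ 2) / (2 * v) = - (y ^+ 2 / 2) by field; rewrite gt_eqF.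
  by rewrite invfM; ring.
have mf : measurable_fun setT f.
  by apply/measurable_restrict => //; apply: measurable_funTS; exact/measurable_EFinP.
have mh : measurable_fun setT h.
  by apply/measurable_restrict => //; apply: measurable_funTS; exact/measurable_EFinP.
have E := ge0_integral_scale c0 mf f0.
have E2 : (\int[leb]_x f (c * x)%R = (c^-1)%:E * \int[leb]_x h x)%E.
  rewrite -ge0_integralZl//; last by rewrite lee_fin invr_ge0 ltW.
  by apply: eq_integral => x _; rewrite fE.
rewrite integral_mkcond -/g -/f.
have -> : (\int[leb]_x f x = \int[leb]_x h x)%E.
  have := congr1 (fun u => c%:E * u)%E (etrans (esym E) E2).
  by rewrite !muleA -EFinM divff ?gt_eqF// !mul1e.
rewrite /h -integral_mkcond EFinB gcdf_normal_prob.
have NE (A : set R) : measurable A -> (\int[leb]_(x in A) (gpdf x)%:E = normal_prob 0 1 A)%E.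
  by move=> mA; apply: eq_integral => x _; rewrite gpdfE.
rewrite (NE _ _)//.
have := @probability_setC _ _ _ (@normal_prob R 0 1) `]-oo, (a / c)[%classic.
rewrite setCitvl => -> //.
congr (1 - _)%E; rewrite -[LHS]NE// -[RHS]NE//.
rewrite integral_itv_bndo_bndc//; apply/measurable_EFinP; exact: measurable_funTS.
Qed.

End Gaussian.

Section HeatKernel.
Context {R : realType}.
Local Notation k := (@gpeak R).

(* P(sqrt s G <= y) for a standard Gaussian G; it solves the heat equation. *)
Definition heat (s y : R) : R := gcdf (y / Num.sqrt s).

Lemma is_derive_gpdf2 (z : R) :
  is_derive z 1 (fun y => - y * gpdf y) ((z ^+ 2 - 1) * gpdf z).
Proof.
have e0 : is_derive z 1 (fun y : R => - y) (- 1) by apply: is_derive_eq.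
apply: (is_derive_eq (is_deriveM e0 (is_derive_gpdf z))).
by rewrite /GRing.scale/=; ring.
Qed.

(** Odd powers are reduced to even ones by 2|z| <= 1 + z^2 and 2|z|^3 <= z^2 + z^4. In order, the
    bounds control the first time derivative of [heat], the third derivative of [gcdf] and the
    second time derivative of [heat]. *)
Lemma gpdf_moments (z : R) : [/\ `|z| * gpdf z <= 3 / 2 * k,
  `|(z ^+ 2 - 1) * gpdf z| <= 3 * k & `|3 * z - z ^+ 3| * gpdf z <= 12 * k].
Proof.
have [b0 b2 b4] := gpdf_bounds z; have g0 := gpdf_ge0 z.
have z1 : `|z| <= (1 + z ^+ 2) / 2.
  rewrite -real_normK ?num_real//; move: `|z| => a; rewrite -subr_ge0.
  rewrite [X in 0 <= X](_ : _ = (a - 1) ^+ 2 / 2); last by field.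
  by rewrite divr_ge0 ?sqr_ge0.
have z3 : `|z| ^+ 3 <= (z ^+ 2 + z ^+ 4) / 2.
  rewrite -(real_normK (num_real z)) (_ : z ^+ 4 = `|z| ^+ 4); last first.
    by rewrite -normrX ger0_norm// exprn_even_ge0.
  move: `|z| => a; rewrite -subr_ge0.
  rewrite [X in 0 <= X](_ : _ = a ^+ 2 * (a - 1) ^+ 2 / 2); last by field.
  by rewrite divr_ge0// mulr_ge0 ?sqr_ge0.
have w1 := ler_wpM2r g0 z1; have w3 := ler_wpM2r g0 z3.
split.
- apply: (le_trans w1); move: b0 b2; lra.
- rewrite normrM (ger0_norm g0).
  have h : `|z ^+ 2 - 1| <= z ^+ 2 + 1.
    by apply: (le_trans (ler_normB _ _)); rewrite normr1 ger0_norm// sqr_ge0.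
  apply: (le_trans (ler_wpM2r g0 h)); move: b0 b2; lra.
- have h : `|3 * z - z ^+ 3| <= 3 * `|z| + `|z| ^+ 3.
    by apply: (le_trans (ler_normB _ _)); rewrite normrM normrX ger0_norm.
  apply: (le_trans (ler_wpM2r g0 h)); move: w1 w3 b0 b2 b4; lra.
Qed.

Lemma gcdf_taylor (x y : R) :
  `|gcdf y - gcdf x - gpdf x * (y - x) - (- x * gpdf x) / 2 * (y - x) ^+ 2|
    <= 3 * k * `|y - x| ^+ 3.
Proof.
apply: (@taylor2 R gcdf gpdf (fun z => - z * gpdf z) (fun z => (z ^+ 2 - 1) * gpdf z)).
  by rewrite mulr_ge0// gpeak_ge0.
move=> z; split; [exact: is_derive_gcdf|exact: is_derive_gpdf|exact: is_derive_gpdf2|].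
by have [] := gpdf_moments z.
Qed.

Lemma is_derive_div_sqrt (y s : R) : 0 < s ->
  is_derive s 1 (fun s => y / Num.sqrt s) (- (y / Num.sqrt s) / (2 * s)).
Proof.
move=> s0; have q0 : 0 < Num.sqrt s by rewrite sqrtr_gt0.
have e1 := @is_deriveV R Num.sqrt s _ _ (lt0r_neq0 q0) (is_derive1_sqrt s0).
have e2 := is_deriveM (is_derive_cst y s 1) e1.
apply: (is_derive_eq e2); rewrite /GRing.scale/= /cst/= mulr0 addr0.
have : s = Num.sqrt s ^+ 2 by rewrite sqr_sqrtr// ltW.
by move: (Num.sqrt s) q0 => q q0 ->; field; rewrite gt_eqF.
Qed.

(** The time derivative of [heat], which is also half of its second derivative in space. *)
Definition heat_t (y s : R) : R := - (y / Num.sqrt s) * gpdf (y / Num.sqrt s) / (2 * s).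

Lemma is_derive_heat (y s : R) : 0 < s -> is_derive s 1 (fun s => heat s y) (heat_t y s).
Proof.
move=> s0.
have e := @is_derive1_comp R gcdf (fun s => y / Num.sqrt s) s _ _
  (is_derive_gcdf _) (is_derive_div_sqrt y s0).
apply: (is_derive_eq e); rewrite /heat_t.
by move: (y / Num.sqrt s) => z; field; rewrite gt_eqF.
Qed.

Lemma is_derive_heat_t (y s : R) : 0 < s -> is_derive s 1 (heat_t y)
  ((3 * (y / Num.sqrt s) - (y / Num.sqrt s) ^+ 3) * gpdf (y / Num.sqrt s) / (4 * s ^+ 2)).
Proof.
move=> s0.
have e1 := @is_derive1_comp R (fun z => - z * gpdf z) (fun s => y / Num.sqrt s) s _ _
  (is_derive_gpdf2 _) (is_derive_div_sqrt y s0).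
have e2 : is_derive s 1 (fun s : R => (2 * s)^-1) (- (2 * s ^+ 2)^-1).
  have e3 : is_derive s 1 (fun s : R => 2 * s) 2.
    by apply: is_derive_eq; rewrite /GRing.scale/= mulr1.
  have s2 : 2 * s != 0 by rewrite mulf_neq0// gt_eqF.
  apply: (is_derive_eq (is_deriveV s2 e3)); rewrite /GRing.scale/=.
  by field; rewrite gt_eqF.
apply: (is_derive_eq (is_deriveM e1 e2)); rewrite /GRing.scale/=.
move: (y / Num.sqrt s) => z; move: (gpdf z) => g.
by field; rewrite gt_eqF.
Qed.

(** The same [B] is the quadratic coefficient in space and the linear one in time: this is the heat
    equation. The lower bound on the time makes [C] uniform in [s] and [y]. *)
Lemma heat_step (e : R) : 0 < e -> exists2 C, 0 <= C & forall s y, e <= s ->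
  exists A B, (forall h, `|heat s (y + h) - heat s y - A * h - B * h ^+ 2| <= C * `|h| ^+ 3) /\
    (forall dl, 0 <= dl -> `|heat (s + dl) y - heat s y - B * dl| <= C * dl ^+ 2).
Proof.
move=> e0; have k0 := @gpeak_ge0 R.
have se0 : 0 < Num.sqrt e by rewrite sqrtr_gt0.
pose C1 := 3 * k * (Num.sqrt e)^-1 ^+ 3; pose C2 := 3 * k / e ^+ 2.
have C10 : 0 <= C1 by rewrite mulr_ge0 ?mulr_ge0// exprn_ge0// invr_ge0 ltW.
have C20 : 0 <= C2 by apply: divr_ge0; [apply: mulr_ge0|exact: sqr_ge0].
exists (C1 + C2) => [|s y es]; first by rewrite addr_ge0.
have s0 : 0 < s by exact: lt_le_trans es.
set b := (Num.sqrt s)^-1; set z := y / Num.sqrt s.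
have b0 : 0 < b by rewrite invr_gt0 sqrtr_gt0.
have be : b <= (Num.sqrt e)^-1 by rewrite lef_pV2 ?posrE ?sqrtr_gt0// ler_wsqrtr.
exists (gpdf z * b), (heat_t y s); split=> [h|dl dl0].
  have -> : heat s (y + h) - heat s y - gpdf z * b * h - heat_t y s * h ^+ 2 =
      gcdf (z + b * h) - gcdf z - gpdf z * ((z + b * h) - z) -
      (- z * gpdf z) / 2 * ((z + b * h) - z) ^+ 2.
    have -> : z + b * h - z = b * h by rewrite addrAC subrr add0r.
    rewrite /heat /heat_t -/z mulrDl -/z [h / _]mulrC -/b exprMn.
    have -> : b ^+ 2 = s^-1 by rewrite /b exprVn sqr_sqrtr// ltW.
    by field; rewrite gt_eqF.
  apply: (le_trans (gcdf_taylor _ _)).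
  have -> : z + b * h - z = b * h by rewrite addrAC subrr add0r.
  rewrite normrM (gtr0_norm b0) exprMn mulrA ler_wpM2r ?exprn_ge0//.
  apply: (@le_trans _ _ C1); last by rewrite lerDl.
  rewrite /C1; apply: ler_wpM2l; first exact: mulr_ge0.
  by apply: lerXn2r be; rewrite nnegrE; [exact: ltW|rewrite invr_ge0 ltW].
have sdl : s <= s + dl by rewrite lerDl.
have h2 t : s <= t <= s + dl -> [/\ is_derive t 1 (fun s => heat s y) (heat_t y t),
    is_derive t 1 (heat_t y) ((3 * (y / Num.sqrt t) - (y / Num.sqrt t) ^+ 3) *
      gpdf (y / Num.sqrt t) / (4 * t ^+ 2)) &
    `|(3 * (y / Num.sqrt t) - (y / Num.sqrt t) ^+ 3) *
      gpdf (y / Num.sqrt t) / (4 * t ^+ 2)| <= C2].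
  move=> /andP[st _]; have t0 : 0 < t by exact: lt_le_trans st.
  split; [exact: is_derive_heat|exact: is_derive_heat_t|].
  have [_ _ w] := gpdf_moments (y / Num.sqrt t).
  have t20 : 0 < 4 * t ^+ 2 by rewrite mulr_gt0// exprn_gt0.
  rewrite normrM (gtr0_norm (_ : 0 < (4 * t ^+ 2)^-1)) ?invr_gt0//.
  rewrite ler_pdivrMr// normrM (ger0_norm (gpdf_ge0 _)); apply: (le_trans w).
  have -> : C2 * (4 * t ^+ 2) = 12 * k * (t ^+ 2 / e ^+ 2).
    by rewrite /C2; field; rewrite gt_eqF.
  rewrite ler_peMr ?mulr_ge0// ler_pdivlMr ?exprn_gt0// mul1r.
  by rewrite lerXn2r ?nnegrE ?(ltW e0) ?(ltW t0) ?(le_trans es st).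
have := taylor1_right C20 sdl h2.
have -> : s + dl - s = dl by rewrite addrAC subrr add0r.
move=> /le_trans; apply.
by rewrite ler_wpM2r ?sqr_ge0// lerDr.
Qed.

End HeatKernel.

(** * Lindeberg's replacement *)

Section HeatExp.
Context {R : realType}.

Lemma heat_ge0 (s y : R) : 0 <= heat s y. Proof. exact: gcdf_ge0. Qed.
Lemma heat_le1 (s y : R) : heat s y <= 1. Proof. exact: gcdf_le1. Qed.

Lemma measurable_gcdf : measurable_fun setT (@gcdf R).
Proof.
apply: continuous_measurable_fun => z; have [h _] := is_derive_gcdf z.
by apply: differentiable_continuous; apply/derivable1_diffP.
Qed.

Lemma measurable_heat (s : R) : measurable_fun setT (heat s).
Proof.
apply: (measurableT_comp measurable_gcdf); exact: measurable_funM.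
Qed.

Lemma integrable_heat d (T : measurableType d) (P : probability T R) (s : R) (f : T -> R) :
  measurable_fun setT f -> P.-integrable setT (EFin \o (fun t => heat s (f t))).
Proof.
move=> mf; apply: (@integrable_le _ _ _ P _ (fun=> 1)).
- exact: (measurableT_comp (measurable_heat s) mf).
- by move=> t; rewrite ger0_norm ?heat_ge0// heat_le1.
- exact: finite_measure_integrable_cst.
Qed.

Variables (r : R) (r0 : 0 < r).
Local Notation mu := (exp_law r0).

Lemma Rintegral_exp_law_poly n (c : nat -> R) :
  \int[mu]_x (\sum_(k < n) c k * `|x| ^+ k) = \sum_(k < n) c k * (k`!%:R / r ^+ k).
Proof. by rewrite /Rintegral integral_exp_law_poly. Qed.

Lemma Rintegral_exp_law_quadratic (a b c : R) :
  mu.-integrable setT (EFin \o (fun x : R => a + b * (`|x| - r^-1) + c * (`|x| - r^-1) ^+ 2)) /\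
  \int[mu]_x (a + b * (`|x| - r^-1) + c * (`|x| - r^-1) ^+ 2) = a + c * r^-1 ^+ 2.
Proof.
pose m := r^-1.
pose q k : R := nth 0 [:: a - b * m + c * m ^+ 2; b - 2 * c * m; c] k.
rewrite (_ : (fun x : R => _) = (fun x => \sum_(k < 3) q k * `|x| ^+ k)); last first.
  by apply/funext => x; rewrite !big_ord_recr big_ord0 /q /m /=; ring.
split; first exact: integrable_exp_law_poly.
rewrite (_ : \int[mu]_x _ = \int[mu]_x (\sum_(k < 3) q k * `|x| ^+ k)); last first.
  by apply: eq_Rintegral => x _; rewrite !big_ord_recr big_ord0 /q /m /=; ring.
rewrite Rintegral_exp_law_poly !big_ord_recr big_ord0 /q /m /=.
rewrite !factS !fact0.
by field; rewrite gt_eqF.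
Qed.

(** Averaging the quadratic expansion in space over a centred variable of variance r^-2 leaves
    [B * kp^2 * r^-2], which is what the clock advanced by that variance produces to first order.
    Only the remainders survive. *)
Lemma heat_exp_step (e : R) : 0 < e -> exists2 C : R, 0 <= C & forall s y kp : R, e <= s ->
  `|\int[mu]_x heat s (y + kp * (`|x| - r^-1)) - heat (s + kp ^+ 2 * r^-1 ^+ 2) y| <=
    C * (`|kp| ^+ 3 + kp ^+ 4).
Proof.
move=> e0; have [C C0 hC] := heat_step e0.
(* The cubic remainder is dominated by |Y|^3 <= 1 + Y^4, whose mean is at most [M] by the fourth
   moment bound at w = 0. *)
pose M := 1 + 13 * r^-1 ^+ 4.
have ri : 0 < r^-1 by rewrite invr_gt0.
have M0 : 0 <= M by rewrite addr_ge0// mulr_ge0// exprn_ge0// ltW.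
have ri4 : 0 <= r^-1 ^+ 4 by rewrite exprn_ge0// ltW.
exists (C * M + C * r^-1 ^+ 4) => [|s y kp es]; first by rewrite addr_ge0// mulr_ge0.
have [A [B [hs ht]]] := hC s y es.
pose Y (x : R) := `|x| - r^-1.
pose p x := heat s y + (A * kp) * Y x + (B * kp ^+ 2) * Y x ^+ 2.
pose q x := C * `|kp| ^+ 3 * (1 + Y x ^+ 4).
have [ip Ep] := Rintegral_exp_law_quadratic (heat s y) (A * kp) (B * kp ^+ 2).
have mY : measurable_fun setT Y.
  by apply: measurable_funB => //; exact: normr_measurable.
have mf : measurable_fun setT (fun x => heat s (y + kp * Y x)).
  apply: (measurableT_comp (measurable_heat s)); apply: measurable_funD => //.
  exact: measurable_funM.
have if_ : mu.-integrable setT (EFin \o (fun x => heat s (y + kp * Y x))).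
  apply: integrable_heat; apply: measurable_funD => //; exact: measurable_funM.
have Y4 : (\int[mu]_x ((Y x) ^+ 4)%:E <= (13 * r^-1 ^+ 4)%:E)%E.
  have E : (\int[mu]_x ((Y x) ^+ 4)%:E = \int[mu]_x ((0 + (`|x| - r^-1)) ^+ 4)%:E)%E.
    by apply: eq_integral => x _; rewrite add0r.
  rewrite E; apply: (le_trans (integral_exp_law_center4 r0 0)).
  by rewrite !expr0n /= mulr0 addr0 add0r.
have c0 : 0 <= C * `|kp| ^+ 3 by rewrite mulr_ge0// exprn_ge0.
have q0 x : 0 <= q x by rewrite mulr_ge0// addr_ge0// exprn_even_ge0.
have mq : measurable_fun setT q.
  apply: measurable_funM => //; apply: measurable_funD => //; exact: measurable_funX.
have iq : (\int[mu]_x (q x)%:E <= (C * `|kp| ^+ 3 * M)%:E)%E.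
  rewrite /q; under eq_integral do rewrite EFinM EFinD.
  have m4 : measurable_fun setT (fun x : R => (Y x ^+ 4)%:E).
    by apply/measurable_EFinP; exact: measurable_funX.
  have p4 x : (0 <= (Y x ^+ 4)%:E)%E by rewrite lee_fin exprn_even_ge0.
  rewrite ge0_integralZl//; last 2 first.
  - by apply: emeasurable_funD.
  - by move=> x _; rewrite adde_ge0.
  rewrite ge0_integralD// integral_probability_cst [X in (_ <= X)%E]EFinM.
  apply: lee_wpmul2l; first by rewrite lee_fin.
  by rewrite /M EFinD; apply: leeD2l.
have intq : mu.-integrable setT (EFin \o q).
  apply/integrableP; split; first exact/measurable_EFinP.
  under eq_integral do rewrite /= ger0_norm//.
  by rewrite (le_lt_trans iq)// ltry.
have pf x : `|heat s (y + kp * Y x) - p x| <= q x.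
  have -> : heat s (y + kp * Y x) - p x =
      heat s (y + kp * Y x) - heat s y - A * (kp * Y x) - B * (kp * Y x) ^+ 2.
    by rewrite /p; ring.
  apply: (le_trans (hs _)); rewrite /q normrM exprMn mulrA ler_wpM2l//.
  have := normr_ge0 (Y x); rewrite (_ : Y x ^+ 4 = `|Y x| ^+ 4); last first.
    by rewrite -normrX ger0_norm// exprn_even_ge0.
  move: `|Y x| => a a0; have [a1|a1] := leP a 1.
    by rewrite (le_trans (exprn_ile1 3 a0 a1))// lerDl exprn_ge0.
  rewrite (le_trans (_ : _ <= a ^+ 4))// ?lerDr//.
  by rewrite [leRHS]exprSr ler_peMr ?exprn_ge0// ltW.
have Rq : \int[mu]_x q x <= C * `|kp| ^+ 3 * M.
  by rewrite /Rintegral -lee_fin fineK//; exact: integrable_fin_num.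
have intB : mu.-integrable setT (EFin \o (fun x => heat s (y + kp * Y x) - p x)).
  by rewrite /comp; under eq_fun do rewrite EFinB; exact: integrableB.
have D : `|\int[mu]_x heat s (y + kp * Y x) - (heat s y + B * kp ^+ 2 * r^-1 ^+ 2)| <= C * `|kp| ^+ 3 * M.
  rewrite -Ep -RintegralB//.
  apply: (le_trans (le_normr_Rintegral _ intB)) => //.
  apply: (le_trans _ Rq); apply: le_Rintegral => //.
  by apply: integrable_norm.
pose dl := kp ^+ 2 * r^-1 ^+ 2.
have dl0 : 0 <= dl by rewrite mulr_ge0 ?sqr_ge0.
have D2 := ht dl dl0.
have -> : \int[mu]_x heat s (y + kp * (`|x| - r^-1)) - heat (s + kp ^+ 2 * r^-1 ^+ 2) y =
   (\int[mu]_x heat s (y + kp * Y x) - (heat s y + B * kp ^+ 2 * r^-1 ^+ 2)) -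
   (heat (s + dl) y - heat s y - B * dl) by rewrite /dl; ring.
apply: (le_trans (ler_normB _ _)).
have kp4 : 0 <= kp ^+ 4 by rewrite exprn_even_ge0.
have kp3 : 0 <= `|kp| ^+ 3 by rewrite exprn_ge0.
have e2 : C * dl ^+ 2 = C * r^-1 ^+ 4 * kp ^+ 4 by rewrite /dl; ring.
rewrite e2 in D2.
apply: (le_trans (lerD D D2)).
have a1 : 0 <= C * M * kp ^+ 4 by apply: mulr_ge0 => //; exact: mulr_ge0.
have a2 : 0 <= C * r^-1 ^+ 4 * `|kp| ^+ 3 by apply: mulr_ge0 => //; exact: mulr_ge0.
move: a1 a2; lra.
Qed.

End HeatExp.

Section Lindeberg.
Context d (T : measurableType d) (R : realType) (P : probability T R).
Variables (K : eqType) (mu : K -> set R -> \bar R) (X : K -> T -> R).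
Hypotheses (indX : indep_family P mu X) (X0 : forall k t, 0 <= X k t).
Variables (f : nat -> K) (r : R) (r0 : 0 < r).
Hypotheses (finj : injective f) (muf : forall k, mu (f k) = exponential_prob r).

Lemma Rintegral_heat_indep (s kp : R) (Y W : T -> R) :
  (forall t, 0 <= Y t) -> indep_law P (exp_law r0) Y W ->
  \int[P]_t heat s (W t + kp * (Y t - r^-1)) =
  \int[P]_t \int[exp_law r0]_x heat s (W t + kp * (`|x| - r^-1)).
Proof.
move=> Y0 YW.
pose F (z : R * R) := (heat s (z.2 + kp * (`|z.1| - r^-1)))%:E.
have mF : measurable_fun setT F.
  apply/measurable_EFinP; apply: (measurableT_comp (measurable_heat s)).
  apply: measurable_funD => //; apply: measurable_funM => //; apply: measurable_funB => //.
  exact: (measurableT_comp (@normr_measurable R setT) measurable_fst).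
have F0 z : (0 <= F z)%E by rewrite lee_fin heat_ge0.
have E := indep_law_integral YW mF F0.
rewrite /Rintegral; congr fine.
transitivity (\int[P]_t F (Y t, W t))%E.
  by apply: eq_integral => t _; rewrite /F /= ger0_norm.
apply: (etrans E); apply: eq_integral => t _; rewrite fineK//.
apply: integrable_fin_num => //.
apply: (@integrable_heat R _ _ (exp_law r0) s (fun x => W t + kp * (`|x| - r^-1))).
apply: measurable_funD => //; apply: measurable_funM => //; apply: measurable_funB => //.
Qed.

(* Lindeberg's replacement: each summand is traded for its variance in the
   time of the heat semigroup. *)
Lemma lindeberg (e C : R) (D : pred K) (Z : T -> R) : 0 < e -> 0 <= C ->
  (forall s y kp : R, e <= s ->
  `|\int[exp_law r0]_x heat s (y + kp * (`|x| - r^-1)) - heat (s + kp ^+ 2 * r^-1 ^+ 2) y| <=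
    C * (`|kp| ^+ 3 + kp ^+ 4)) ->
  (forall k, ~~ D (f k)) ->
  @measurable_fun _ _ (g_sigma_algebraType (cylinders X D)) R setT Z ->
  forall n (s kp : R), e <= s ->
  `|\int[P]_t heat s (Z t + kp * csum X f r n t) -
    \int[P]_t heat (s + n%:R * (kp ^+ 2 * r^-1 ^+ 2)) (Z t)| <=
    n%:R * (C * (`|kp| ^+ 3 + kp ^+ 4)).
Proof.
move=> e0 C0 hC Df mZ n s kp.
set v := kp ^+ 2 * r^-1 ^+ 2; set B := C * _.
have v0 : 0 <= v by rewrite mulr_ge0 ?sqr_ge0.
elim: n s => [|n ih] s es.
  have E0 : \int[P]_t heat s (Z t + kp * csum X f r 0 t) =
      \int[P]_t heat (s + 0%:R * v) (Z t).
    by apply: eq_Rintegral => t _; rewrite /csum big_ord0 mulr0 addr0 mul0r addr0.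
  by rewrite E0 subrr normr0 mul0r.
pose W t := Z t + kp * csum X f r n t.
(* [W] depends on the coordinates of [Z] and on the first n summands, hence is independent of the
   summand with index n. *)
pose D' : pred K := fun k => D k || (k \in map f (iota 0 n)).
have mZ' : @measurable_fun _ _ (g_sigma_algebraType (cylinders X D')) R setT Z.
  move=> _ A mA; have := mZ measurableT A mA; apply: sub_sigma_algebra2.
  move=> _ [J [B' [uJ DJ mB' ->]]]; exists J, B'; split => //.
  by apply: sub_all DJ => k Dk; rewrite /D' Dk.
have mW : @measurable_fun _ _ (g_sigma_algebraType (cylinders X D')) R setT W.
  apply: measurable_funD => //; apply: measurable_funM => //.
  apply: measurable_cylinders_csum => k kn.
  by rewrite /D' mem_map// mem_iota /= add0n kn orbT.
have mWT := measurable_cylinders indX mW.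
have YW : indep_law P (exp_law r0) (X (f n)) W.
  apply: (indep_law_eq (muf n)); apply: (indep_family_pair indX (D := D')) => //.
  by rewrite /D' negb_or Df mem_map// mem_iota /= add0n ltnn.
have E1 : \int[P]_t heat s (Z t + kp * csum X f r n.+1 t) =
    \int[P]_t \int[exp_law r0]_x heat s (W t + kp * (`|x| - r^-1)).
  rewrite -(Rintegral_heat_indep s kp (X0 (f n)) YW).
  by apply: eq_Rintegral => t _; rewrite /W csumS; congr heat; ring.
(* The last summand is traded first, which advances the clock to s + v; the induction hypothesis
   then runs from there. *)
have := ih (s + v); rewrite (le_trans es) ?lerDl// => /(_ isT).
have -> : s + v + n%:R * v = s + n.+1%:R * v by rewrite -natr1; ring.
move=> {}ih.
have mg : measurable_fun setT (fun t => \int[exp_law r0]_x heat s (W t + kp * (`|x| - r^-1))).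
  pose F (z : R * R) := (heat s (z.2 + kp * (`|z.1| - r^-1)))%:E.
  have mF : measurable_fun setT F.
    apply/measurable_EFinP; apply: (measurableT_comp (measurable_heat s)).
    apply: measurable_funD => //; apply: measurable_funM => //; apply: measurable_funB => //.
    exact: (measurableT_comp (@normr_measurable R setT) measurable_fst).
  have F0 z : (0 <= F z)%E by rewrite lee_fin heat_ge0.
  have h := @measurable_fun_fubini_tonelli_G _ _ (measurableTypeR R) R R (exp_law r0) F mF F0.
  rewrite /Rintegral; apply: (measurableT_comp (@fine_measurable R setT measurableT)).
  exact: (measurableT_comp h mWT).
have step : `|\int[P]_t \int[exp_law r0]_x heat s (W t + kp * (`|x| - r^-1)) -
    \int[P]_t heat (s + v) (W t)| <= B.
  have ih1 : P.-integrable setT (EFin \o (fun t => heat (s + v) (W t))) by exact: integrable_heat.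
  have bnd t : `|\int[exp_law r0]_x heat s (W t + kp * (`|x| - r^-1)) - heat (s + v) (W t)| <= B.
    exact: hC.
  have ig : P.-integrable setT (EFin \o (fun t => \int[exp_law r0]_x heat s (W t + kp * (`|x| - r^-1)))).
    apply: (@integrable_le _ _ _ P _ (fun=> B + 1)) => //; last first.
      exact: finite_measure_integrable_cst.
    move=> t; have := bnd t; have := heat_ge0 (s + v) (W t); have := heat_le1 (s + v) (W t).
    rewrite ler_norml => h1 h2 /andP[h3 h4]; rewrite ler_norml; apply/andP; split; lra.
  rewrite -RintegralB//.
  have iB : P.-integrable setT (EFin \o (fun t => \int[exp_law r0]_x heat s (W t + kp * (`|x| - r^-1)) - heat (s + v) (W t))).
    by rewrite /comp; under eq_fun do rewrite EFinB; exact: integrableB.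
  apply: (le_trans (le_normr_Rintegral _ iB)) => //.
  have -> : B = \int[P]_t (fun=> B) t.
    by rewrite /Rintegral integral_probability_cst.
  apply: le_Rintegral => //; first exact: integrable_norm.
  exact: finite_measure_integrable_cst.
rewrite E1; set a := \int[P]_t _ in step *; set b := \int[P]_t _ in step ih *.
set c := \int[P]_t _ in ih *.
have -> : a - c = (a - b) + (b - c) by ring.
apply: (le_trans (ler_normD _ _)); rewrite -natr1 mulrDl mul1r addrC.
exact: lerD.
Qed.

End Lindeberg.

(** [Q] is the centred stationary passage time from (0, n-k) to (m, n+1), which climbs k+1 rows, so
    its variance is governed by the gap for k+1. [B] is the exit event of the full rectangle, whose
    gap is only larger. *)
Lemma stationary_split (R : realType) (rho kappa : R) : 0 < rho < 1 -> 0 < kappa ->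
  exists K, 0 <= K /\ forall (N : R) (m n k : nat), 1 <= N -> m%:R <= N -> n.+1%:R <= N ->
  (k <= n)%N -> kappa * N <= k.+1%:R / rho ^+ 2 - m%:R / (1 - rho) ^+ 2 ->
  forall (d : measure_display) (T : measurableType d) (P : probability T R)
    (X : nat * nat -> T -> R), exp_env P rho (1 - rho) X ->
  exists Q B, [/\ sqint P Q,
    \int[P]_t ((Q t) ^+ 2) <= k.+1%:R / rho ^+ 2 - m%:R / (1 - rho) ^+ 2 + K,
    measurable B /\ (P B <= (K / N ^+ 2)%:E)%E &
    forall t, ~ B t -> Lup (weights X t) m n =
      lpp_mean rho m n.+1 + csum X vaxis rho (n - k) t + Q t].
Proof.
move=> r01 k0; have [K [K0 hK]] := stationary_exit r01 k0.
exists K; split => // N m n k N1 mN nN kn hgap d T P X eX.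
have /andP[r0 r1] := r01.
have kN : k.+1%:R <= N by apply: le_trans nN; rewrite ler_nat.
have [Z [eZ hZ]] := stationary_shift m (n - k) k.+1 r01 eX.
have [sq _] := hK N m k N1 mN kN hgap d T P Z eZ.
have hgap' : kappa * N <= n.+1%:R / rho ^+ 2 - m%:R / (1 - rho) ^+ 2.
  apply: (le_trans hgap); rewrite lerD2r ler_wpM2r ?invr_ge0 ?sqr_ge0//.
  by rewrite ler_nat.
have [_ ex] := hK N m n N1 mN nN hgap' d T P X eX.
have nk : (n - k + k.+1 = n.+1)%N by rewrite addnS subnK.
rewrite nk in hZ.
exists (lpp_bar rho Z m k.+1), [set t | Lup (weights X t) m n != lpp (weights X t) m n.+1].
split => //.
- exact: sqint_lpp_bar.
- split => //.
  have mU : measurable_fun setT (fun t => Lup (weights X t) m n).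
    apply: (measurable_Lup (w := fun i j t => weights X t i j)) => i j.
    exact: measurable_weights eX.
  have mL : measurable_fun setT (fun t => lpp (weights X t) m n.+1).
    apply: (measurable_lpp (w := fun i j t => weights X t i j)) => i j.
    exact: measurable_weights eX.
  have -> : [set t | Lup (weights X t) m n != lpp (weights X t) m n.+1] =
      (fun t => Lup (weights X t) m n == lpp (weights X t) m n.+1) @^-1` [set false].
    by apply/seteqP; split => t /=; [move/negbTE|move=> ->].
  rewrite -[_ @^-1` _]setTI; exact: (measurable_fun_eqr mU mL).
- move=> t /negP; rewrite negbK => /eqP ->.
  rewrite csum_vaxis /lpp_bar hZ /lpp_mean.
  have -> : n.+1%:R = (n - k)%:R + k.+1%:R :> R by rewrite -natrD nk.
  ring.
Qed.

(** * Regularity of the heat function and smoothing of probabilities *)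

Section HeatRegularity.
Context (R : realType).

Lemma gcdf_lipschitz (x y : R) : `|gcdf x - gcdf y| <= gpeak * `|x - y|.
Proof.
apply: (@mvt_dist R (@gcdf R) (@gpdf R)) => z _; split; first exact: is_derive_gcdf.
by rewrite ger0_norm ?gpdf_ge0//; have [] := gpdf_bounds z.
Qed.

(** The function gcdf z + gcdf(-z) has derivative zero because the density is even; its constant
    value is found from the tails. *)
Lemma gcdfN (x : R) : gcdf (- x) = 1 - gcdf x.
Proof.
have h (y : R) : gcdf y + gcdf (- y) = gcdf x + gcdf (- x).
  pose f (z : R) := gcdf z + gcdf (- z).
  have h : `|f y - f x| <= 0 * `|y - x|.
    apply: (@mvt_dist R f (fun=> 0)) => z _; rewrite normr0; split => //.
    have e0 : is_derive z 1 (fun z : R => - z) (- 1) by apply: is_derive_eq.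
    have e1 := @is_derive1_comp R (@gcdf R) (fun z => - z) z _ _ (is_derive_gcdf (- z)) e0.
    have e2 := is_deriveD (is_derive_gcdf z) e1.
    apply: (is_derive_eq e2).
    have -> : gpdf (- z) = gpdf z by rewrite /gpdf sqrrN.
    by ring.
  by move: h; rewrite mul0r normr_le0 subr_eq0 => /eqP.
suff H : gcdf x + gcdf (- x) = 1 by rewrite -H; ring.
apply/eqP; rewrite -subr_eq0 -normr_le0; apply/ler_addgt0Pl => e e0; rewrite addr0.
have [A A0 [h1 h2]] := gcdf_tails e0; rewrite -(h A).
have := gcdf_ge0 (- A); have := gcdf_le1 A => h3 h4.
rewrite ler_norml; apply/andP; split; lra.
Qed.

Lemma heat_lipschitz (s x y : R) : 0 < s ->
  `|heat s x - heat s y| <= gpeak / Num.sqrt s * `|x - y|.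
Proof.
move=> s0; apply: (le_trans (gcdf_lipschitz _ _)).
by rewrite -mulrBl normrM [`|_^-1|]ger0_norm ?invr_ge0 ?sqrtr_ge0// [X in _ <= X]mulrAC mulrA.
Qed.

Lemma heat_continuous (v y g : R) : 0 < v -> 0 < g ->
  exists2 dl, 0 < dl & forall s z, `|s - v| <= dl -> `|z - y| <= dl ->
    `|heat s z - heat v y| <= g.
Proof.
move=> v0 g0; have k0 := @gpeak_ge0 R.
have q0 : 0 < Num.sqrt v by rewrite sqrtr_gt0.
pose C1 := 3 / 2 * gpeak / v; pose C2 := gpeak / Num.sqrt v.
have C10 : 0 <= C1 by rewrite divr_ge0 ?mulr_ge0 ?(ltW v0)// divr_ge0.
have C20 : 0 <= C2 by rewrite divr_ge0// ltW.
have C0 : 0 < C1 + C2 + 1 by lra.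
exists (Num.min (v / 2) (g / (C1 + C2 + 1))).
  by rewrite lt_min !divr_gt0.
move=> s z; rewrite !le_min => /andP[sv sg] /andP[_ zg].
have h1 : `|heat s z - heat v z| <= C1 * `|s - v|.
  apply: (@mvt_dist R (fun s => heat s z) (heat_t z)) => w wv.
  have w2 : v / 2 <= w.
    have := le_trans wv sv; rewrite ler_norml => /andP[h _]; lra.
  have w0 : 0 < w by lra.
  split; first exact: is_derive_heat.
  have [h _ _] := gpdf_moments (z / Num.sqrt w).
  rewrite /heat_t normrM [`|_^-1|]ger0_norm ?invr_ge0 ?mulr_ge0 ?(ltW w0)//.
  rewrite normrM normrN [`|gpdf _|]ger0_norm ?gpdf_ge0//.
  rewrite ler_pdivrMr ?mulr_gt0//; apply: (le_trans h).
  have -> : C1 * (2 * w) = 3 / 2 * gpeak * (2 * w / v) by rewrite /C1; ring.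
  rewrite ler_peMr ?mulr_ge0 ?divr_ge0// ler_pdivlMr//; lra.
have h2 : `|heat v z - heat v y| <= C2 * `|z - y| by exact: heat_lipschitz.
apply: (le_trans (ler_distD (heat v z) _ _)); apply: (le_trans (lerD h1 h2)).
have a1 := ler_wpM2l C10 sg; have a2 := ler_wpM2l C20 zg.
have q : 0 <= g / (C1 + C2 + 1) by rewrite divr_ge0 // ltW.
have e : (C1 + C2 + 1) * (g / (C1 + C2 + 1)) = g by rewrite mulrCA divff ?mulr1// gt_eqF.
rewrite -[leRHS]e !mulrDl; lra.
Qed.

Section Smoothing.
Context d (T : measurableType d) (P : probability T R).

Lemma Rintegral_indic (B : set T) : measurable B -> \int[P]_t (\1_B t) = fine (P B).
Proof. by move=> mB; rewrite /Rintegral integral_indic// setIT. Qed.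

(** x -> [heat th (c - x)] is a smoothed indicator of x <= c of width sqrt(th). Shifting it by
    [A * sqrt th] to either side sandwiches the indicator of x <= 0 up to [e]; the Lipschitz bound
    then removes [Q], and [B] costs its probability. *)
Lemma smoothing (e th A a : R) (D W Q : T -> R) (B : set T) : 0 < th -> 0 < a ->
  gcdf (- A) <= e -> 1 - e <= gcdf A ->
  measurable_fun setT D -> measurable_fun setT W -> sqint P Q -> measurable B ->
  (forall t, ~ B t -> D t = W t + Q t) ->
  let err := e + gpeak / Num.sqrt th * ((a + (\int[P]_t ((Q t) ^+ 2)) / a) / 2) + fine (P B) in
  fine (P [set t | D t <= 0]) <= \int[P]_t heat th (A * Num.sqrt th - W t) + err /\
  \int[P]_t heat th (- A * Num.sqrt th - W t) - err <= fine (P [set t | D t <= 0]).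
Proof.
move=> th0 a0 A1 A2 mD mW sQ mB hB err.
set L := gpeak / Num.sqrt th in err *.
have q0 : 0 < Num.sqrt th by rewrite sqrtr_gt0.
have L0 : 0 <= L by rewrite divr_ge0 ?gpeak_ge0// ltW.
pose psi t := e + L * ((a + (Q t) ^+ 2 / a) / 2) + \1_B t.
pose F := [set t | D t <= 0].
have mF : measurable F.
  have -> : F = setT `&` D @^-1` `]-oo, 0].
    by rewrite setTI; apply/seteqP; split => t /=; rewrite in_itv.
  exact: mD.
have iB (C : set T) : measurable C -> P.-integrable setT (EFin \o (\1_C : T -> R)).
  by move=> mC; exact: integrable_indic.
have e0 : 0 <= e by exact: le_trans (gcdf_ge0 _) A1.
have ic c : P.-integrable setT (EFin \o (fun=> c : R)) by exact: finite_measure_integrable_cst.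
have iQ : P.-integrable setT (EFin \o (fun t => L / (2 * a) * (Q t) ^+ 2)).
  rewrite (_ : _ \o _ = (fun t => (L / (2 * a))%:E * ((Q t) ^+ 2)%:E)%E)//.
  by apply: integrableZl => //; exact: sQ.2.
have psiE t : psi t = (e + L * a / 2) + L / (2 * a) * (Q t) ^+ 2 + \1_B t.
  by rewrite /psi; field; rewrite gt_eqF.
have ipsi1 : P.-integrable setT (EFin \o (fun t => (e + L * a / 2) + L / (2 * a) * (Q t) ^+ 2)).
  by apply: (@eq_integrable _ _ _ P setT measurableT _ _ _ (integrableD measurableT (ic (e + L * a / 2)) iQ)) => t _.
have ipsi : P.-integrable setT (EFin \o psi).
  apply: (@eq_integrable _ _ _ P setT measurableT _ _ _ (integrableD measurableT ipsi1 (iB B mB))) => t _.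
  by rewrite /= psiE.
have Epsi : \int[P]_t psi t = err.
  have -> : \int[P]_t psi t = \int[P]_t ((e + L * a / 2) + L / (2 * a) * (Q t) ^+ 2 + \1_B t).
    by apply: eq_Rintegral => t _; exact: psiE.
  rewrite RintegralD//; last exact: iB.
  rewrite RintegralD// Rintegral_indic//.
  rewrite RintegralZl//; last exact: sQ.2.
  have -> : \int[P]_t (e + L * a / 2) = e + L * a / 2 by rewrite /Rintegral integral_probability_cst.
  by rewrite /err; congr (_ + _); field; rewrite gt_eqF.
have cut x : heat th (- A * Num.sqrt th - x) - e <= (x <= 0)%R%:R :> R /\
     (x <= 0)%R%:R <= heat th (A * Num.sqrt th - x) + e :> R.
  have hh c : heat th (c * Num.sqrt th - x) = gcdf (c - x / Num.sqrt th).
    by rewrite /heat mulrBl mulfK// gt_eqF.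
  rewrite !hh; have [x0|x0] := leP x 0 => /=.
    split; first by have := gcdf_le1 (- A - x / Num.sqrt th); move: e0; lra.
    have : gcdf A <= gcdf (A - x / Num.sqrt th).
      by apply: gcdf_mono; rewrite lerDl oppr_ge0 mulr_le0_ge0// invr_ge0 ltW.
    lra.
  split; last by rewrite addr_ge0// gcdf_ge0.
  have : gcdf (- A - x / Num.sqrt th) <= gcdf (- A).
    by apply: gcdf_mono; rewrite gerDl oppr_le0 divr_ge0// ltW.
  lra.
(* The inequality |q| <= (a + q^2/a)/2 turns the Lipschitz bound into one that involves only the
   second moment of [Q]. *)
have lip c t : `|heat th (c - (W t + Q t)) - heat th (c - W t)| <= L * ((a + (Q t) ^+ 2 / a) / 2).
  apply: (le_trans (heat_lipschitz _ _ th0)); rewrite -/L ler_wpM2l//.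
  have -> : c - (W t + Q t) - (c - W t) = - Q t by ring.
  rewrite normrN -[Q t ^+ 2]real_normK ?num_real//; set z := `|Q t|.
  rewrite -(ler_pM2r a0) -subr_ge0.
  have -> : (a + z ^+ 2 / a) / 2 * a - z * a = (z - a) ^+ 2 / 2 by field; rewrite gt_eqF.
  by rewrite divr_ge0// sqr_ge0.
have pt t : \1_F t <= heat th (A * Num.sqrt th - W t) + psi t /\
    heat th (- A * Num.sqrt th - W t) - psi t <= \1_F t.
  have ps0 : 0 <= L * ((a + (Q t) ^+ 2 / a) / 2).
    by rewrite mulr_ge0// divr_ge0// addr_ge0 ?(ltW a0)// divr_ge0 ?sqr_ge0// ltW.
  have i0 : 0 <= (\1_F t : R) <= 1 by rewrite indicE; case: (_ \in _); rewrite ?lexx ler01.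
  have [h1 h2] : heat th (A * Num.sqrt th - W t) \in `[0, 1] /\
     heat th (- A * Num.sqrt th - W t) \in `[0, 1].
    by rewrite !in_itv/= !heat_ge0 !heat_le1.
  rewrite /psi; case: (boolP (t \in B)) => tB.
    rewrite [\1_B t]indicE tB/=; move: h1 h2 i0; rewrite !in_itv/= => /andP[? ?] /andP[? ?] /andP[? ?].
    split; lra.
  have E : D t = W t + Q t by apply: hB => Bt; move/negP: tB; apply; rewrite inE.
  have -> : \1_F t = (D t <= 0)%R%:R :> R by rewrite indicE mem_setE.
  rewrite [\1_B t]indicE (negbTE tB)/= addr0 E.
  have [c1 c2] := cut (W t + Q t).
  have := lip (A * Num.sqrt th) t; have := lip (- A * Num.sqrt th) t.
  rewrite !ler_norml => /andP[l1 l2] /andP[l3 l4]; split; lra.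
have ih c : P.-integrable setT (EFin \o (fun t => heat th (c - W t))).
  by apply: integrable_heat; exact: measurable_funB.
have iF := iB F mF.
rewrite -/F -(Rintegral_indic mF) -Epsi; split.
  rewrite -RintegralD//; apply: le_Rintegral => //.
    exact: (integrableD measurableT (ih (A * Num.sqrt th)) ipsi).
  by move=> t _; exact: (pt t).1.
rewrite -RintegralB//; apply: le_Rintegral => //.
  exact: (integrableB measurableT (ih (- A * Num.sqrt th)) ipsi).
by move=> t _; exact: (pt t).2.
Qed.

End Smoothing.
End HeatRegularity.

Lemma mulrD_le_sum (R : realType) (C D x y : R) : 0 <= C -> 0 <= D -> y <= x -> 0 <= x ->
  C * (x + y) <= 2 * (C + D) * x.
Proof.
move=> C0 D0 yx x0; have u1 := ler_wpM2l C0 yx; have u2 := mulr_ge0 D0 x0.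
rewrite -subr_ge0; have -> : 2 * (C + D) * x - C * (x + y) =
  (C * x - C * y) + 2 * (D * x) by ring.
by rewrite addr_ge0 ?subr_ge0// mulr_ge0.
Qed.

(** Lindeberg's replacement is run twice: over the vertical axis, with the horizontal sum kept as
    the independent part, and then over the horizontal axis around a constant. For [kp <= 1] the
    quartic errors are absorbed by the cubic ones. *)
Lemma heat_axes (R : realType) (a b e : R) : 0 < a -> 0 < b -> 0 < e ->
  exists2 C : R, 0 <= C & forall (d : measure_display) (T : measurableType d)
    (P : probability T R) (X : nat * nat -> T -> R), exp_env P a b X ->
  forall (s kp c : R) (n m : nat), e <= s -> 0 <= kp <= 1 ->
  `|\int[P]_t heat s (c - kp * (csum X vaxis a n t - csum X haxis b m t)) -
    heat (s + (n%:R * (kp ^+ 2 / a ^+ 2) + m%:R * (kp ^+ 2 / b ^+ 2))) c| <=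
  (n%:R + m%:R) * (C * kp ^+ 3).
Proof.
move=> a0 b0 e0.
have [Ca Ca0 hCa] := heat_exp_step a0 e0.
have [Cb Cb0 hCb] := heat_exp_step b0 e0.
exists (2 * (Ca + Cb)); first by rewrite mulr_ge0// addr_ge0.
move=> d T P X [[m0 indX] X0] s kp c n m es /andP[k0 k1].
pose DX : pred (nat * nat) := fun z => z.2 == 0%N.
pose Z t := c + kp * csum X haxis b m t.
have mZ : @measurable_fun _ _ (g_sigma_algebraType (cylinders X DX)) R setT Z.
  apply: measurable_funD => //; apply: measurable_funM => //.
  by apply: measurable_cylinders_csum.
have L1 := lindeberg indX X0 vaxis_inj (env_law_vaxis _ _ _) e0 Ca0 hCa
  (D := DX) (fun=> isT) mZ n (- kp) es.
pose v := n%:R * (kp ^+ 2 / a ^+ 2).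
have v0 : 0 <= v by rewrite mulr_ge0// divr_ge0// sqr_ge0.
have es' : e <= s + v by rewrite (le_trans es)// lerDl.
have mc : @measurable_fun _ _ (g_sigma_algebraType (cylinders X pred0)) R setT (fun=> c).
  exact: measurable_cst.
have L2 := lindeberg indX X0 haxis_inj (env_law_haxis _ _ _) e0 Cb0 hCb
  (D := pred0) (fun=> isT) mc m kp es'.
have E1 : \int[P]_t heat s (c - kp * (csum X vaxis a n t - csum X haxis b m t)) =
    \int[P]_t heat s (Z t + - kp * csum X vaxis a n t).
  by apply: eq_Rintegral => t _; congr heat; rewrite /Z; ring.
have sE : s + n%:R * ((- kp) ^+ 2 * a^-1 ^+ 2) = s + v by rewrite sqrrN exprVn.
have E2 : \int[P]_t heat (s + v + m%:R * (kp ^+ 2 * b^-1 ^+ 2)) c =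
   heat (s + (v + m%:R * (kp ^+ 2 / b ^+ 2))) c.
  by rewrite /Rintegral integral_probability_cst/= exprVn addrA.
have n1 : `|- kp| = kp by rewrite normrN ger0_norm.
have n2 : `|kp| = kp by rewrite ger0_norm.
have n4 : (- kp) ^+ 4 = kp ^+ 4 by ring.
rewrite sE n1 n4 in L1; rewrite E2 n2 in L2; rewrite E1.
apply: (le_trans (ler_distD (\int[P]_t heat (s + v) (Z t)) _ _)).
apply: (le_trans (lerD L1 L2)); clear L1 L2 E1 E2 hCa hCb.
have k4 : kp ^+ 4 <= kp ^+ 3 by rewrite exprS ler_piMl ?exprn_ge0.
have k30 : 0 <= kp ^+ 3 by rewrite exprn_ge0.
have h (C D : R) (j : nat) : 0 <= C -> 0 <= D ->
    j%:R * (C * (kp ^+ 3 + kp ^+ 4)) <= j%:R * (2 * (C + D) * kp ^+ 3).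
  by move=> C0 D0; rewrite ler_wpM2l// mulrD_le_sum.
have ha := h Ca Cb n Ca0 Cb0; have hb := h Cb Ca m Cb0 Ca0.
rewrite mulrDl; apply: (le_trans (lerD ha hb)); rewrite le_eqVlt; apply/orP; left; apply/eqP; ring.
Qed.

(** * Estimates for the competition interface *)

(** Neither [Lup] nor the vertical sum sees the horizontal axis, so that axis may be rescaled to the
    stationary rate without changing the decomposition. *)
Lemma exp_env_split (R : realType) (rho b kappa : R) : 0 < rho < 1 -> 0 < b -> 0 < kappa ->
  exists2 K, 0 <= K & forall (N : R) (m n k : nat), 1 <= N -> m%:R <= N -> n.+1%:R <= N ->
  (k <= n)%N -> kappa * N <= k.+1%:R / rho ^+ 2 - m%:R / (1 - rho) ^+ 2 ->
  forall (d : measure_display) (T : measurableType d) (P : probability T R)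
    (X : nat * nat -> T -> R), exp_env P rho b X ->
  exists Q B, [/\ sqint P Q,
    \int[P]_t ((Q t) ^+ 2) <= k.+1%:R / rho ^+ 2 - m%:R / (1 - rho) ^+ 2 + K,
    measurable B /\ (P B <= (K / N ^+ 2)%:E)%E &
    forall t, ~ B t -> Lup (weights X t) m n =
      lpp_mean rho m n.+1 + csum X vaxis rho (n - k) t + Q t].
Proof.
move=> r01 b0 k0; have [K [K0 hK]] := stationary_split r01 k0.
have /andP[r0 r1] := r01; have s0 : 0 < 1 - rho by rewrite subr_gt0.
exists K; first exact: K0.
move=> N m n k N1 mN nN kn hgap d T P X eX.
have eX' := exp_env_rescale r0 b0 r0 s0 eX.
have [Q [B [sQ Q2 hB E]]] := hK N m n k N1 mN nN kn hgap d T P _ eX'.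
exists Q, B; split => // t /E.
have rr : rho / rho = 1 by rewrite divff// gt_eqF.
have eU i j : shift_up (weights (rescale (rho / rho) (b / (1 - rho)) X) t) i j =
    shift_up (weights X t) i j.
  by rewrite /shift_up /weights /rescale rr /=; case: ifP => _; rewrite mul1r.
have -> : Lup (weights (rescale (rho / rho) (b / (1 - rho)) X) t) m n = Lup (weights X t) m n.
  rewrite /Lup; congr (_ + _); last by apply: eq_lpp => i j _ _ _; exact: eU.
  exact: (eU 0%N 0%N).
move=> ->; congr (_ + _ + _); apply: eq_bigr => i _.
by rewrite /rescale /vaxis /= rr mul1r.
Qed.

Lemma sandwich_trans (R : realType) (p I J h k c e1 e2 : R) :
  p <= I + e1 -> J - e1 <= p -> `|I - h| <= c -> `|J - k| <= c -> e1 + c <= e2 ->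
  p <= h + e2 /\ k - e2 <= p.
Proof. rewrite !ler_norml => ? ? /andP[? ?] /andP[? ?] ?; split; lra. Qed.

(* [g1] and [g2] are the variances left to the passage times started [k1.+1] rows
   below, resp. [k2.+1] columns left of, the corner; [V] is the variance of the
   difference of the two sums along the axes, in units of [nn]. *)
Lemma interface_estimate (R : realType) (rm rp Bc kappa th : R) :
  0 < rm < 1 -> 0 < rp < 1 -> 1 <= Bc -> 0 < kappa -> 0 < th ->
  exists2 K, 0 <= K & forall (M N k1 k2 : nat),
  let nn : R := N.+1%:R in let mm : R := M.+1%:R in let S := Num.sqrt nn in
  mm <= Bc * nn -> (k1 <= N)%N -> (k2 <= M)%N ->
  let g1 := k1.+1%:R / rm ^+ 2 - mm / (1 - rm) ^+ 2 in
  let g2 := k2.+1%:R / (1 - rp) ^+ 2 - nn / rp ^+ 2 in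
  kappa * (Bc * nn) <= g1 -> kappa * (Bc * nn) <= g2 ->
  forall (d : measure_display) (T : measurableType d) (P : probability T R)
    (X : nat * nat -> T -> R), exp_env P rm (1 - rp) X ->
  forall e A a, 0 < a -> gcdf (- A) <= e -> 1 - e <= gcdf A ->
  let p := fine (P [set t | Lup (weights X t) M.+1 N <= Lright (weights X t) M N.+1]) in
  let b := (mm / (1 - rm) + nn / rm) - (mm / (1 - rp) + nn / rp) in
  let V := ((N - k1)%:R / rm ^+ 2 + (M - k2)%:R / (1 - rp) ^+ 2) / nn in
  let err := e + gpeak / Num.sqrt th * ((a + 2 * (g1 + g2 + K) / nn / a) / 2) + K / S in
  p <= heat (th + V) (A * Num.sqrt th - b / S) + err /\
  heat (th + V) (- A * Num.sqrt th - b / S) - err <= p.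
Proof.
move=> rm01 rp01 Bc1 k0 th0.
have /andP[rm0 rm1] := rm01; have /andP[rp0 rp1] := rp01.
have sp0 : 0 < 1 - rp by rewrite subr_gt0.
have sp01 : 0 < 1 - rp < 1 by rewrite sp0 gtrBl.
have [K1 K10 h1] := exp_env_split rm01 sp0 k0.
have [K2 K20 h2] := exp_env_split sp01 rm0 k0.
have [C C0 hC] := heat_axes rm0 sp0 th0.
have CB0 : 0 <= (1 + Bc) * C by rewrite mulr_ge0//; lra.
exists (K1 + K2 + (1 + Bc) * C); first by rewrite !addr_ge0.
set K := K1 + K2 + _.
move=> M N k1 k2 nn mm S mmB k1N k2M g1 g2 hg1 hg2 d T P X eX e A a a0 A1 A2 p b V err.
have nn1 : 1 <= nn by rewrite ler1n.
have nn0 : 0 < nn by exact: lt_le_trans nn1.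
have S0 : 0 < S by rewrite sqrtr_gt0.
have S2 : S ^+ 2 = nn by rewrite sqr_sqrtr// ltW.
have S1 : 1 <= S by rewrite -(@ler_pXn2r _ 2) ?nnegrE ?(ltW S0)// expr1n S2.
have Bn : nn <= Bc * nn by rewrite ler_peMl// ltW.
have B1 : 1 <= Bc * nn by exact: le_trans Bn.
(* L^- is L^+ for the transposed environment, with parameter 1 - rp in place of rm. The size
   [Bc * nn] dominates both side lengths and serves for both applications. *)
have eXt := exp_env_transpose eX; set Xt := (fun z => _) in eXt.
have [Q1 [E1 [sQ1 I1 [mE1 PE1] D1]]] := h1 _ _ _ _ B1 mmB Bn k1N hg1 d T P X eX.
have hg2' : kappa * (Bc * nn) <= k2.+1%:R / (1 - rp) ^+ 2 - nn / (1 - (1 - rp)) ^+ 2.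
  by rewrite subKr.
have [Q2 [E2 [sQ2 I2 [mE2 PE2] D2]]] := h2 _ _ _ _ B1 Bn mmB k2M hg2' d T P Xt eXt.
rewrite subKr in I2.
pose U t := Lup (weights X t) M.+1 N; pose W t := Lright (weights X t) M N.+1.
pose cs t := csum X vaxis rm (N - k1) t - csum X haxis (1 - rp) (M - k2) t.
have [[m0 indX] X0] := eX.
have mU : measurable_fun setT U.
  apply: (measurable_Lup (w := fun i j t => weights X t i j)) => i j.
  exact: measurable_weights eX.
have mW : measurable_fun setT W.
  apply: (measurable_Lup (w := fun i j t => weights Xt t i j)) => i j.
  exact: measurable_weights eXt.
have mcs : measurable_fun setT cs.
  by apply: measurable_funB; exact: (measurable_csum indX).
pose D t := S^-1 * (U t - W t); pose G t := S^-1 * b + S^-1 * cs t.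
pose Q t := S^-1 * (Q1 t - Q2 t).
have mD : measurable_fun setT D by apply: measurable_funM => //; exact: measurable_funB.
have mG : measurable_fun setT G by apply: measurable_funD => //; exact: measurable_funM.
have sQ : sqint P Q by apply: sqintZ; exact: sqintB.
have mE : measurable (E1 `|` E2) by exact: measurableU.
have DE t : ~ (E1 `|` E2) t -> D t = G t + Q t.
  move=> nE; have n1 : ~ E1 t by move=> h; apply: nE; left.
  have n2 : ~ E2 t by move=> h; apply: nE; right.
  rewrite /D /U (D1 t n1) /W /Lright.
  have -> : Lup (transpose (weights X t)) N.+1 M = Lup (weights Xt t) N.+1 M by [].
  rewrite (D2 t n2) /G /Q /b /cs /lpp_mean subKr.
  have -> : csum Xt vaxis (1 - rp) (M - k2) t = csum X haxis (1 - rp) (M - k2) t by [].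
  rewrite -/mm -/nn; ring.
have [up lo] := smoothing th0 a0 A1 A2 mD mG sQ mE DE.
have pE : [set t | D t <= 0] = [set t | Lup (weights X t) M.+1 N <= Lright (weights X t) M N.+1].
  by apply/seteqP; split => t /=; rewrite /D pmulr_rle0 ?invr_gt0// subr_le0.
rewrite pE -/p in up lo.
set err0 := (X in _ + X) in up; rewrite -/err0 in lo.
have Si : 0 <= S^-1 <= 1 by rewrite invr_ge0 (ltW S0) invf_le1.
(* There are at most (1 + Bc) S^2 summands, each scaled by 1/S and costing C S^-3. *)
have L c : `|\int[P]_t heat th (c - G t) - heat (th + V) (c - b / S)| <= (1 + Bc) * C / S.
  have := hC d T P X eX th S^-1 (c - b / S) (N - k1)%N (M - k2)%N (lexx _) Si.
  have -> : th + ((N - k1)%:R * (S^-1 ^+ 2 / rm ^+ 2) + (M - k2)%:R * (S^-1 ^+ 2 / (1 - rp) ^+ 2))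
     = th + V by rewrite exprVn S2 /V; congr (_ + _); ring.
  have -> : \int[P]_t heat th (c - b / S - S^-1 * (csum X vaxis rm (N - k1) t - csum X haxis (1 - rp) (M - k2) t)) = \int[P]_t heat th (c - G t).
    by apply: eq_Rintegral => t _; congr heat; rewrite /G /cs; ring.
  move/le_trans; apply.
  have NM : (N - k1)%:R + (M - k2)%:R <= (1 + Bc) * nn.
    rewrite mulrDl mul1r lerD//; first by rewrite ler_nat (leq_trans (leq_subr _ _)).
    by apply: le_trans mmB; rewrite ler_nat (leq_trans (leq_subr _ _)).
  apply: (@le_trans _ _ ((1 + Bc) * nn * (C * S^-1 ^+ 3))).
    apply: ler_wpM2r => //; apply: mulr_ge0 => //; rewrite exprn_ge0//.
    by case/andP: Si.
  rewrite -S2 le_eqVlt; apply/orP; left; apply/eqP; field; exact: lt0r_neq0.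
(* [Q1] and [Q2] may be dependent, so (Q1 - Q2)^2 <= 2 Q1^2 + 2 Q2^2 is used. *)
have EQ : \int[P]_t ((Q t) ^+ 2) <= 2 * (g1 + g2 + K) / nn.
  apply: (@le_trans _ _ (\int[P]_t (2 / nn * ((Q1 t) ^+ 2 + (Q2 t) ^+ 2)))).
    have i12 : P.-integrable setT (EFin \o (fun t => (Q1 t) ^+ 2 + (Q2 t) ^+ 2)).
      exact: (integrableD measurableT sQ1.2 sQ2.2).
    apply: le_Rintegral => //; first exact: sQ.2.
      exact: (integrableZl measurableT (2 / nn) i12).
    move=> t _; rewrite /Q exprMn exprVn S2 [2 / nn]mulrC -mulrA ler_wpM2l ?invr_ge0 ?(ltW nn0)//.
    rewrite -subr_ge0; have -> : 2 * (Q1 t ^+ 2 + Q2 t ^+ 2) - (Q1 t - Q2 t) ^+ 2 =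
      (Q1 t + Q2 t) ^+ 2 by ring.
    exact: sqr_ge0.
  rewrite RintegralZl//; last exact: (integrableD measurableT sQ1.2 sQ2.2).
  rewrite RintegralD//; [|exact: sQ1.2|exact: sQ2.2].
  rewrite [leRHS]mulrAC; apply: ler_wpM2l; first by rewrite divr_ge0// ltW.
  apply: (le_trans (lerD I1 I2)); by rewrite addrACA lerD2l lerDl.
(* The exit probabilities are of order nn^-2; the cruder rate 1/S lets them join the Lindeberg error
   in the single term [K / S]. *)
have PE : fine (P (E1 `|` E2)) <= (K1 + K2) / S.
  have nS : (Bc * nn) ^- 2 <= S^-1.
    rewrite lef_pV2 ?posrE ?exprn_gt0//; last by rewrite (lt_le_trans ltr01).
    have SS : S <= nn by rewrite -S2 expr2 ler_peMl// ltW.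
    by apply: (le_trans SS); apply: (le_trans Bn); rewrite expr2 ler_peMl// (le_trans ler01).
  have PU : (P (E1 `|` E2) <= P E1 + P E2)%E by exact: measureU2.
  have PK : (P (E1 `|` E2) <= (K1 / (Bc * nn) ^+ 2 + K2 / (Bc * nn) ^+ 2)%:E)%E.
    by apply: (le_trans PU); rewrite EFinD; exact: leeD.
  have Pf : P (E1 `|` E2) \is a fin_num by exact: fin_num_measure.
  apply: (@le_trans _ _ (K1 / (Bc * nn) ^+ 2 + K2 / (Bc * nn) ^+ 2)).
    by rewrite -lee_fin fineK.
  by rewrite -mulrDl; apply: ler_wpM2l => //; exact: addr_ge0.
have errle : err0 + (1 + Bc) * C / S <= err.
  have -> : err = e + gpeak / Num.sqrt th * ((a + 2 * (g1 + g2 + K) / nn / a) / 2) +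
      (K1 + K2) / S + (1 + Bc) * C / S by rewrite /err /K; ring.
  rewrite /err0; apply: lerD => //; apply: lerD => //; apply: lerD => //.
  apply: ler_wpM2l; first by rewrite divr_ge0 ?gpeak_ge0// sqrtr_ge0.
  rewrite ler_pM2r// lerD2l ler_pM2r ?invr_gt0//.
exact: (sandwich_trans up lo (L _) (L _) errle).
Qed.

(** * Arithmetic of the choice of parameters *)

Section ParameterBounds.
Variable R : realType.

(** This chooses the length of the remaining stretch: its variance hits a prescribed target up to
    the variance of one weight. *)
Lemma index_near (r x : R) : 0 < r -> 0 <= x ->
  exists k : nat, x <= k.+1%:R / r ^+ 2 <= x + 1 / r ^+ 2.
Proof.
move=> r0 x0; have r20 : 0 < r ^+ 2 by rewrite exprn_gt0.
have y0 : 0 <= x * r ^+ 2 by rewrite mulr_ge0// ltW.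
exists (Num.truncn (x * r ^+ 2)).
have /andP[h1 h2] := truncn_itv y0.
rewrite ler_pdivlMr// (ltW h2) /= -lerBlDr -mulrBl -natr1 addrK ler_pdivrMr//.
Qed.

(** Two effects move the variance off its limit: the point is off the line by z = O(S), and the
    remainders withhold [G], about 2 e0 S^2. Only the second does not vanish, and it is small
    through [e0]. *)
Lemma variance_bound (U q1 q2 S z e0 c0 G h : R) : 1 <= S -> `|z| <= U * S ->
  0 <= q1 -> 0 <= q2 -> 0 <= c0 -> 0 <= G -> G <= 2 * e0 * S ^+ 2 + c0 ->
  U * (q1 + q2) + c0 <= h * S ->
  `|z / S ^+ 2 * (q2 - q1) - G / S ^+ 2| <= 2 * e0 + h.
Proof.
move=> S1 zU q10 q20 c00 G0 hG hh.
have S0 : 0 < S by exact: lt_le_trans S1.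
have S20 : 0 < S ^+ 2 by rewrite exprn_gt0.
have -> : z / S ^+ 2 * (q2 - q1) - G / S ^+ 2 = (z * (q2 - q1) - G) / S ^+ 2 by ring.
rewrite normrM [`|_^-1|]ger0_norm ?invr_ge0 ?(ltW S20)// ler_pdivrMr//.
apply: (le_trans (ler_normB _ _)); rewrite [`|G|]ger0_norm//.
have h1 : `|z * (q2 - q1)| <= U * S * (q1 + q2).
  rewrite normrM ler_pM//.
  by apply: (le_trans (ler_normB _ _)); rewrite !ger0_norm// addrC.
have h2 : (U * (q1 + q2) + c0) * S <= h * S * S by rewrite ler_wpM2r// ltW.
have h3 : c0 <= c0 * S by rewrite ler_peMr.
apply: (le_trans (lerD h1 hG)); rewrite -subr_ge0.
have -> : (2 * e0 + h) * S ^+ 2 - (U * S * (q1 + q2) + (2 * e0 * S ^+ 2 + c0)) =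
  (h * S * S - (U * (q1 + q2) + c0) * S) + (c0 * S - c0) by ring.
by rewrite addr_ge0// subr_ge0.
Qed.

Lemma error_bound (e L a G K S c0 e0 g : R) : 1 <= S -> 0 <= L -> 0 < a -> 0 <= K ->
  0 <= c0 -> G <= 2 * e0 * S ^+ 2 + c0 -> e <= g / 6 -> L * a <= g / 6 ->
  L * e0 * 24 <= a * g -> (L * (c0 + K) / a + K) * 6 <= g * S ->
  e + L * ((a + 2 * (G + K) / S ^+ 2 / a) / 2) + K / S <= g / 2.
Proof.
move=> S1 L0 a0 K0 c00 hG eg La Le hS.
have S0 : 0 < S by exact: lt_le_trans S1.
have S20 : 0 < S ^+ 2 by rewrite exprn_gt0.
have h1 : L * (G + K) / (S ^+ 2 * a) <= L * (2 * e0 * S ^+ 2 + c0 + K) / (S ^+ 2 * a).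
  apply: ler_wpM2r; first by rewrite invr_ge0 mulr_ge0// ltW.
  by apply: ler_wpM2l => //; rewrite lerD2r.
have h2 : L * (2 * e0 * S ^+ 2 + c0 + K) / (S ^+ 2 * a) =
    2 * (L * e0 / a) + L * (c0 + K) / a / S ^+ 2 by field; rewrite !gt_eqF.
have h3 : L * e0 / a <= g / 24.
  by rewrite ler_pdivrMr// [leRHS]mulrAC ler_pdivlMr// [g * a]mulrC.
have c1 : 0 <= L * (c0 + K) / a by rewrite divr_ge0 ?(ltW a0)// mulr_ge0// addr_ge0.
have h4 : L * (c0 + K) / a / S ^+ 2 <= L * (c0 + K) / a / S.
  rewrite ler_wpM2l// lef_pV2 ?posrE// expr2 ler_peMl// ltW//.
have h5 : L * (c0 + K) / a / S + K / S <= g / 6.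
  by rewrite -mulrDl ler_pdivrMr// [leRHS]mulrAC ler_pdivlMr.
have -> : e + L * ((a + 2 * (G + K) / S ^+ 2 / a) / 2) + K / S =
  e + L * a / 2 + L * (G + K) / (S ^+ 2 * a) + K / S by field; rewrite !gt_eqF.
rewrite h2 in h1; move: h1 h3 h4 h5 eg La; set x1 := _ / (S ^+ 2 * a); set x2 := _ / a.
set x3 := _ / S ^+ 2; set x4 := _ / S; set x5 := _ / S; set x6 := L * a; lra.
Qed.

Lemma add_le_quarters (x y z d : R) : x <= 2 * z + d / 2 -> y <= d / 4 -> z <= d / 8 ->
  y + x <= d.
Proof. lra. Qed.

Lemma sum6_le (S a b c d e f : R) : 0 <= a -> 0 <= b -> 0 <= c -> 0 <= d -> 0 <= e ->
  0 <= f -> a + b + c + d + e + f <= S ->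
  [/\ a <= S, b <= S, c <= S, d <= S & e <= S /\ f <= S].
Proof. by move=> *; split; [lra|lra|lra|lra|split; lra]. Qed.

Lemma index_room (U q q' c c0 z e0 v S : R) : 1 <= S -> `|z| <= U * S -> 0 <= U ->
  0 <= q -> 0 <= q' -> 0 <= c -> c <= c0 -> e0 <= v / 4 -> 0 <= v ->
  2 * (U * (q + q') + c0) <= v * S -> `|z| * q + e0 * S ^+ 2 + c <= v * S ^+ 2.
Proof.
move=> S1 zU U0 q0 q'0 c0' cc0 ev v0 h.
have S0 : 0 <= S by exact: le_trans S1.
have h1 : `|z| * q <= U * S * q by rewrite ler_wpM2r.
have h2 : e0 * S ^+ 2 <= v / 4 * S ^+ 2 by rewrite ler_wpM2r// exprn_ge0.
have h3 : c <= c0 * S by apply: (le_trans cc0); rewrite ler_peMr// (le_trans c0').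
have h4 : 2 * (U * (q + q') + c0) * S <= v * S ^+ 2 by rewrite expr2 mulrA ler_wpM2r.
have h5 : 0 <= U * q' * S by rewrite !mulr_ge0.
have h6 : 0 <= v * S ^+ 2 by rewrite mulr_ge0// exprn_ge0.
move: h1 h2 h3 h4 h5 h6; have -> : 2 * (U * (q + q') + c0) * S =
  2 * (U * S * q) + 2 * (U * q' * S) + 2 * (c0 * S) by ring.
have -> : v / 4 * S ^+ 2 = v * S ^+ 2 / 4 by ring.
set x1 := `|z| * q; set x2 := U * S * q; set x3 := e0 * _; set x4 := v * _.
set x5 := c0 * S; set x6 := _ * q' * S; lra.
Qed.

End ParameterBounds.

Section InterfaceLimit.
Context (R : realType) (rm rp : R).
Hypotheses (rm0 : 0 < rm) (rmp : rm < rp) (rp1 : rp < 1).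
Let eta := (1 - rp) * (1 - rm) / (rm * rp).
Let v_p := 1 / rm ^+ 2 - eta / (1 - rm) ^+ 2.
Let v_m := eta / (1 - rp) ^+ 2 - 1 / rp ^+ 2.
Let m_p := 1 / (1 - rm).
Let m_m := 1 / (1 - rp).

Let rp0 : 0 < rp. Proof. exact: lt_trans rmp. Qed.
Let sm0 : 0 < 1 - rm. Proof. by rewrite subr_gt0 (lt_trans rmp). Qed.
Let sp0 : 0 < 1 - rp. Proof. by rewrite subr_gt0. Qed.

Lemma eta_gt0 : 0 < eta.
Proof. by rewrite divr_gt0// mulr_gt0. Qed.

(** [v_p] is the gap n/rho^2 - m/(1-rho)^2 per unit of n on the line m = eta n for the parameter rm;
    its positivity leaves room for an initial stretch of linear length. *)
Lemma v_p_gt0 : 0 < v_p.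
Proof.
have -> : v_p = (rp - rm) / (rm ^+ 2 * rp * (1 - rm)).
  by rewrite /v_p /eta; field; rewrite !gt_eqF.
by rewrite divr_gt0 ?subr_gt0// !mulr_gt0// exprn_gt0.
Qed.

Lemma v_m_gt0 : 0 < v_m.
Proof.
have -> : v_m = (rp - rm) / (rm * rp ^+ 2 * (1 - rp)).
  by rewrite /v_m /eta; field; rewrite !gt_eqF.
by rewrite divr_gt0 ?subr_gt0// !mulr_gt0// exprn_gt0.
Qed.

(** This is the origin of [eta]: x = eta y is the direction in which the two stationary means
    agree. *)
Lemma lpp_mean_gap (x y : R) :
  (x / (1 - rm) + y / rm) - (x / (1 - rp) + y / rp) = (m_p - m_m) * (x - eta * y).
Proof. by rewrite /m_p /m_m /eta; field; rewrite !gt_eqF. Qed.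

(** The order of choices is essential: the tails and the continuity of [heat] fix [A] and [dc], then
    [th], [a] and [e0] follow. [K] depends on [th] and [e0], so only a large S can beat it. *)
Lemma interface_limit (u g : R) : 0 < g -> exists dl S0 : R, 0 < dl /\
  forall M N : nat, let S := Num.sqrt (N.+1%:R : R) in
  S0 <= S -> `|M.+1%:R - eta * N.+1%:R - u * S| <= dl * S ->
  forall (d : measure_display) (T : measurableType d) (P : probability T R)
    (X : nat * nat -> T -> R), exp_env P rm (1 - rp) X ->
  `|fine (P [set t | Lup (weights X t) M.+1 N <= Lright (weights X t) M N.+1]) -
    (1 - gcdf (u * (m_p - m_m) / Num.sqrt (v_m + v_p)))| <= g.
Proof.
move=> g0; have [eta0 v_p0 v_m0] := And3 eta_gt0 v_p_gt0 v_m_gt0; pose mu := m_p - m_m; pose y0 := - (u * mu); pose v := v_m + v_p.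
have v0 : 0 < v by rewrite addr_gt0.
have g60 : 0 < g / 6 by rewrite divr_gt0.
have [A A0 [A1 A2]] := gcdf_tails g60.
have [dc dc0 hdc] := heat_continuous y0 v0 g60.
pose th := Num.min (dc / 4) ((dc / (2 * A)) ^+ 2).
have dA0 : 0 < dc / (2 * A) by rewrite divr_gt0// mulr_gt0.
have th0 : 0 < th by rewrite lt_min divr_gt0// exprn_gt0.
have th1 : th <= dc / 4 by rewrite ge_min lexx.
have th2 : A * Num.sqrt th <= dc / 2.
  have : Num.sqrt th <= dc / (2 * A).
    by rewrite -[leRHS](ger0_norm (ltW dA0)) -sqrtr_sqr ler_wsqrtr// ge_min lexx orbT.
  rewrite ler_pdivlMr ?mulr_gt0//; lra.
pose L := gpeak / Num.sqrt th.
have L0 : 0 <= L by rewrite divr_ge0 ?gpeak_ge0// sqrtr_ge0.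
have L10 : 0 < L + 1 by rewrite ltr_wpDl.
pose a := g / (6 * (L + 1)).
have a0 : 0 < a by rewrite divr_gt0// mulr_gt0.
have La : L * a <= g / 6.
  rewrite /a mulrA ler_pdivrMr ?mulr_gt0//; lra.
(* [e0] is the variance per unit of nn left to each remainder. The four bounds keep the limit
   variance within [dc], keep the smoothing error below its share of [g], and make both stretches
   fit in their axes. *)
pose e0 := Num.min (Num.min (dc / 8) (a * g / (24 * (L + 1)))) (Num.min (v_p / 4) (v_m / 4)).
have e00 : 0 < e0.
  rewrite !lt_min; apply/andP; split; apply/andP; split.
  - exact: divr_gt0.
  - by apply: divr_gt0; exact: mulr_gt0.
  - exact: divr_gt0.
  - exact: divr_gt0.
have [e1 e2 e3 e4] : [/\ e0 <= dc / 8, e0 <= a * g / (24 * (L + 1)), e0 <= v_p / 4 & e0 <= v_m / 4].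
  by split; rewrite /e0 !ge_min lexx ?orbT.
have Le : L * e0 * 24 <= a * g.
  move: e2; rewrite ler_pdivlMr ?mulr_gt0// => e2; apply: le_trans e2.
  have -> : e0 * (24 * (L + 1)) = L * e0 * 24 + 24 * e0 by ring.
  by rewrite lerDl mulr_ge0// ltW.
pose Bc := eta + 1.
have Bc1 : 1 <= Bc by rewrite lerDr ltW.
have Bc0 : 0 < Bc by exact: lt_le_trans Bc1.
have rm01 : 0 < rm < 1 by rewrite rm0 (lt_trans rmp).
have rp01 : 0 < rp < 1 by rewrite rp0.
have kap0 : 0 < e0 / Bc by rewrite divr_gt0.
have [K K0 hK] := interface_estimate rm01 rp01 Bc1 kap0 th0.
(* The bound 1 gives |z| <= (|u| + 1) S; the other keeps the rescaled mean within dc/2 of its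
   limit. *)
pose dl := Num.min 1 (dc / (2 * (`|mu| + 1))).
have mu10 : 0 < `|mu| + 1 by rewrite ltr_wpDl.
have dl0 : 0 < dl by rewrite lt_min ltr01 divr_gt0// mulr_gt0.
have dl1 : dl <= 1 by rewrite ge_min lexx.
have dl2 : `|mu| * dl <= dc / 2.
  have : dl <= dc / (2 * (`|mu| + 1)) by rewrite ge_min lexx orbT.
  rewrite ler_pdivlMr ?mulr_gt0// => h; rewrite ler_pdivlMr//.
  apply: le_trans h.
  have -> : dl * (2 * (`|mu| + 1)) = `|mu| * dl * 2 + 2 * dl by ring.
  by rewrite lerDl mulr_ge0// ltW.
pose U := `|u| + 1.
have U0 : 0 <= U by rewrite addr_ge0.
pose q1 := 1 / (1 - rm) ^+ 2; pose q2 := 1 / (1 - rp) ^+ 2.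
pose c1 := 1 / rm ^+ 2.
have [q10 q20 c10] : [/\ 0 <= q1, 0 <= q2 & 0 <= c1].
  by split; rewrite divr_ge0// exprn_ge0// ltW.
pose c0 := c1 + q2.
have c00 : 0 <= c0 by rewrite addr_ge0.
pose H := U * (q1 + q2) + c0.
have H0 : 0 <= H by rewrite addr_ge0// mulr_ge0// addr_ge0.
pose J := (L * (c0 + K) / a + K) * 6 / g.
have J0 : 0 <= J.
  by rewrite divr_ge0 ?(ltW g0)// mulr_ge0// addr_ge0// divr_ge0 ?(ltW a0)// mulr_ge0// addr_ge0.
have [p1 p2 p3] : [/\ 0 <= 2 * H / v_p, 0 <= 2 * H / v_m & 0 <= 2 * H / dc].
  by split; rewrite divr_ge0 ?mulr_ge0// ltW.
exists dl, (1 + U + 2 * H / v_p + 2 * H / v_m + 2 * H / dc + J); split => //.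
move=> M N S hS hz d T P X eX.
pose nn : R := N.+1%:R; pose mm : R := M.+1%:R; pose z := mm - eta * nn.
have [S1 US Sp Sm [Sd SJ]] : [/\ 1 <= S, U <= S, 2 * H / v_p <= S, 2 * H / v_m <= S &
   2 * H / dc <= S /\ J <= S].
  exact: sum6_le hS.
have S0 : 0 < S by exact: lt_le_trans S1.
have nn0 : 0 < nn by rewrite ltr0n.
have S2 : S ^+ 2 = nn by rewrite sqr_sqrtr// ltW.
have zU : `|z| <= U * S.
  have -> : z = (mm - eta * nn - u * S) + u * S by rewrite /z; ring.
  apply: (le_trans (ler_normD _ _)); rewrite /U mulrDl addrC lerD//.
    by rewrite normrM [`|S|]ger0_norm// ltW.
  by apply: (le_trans hz); rewrite ler_wpM2r// ltW.
have zn : `|z| <= nn.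
  by apply: (le_trans zU); rewrite -S2 expr2 ler_wpM2r// ltW.
have mmB : mm <= Bc * nn.
  move: zn; rewrite ler_norml => /andP[_]; rewrite /z /Bc mulrDl mul1r lerBlDl//.
have znE : mm = eta * nn + z by rewrite /z addrC subrK.
have Hp : 2 * (U * (q1 + q2) + c0) <= v_p * S by move: Sp; rewrite ler_pdivrMr// [S * _]mulrC.
have Hm : 2 * (U * (q2 + q1) + c0) <= v_m * S.
  by move: Sm; rewrite ler_pdivrMr// [S * _]mulrC [q2 + _]addrC.
have q2c : q2 <= c0 by rewrite lerDr.
have c1c : c1 <= c0 by rewrite lerDl.
have room1 := index_room S1 zU U0 q10 q20 c10 c1c e3 (ltW v_p0) Hp.
have room2 := index_room S1 zU U0 q20 q10 q20 q2c e4 (ltW v_m0) Hm.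
have [x10 x20] : 0 <= mm / (1 - rm) ^+ 2 + e0 * nn /\ 0 <= nn / rp ^+ 2 + e0 * nn.
  by split; rewrite addr_ge0 ?(mulr_ge0 (ltW e00))// ?divr_ge0 ?exprn_ge0// ltW.
(* The targets are such that both gaps [g1] and [g2] lie between e0 nn and e0 nn plus a constant. *)
have [k1 /andP[k1l k1u]] := index_near rm0 x10.
have [k2 /andP[k2l k2u]] := index_near sp0 x20.
have mono (r : R) (i j : nat) : 0 < r -> i.+1%:R / r ^+ 2 <= j.+1%:R / r ^+ 2 -> (i <= j)%N.
  by move=> r0; rewrite ler_pM2r ?invr_gt0 ?exprn_gt0// ler_nat ltnS.
have k1N : (k1 <= N)%N.
  apply: (mono rm) => //; apply: (le_trans k1u); rewrite -/nn.
  have -> : nn / rm ^+ 2 = v_p * S ^+ 2 + eta * nn / (1 - rm) ^+ 2.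
    by rewrite S2 /v_p; ring.
  have -> : mm / (1 - rm) ^+ 2 + e0 * nn + 1 / rm ^+ 2 =
     (z * q1 + e0 * S ^+ 2 + c1) + eta * nn / (1 - rm) ^+ 2.
    by rewrite S2 znE /q1 /c1; ring.
  rewrite lerD2r; apply: le_trans room1; rewrite !lerD2r; apply: ler_wpM2r => //; exact: ler_norm.
have k2M : (k2 <= M)%N.
  apply: (mono (1 - rp)) => //; apply: (le_trans k2u); rewrite -/mm.
  have -> : mm / (1 - rp) ^+ 2 = v_m * S ^+ 2 + nn / rp ^+ 2 + z * q2.
    by rewrite S2 znE /v_m /q2; ring.
  have -> : nn / rp ^+ 2 + e0 * nn + 1 / (1 - rp) ^+ 2 =
     (- z * q2 + e0 * S ^+ 2 + q2) + nn / rp ^+ 2 + z * q2.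
    by rewrite S2 /q2; ring.
  rewrite !lerD2r; apply: le_trans room2; rewrite !lerD2r; apply: ler_wpM2r => //.
  by rewrite -normrN; exact: ler_norm.
pose g1 := k1.+1%:R / rm ^+ 2 - mm / (1 - rm) ^+ 2.
pose g2 := k2.+1%:R / (1 - rp) ^+ 2 - nn / rp ^+ 2.
have kB : e0 / Bc * (Bc * nn) = e0 * nn by rewrite mulrA divfK// gt_eqF.
have g1l : e0 / Bc * (Bc * nn) <= g1 by rewrite kB /g1 lerBrDl.
have g2l : e0 / Bc * (Bc * nn) <= g2 by rewrite kB /g2 lerBrDl.
have g1u : g1 <= e0 * nn + c1 by rewrite /g1 lerBlDl addrA.
have g2u : g2 <= e0 * nn + q2 by rewrite /g2 lerBlDl addrA.
have gl0 : 0 <= e0 * nn by rewrite mulr_ge0// ltW.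
have G0 : 0 <= g1 + g2 by rewrite addr_ge0// (le_trans gl0)// -kB.
have Gu : g1 + g2 <= 2 * e0 * S ^+ 2 + c0.
  by apply: (le_trans (lerD g1u g2u)); rewrite S2 /c0 le_eqVlt; apply/orP; left; apply/eqP; ring.
have [up lo] := hK M N k1 k2 mmB k1N k2M g1l g2l d T P X eX (g / 6) A a a0 A1 A2.
rewrite -/nn -/mm -/S -/g1 -/g2 -/L -S2 in up lo.
set p := fine _ in up lo *.
set V := (X in heat (th + X) _) in up; rewrite -/V in lo.
set err := (X in _ + X) in up; rewrite -/err in lo.
set b := (X in _ - X / S) in up; rewrite -/b in lo.
have bE : b = mu * z by rewrite /b S2; exact: lpp_mean_gap.
have errg : err <= g / 2.
  apply: (error_bound S1 L0 a0 K0 c00 Gu) => //.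
  by move: SJ; rewrite /J ler_pdivrMr// [S * g]mulrC.
(* Full axes would give variance v up to the deviation z; the gaps [g1] and [g2] are what the
   remainders withhold. *)
have VE : V = v + (z / S ^+ 2 * (q2 - q1) - (g1 + g2) / S ^+ 2).
  have nk1 : (N - k1)%:R = nn - k1.+1%:R by rewrite -natrB ?subSS.
  have nk2 : (M - k2)%:R = mm - k2.+1%:R by rewrite -natrB ?subSS.
  rewrite /V nk1 nk2 /v /v_m /v_p /q1 /q2 /g1 /g2 znE -S2.
  clear -S0 sm0 sp0 rm0 rp0; move: eta => et.
  by field; rewrite !gt_eqF.
have Vb : `|V - v| <= 2 * e0 + dc / 2.
  rewrite VE addrC addKr; apply: (variance_bound S1 zU q10 q20 c00 G0 Gu).
  by move: Sd; rewrite ler_pdivrMr// /H => h; rewrite mulrAC ler_pdivlMr// mulrC [dc * S]mulrC.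
have hs : `|th + V - v| <= dc.
  rewrite -addrA; apply: (le_trans (ler_normD _ _)); rewrite [`|th|]gtr0_norm//.
  exact: add_le_quarters Vb th1 e1.
have hc (c : R) : `|c| <= dc / 2 -> `|c - b / S - y0| <= dc.
  move=> cd; have -> : c - b / S - y0 = c - mu * (z / S - u) by rewrite bE /y0; ring.
  apply: (le_trans (ler_normB _ _)); rewrite normrM.
  have zs : `|z / S - u| <= dl.
    have -> : z / S - u = (z - u * S) / S by field; rewrite gt_eqF.
    by rewrite normrM [`|_^-1|]gtr0_norm ?invr_gt0// ler_pdivrMr.
  have h2 : `|mu| * `|z / S - u| <= dc / 2 by apply: le_trans dl2; rewrite ler_wpM2l.
  by apply: (le_trans (lerD cd h2)); rewrite -splitr.
have As : `|A * Num.sqrt th| <= dc / 2 by rewrite ger0_norm// mulr_ge0 ?(ltW A0)// sqrtr_ge0.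
have As' : `|- A * Num.sqrt th| <= dc / 2 by rewrite mulNr normrN.
have h1 := hdc _ _ hs (hc _ As); have h2 := hdc _ _ hs (hc _ As').
have E : heat v y0 = 1 - gcdf (u * mu / Num.sqrt v).
  by rewrite /heat /y0 mulNr gcdfN.
rewrite E in h1 h2; move: h1 h2 up lo errg; rewrite -/mu -/v.
clear -g0; set x1 := heat _ _; set x2 := heat _ _; set x3 := gcdf _.
rewrite !ler_norml => /andP[? ?] /andP[? ?] ? ? ?; apply/andP; split; lra.
Qed.

End InterfaceLimit.

(** With t = (1+eta) w^2 and c = u/(1+eta), the test point is (eta w^2 + c w, w^2 - c w) up to
    bounded errors. Its deviation from the line is (1+eta) c w = u w, and S = sqrt(N+1) differs from
    w by O(1). *)
Lemma floor_scaling (R : realType) (eta u dl S0 : R) : 0 < eta -> 0 < dl ->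
  exists W0 : R, forall w n t, W0 <= w -> t = (1 + eta) * w ^+ 2 -> n = Num.truncn t ->
  let s := - (1 - eta) * w ^+ 2 + 2 * u * w / (1 + eta) in
  exists M N : nat, let S := Num.sqrt (N.+1%:R : R) in
  [/\ (M < n)%N, N = (n - M.+1)%N,
    forall i j, (i + j)%N = n -> (i%:R - j%:R <= s) = (i <= M)%N, S0 <= S &
    `|M.+1%:R - eta * N.+1%:R - u * S| <= dl * S].
Proof.
move=> eta0 dl0; have e10 : 0 < 1 + eta by rewrite addr_gt0.
pose c := u / (1 + eta); pose C1 := 1 + 2 * eta + `|u| * (`|c| + 2).
have cn := normr_ge0 c; have un := normr_ge0 u; have Sn := normr_ge0 S0.
have C10 : 0 <= C1.
  by rewrite addr_ge0 ?mulr_ge0 ?addr_ge0 ?mulr_ge0// ltW.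
have q1 : 0 <= C1 / dl by rewrite divr_ge0// ltW.
have q2 : 0 <= (`|c| + 1) / eta by rewrite divr_ge0 ?addr_ge0// ltW.
exists (`|c| + 3 + `|S0| + C1 / dl + (`|c| + 1) / eta).
move=> w n t hw tw nt s.
have [w1 w2 w3] : [/\ `|c| + 3 <= w, `|S0| + C1 / dl <= w - `|c| - 2 & (`|c| + 1) / eta <= w].
  by split; move: hw q1 q2; move: (C1 / dl) ((`|c| + 1) / eta) => *; lra.
have w0 : 1 <= w by lra.
have w00 : 0 < w by lra.
have sE : s = - (1 - eta) * w ^+ 2 + 2 * (c * w) by rewrite /s /c; ring.
have cw : `|c * w| <= `|c| * w by rewrite normrM [`|w|]gtr0_norm.
move: cw; rewrite ler_norml => /andP[cw1 cw2].
have t0 : 0 <= t by rewrite tw mulr_ge0 ?sqr_ge0// ltW.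
have /andP[n1 n2] := truncn_itv t0; rewrite -nt -natr1 in n1 n2.
have h1 : (`|c| + 3) * w <= w ^+ 2 by rewrite expr2 ler_wpM2r// ltW.
have h3 : (`|c| + 1) * w <= eta * w ^+ 2.
  rewrite expr2 mulrA ler_wpM2r ?(ltW w00)//.
  by move: w3; rewrite ler_pdivrMr// [w * _]mulrC.
have tE : t = w ^+ 2 + eta * w ^+ 2 by rewrite tw; ring.
(* As i + j = n, the condition i - j <= s reads i <= (n + s)/2, so M is the integer part of this
   number. *)
pose x := (n%:R + s) / 2.
have sE' : s = eta * w ^+ 2 - w ^+ 2 + 2 * (c * w) by rewrite sE; ring.
have x0 : 0 <= x.
  rewrite /x sE' divr_ge0//; move: cw1 h3 tE n2; rewrite !mulrDl !mul1r.
  move: (w ^+ 2) (eta * _) (c * w) (`|c| * w) => *; lra.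
have /andP[m1 m2] := truncn_itv x0.
set M := Num.truncn x in m1 m2; rewrite -natr1 in m2.
have xE : 2 * x = n%:R + s by rewrite /x mulrC divfK.
have Mn : (M < n)%N.
  rewrite -(ltr_nat R); move: cw1 cw2 h1 m1 n1 n2 xE; rewrite tE sE' !mulrDl.
  move: (w ^+ 2) (eta * _) (c * w) (`|c| * w) => *; lra.
exists M, (n - M.+1)%N => S.
have NE : (n - M.+1).+1%:R = n%:R - M%:R :> R by rewrite subnSK// natrB// ltnW.
(* [r1] and [r2] collect the rounding errors of both integer parts; with the bound on S - w below,
   they produce the three terms of [C1]. *)
pose r1 := M.+1%:R - (eta * w ^+ 2 + c * w).
have r1b : `|r1| <= 1.
  rewrite /r1 -natr1 ler_norml; apply/andP; move: m1 m2 n1 n2 xE; rewrite tE sE'.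
  by move: (w ^+ 2) (eta * _) (c * w) => *; split; lra.
pose r2 := (n%:R - M%:R) - (w ^+ 2 - c * w).
have r2b : `|r2| <= 2.
  rewrite /r2 ler_norml; apply/andP; move: m1 m2 n1 n2 xE; rewrite tE sE'.
  by move: (w ^+ 2) (eta * _) (c * w) => *; split; lra.
have S2 : S ^+ 2 = w ^+ 2 - c * w + r2 by rewrite sqr_sqrtr// NE /r2; ring.
have S00 : 0 <= S by rewrite sqrtr_ge0.
have Sw : `|S - w| <= `|c| + 2.
  have Sw0 : 0 < S + w by rewrite ltr_wpDl.
  have e : (S - w) * (S + w) = - (c * w) + r2.
    have -> : (S - w) * (S + w) = S ^+ 2 - w ^+ 2 by ring.
    by rewrite S2; ring.
  rewrite -(ler_pM2r Sw0) -[X in _ * X <= _](gtr0_norm Sw0) -normrM e.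
  apply: (@le_trans _ _ ((`|c| + 2) * w)).
    apply: (le_trans (ler_normD _ _)); rewrite normrN normrM [`|w|]gtr0_norm// mulrDl lerD2l.
    by apply: (le_trans r2b); rewrite ler_peMr.
  by rewrite ler_wpM2l ?addr_ge0// lerDr.
have SL : `|S0| + C1 / dl <= S.
  by move: Sw w2; rewrite ler_norml => /andP[]; move: (C1 / dl) => *; lra.
split => //.
- move=> i j ij; rewrite truncn_ge_nat// /x ler_pdivlMr//.
  have -> : j%:R = n%:R - i%:R :> R by rewrite -ij natrD addrC addKr.
  by rewrite -subr_ge0 -[RHS]subr_ge0; congr (0 <= _); ring.
- by apply: le_trans SL; rewrite (le_trans (ler_norm _))// lerDl.
- have CS : C1 <= dl * S.
    by rewrite mulrC -ler_pdivrMr//; apply: le_trans SL; rewrite lerDr.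
  apply: le_trans CS; rewrite NE.
  have -> : M.+1%:R - eta * (n%:R - M%:R) - u * S = r1 - eta * r2 - u * (S - w).
    by rewrite /r1 /r2 /c; field; rewrite gt_eqF.
  apply: (le_trans (ler_normB _ _)); rewrite /C1 lerD//.
    apply: (le_trans (ler_normB _ _)); rewrite lerD// normrM gtr0_norm// mulrC.
    by rewrite ler_pM2r.
  by rewrite normrM ler_wpM2l.
Qed.

(** * From almost surely nonnegative to nonnegative weights *)

Section AbsoluteWeights.
Context (R : realType) (d : measure_display) (T : measurableType d) (P : probability T R).

Lemma eq_exponential_prob (r : R) (A B : set R) : (forall x, 0 <= x -> A x <-> B x) ->
  exponential_prob r A = exponential_prob r B.
Proof.
move=> AB; rewrite /exponential_prob integral_mkcond [RHS]integral_mkcond.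
apply: eq_integral => x _; rewrite !patchE.
have [x0|x0] := leP 0 x.
  by congr (if _ then _ else _); apply/idP/idP; rewrite !inE => /(AB x x0).
have -> : exponential_pdf r x = 0.
  by rewrite /exponential_pdf patchE memNset//= in_itv/= andbT; apply/negP; rewrite -ltNge.
by case: ifP; case: ifP.
Qed.

Lemma probability_eq_off (N A B : set T) : measurable A -> measurable B -> P.-negligible N ->
  (forall t, ~ N t -> A t <-> B t) -> P A = P B.
Proof.
move=> mA mB [C [mC C0 NC]] AB.
have le (X Y : set T) : measurable X -> measurable Y -> (forall t, ~ N t -> X t -> Y t) -> (P X <= P Y)%E.
  move=> mX mY XY; apply: (@le_trans _ _ (P (Y `|` C))).
    rewrite le_measure ?inE//; first exact: measurableU.
    by move=> t Xt; have [Nt|Nt] := pselect (N t); [right; exact: NC|left; exact: XY].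
  have h : (P (Y `|` C) <= P Y + P C)%E by exact: measureU2.
  by have C0' : P C = 0%E := C0; rewrite C0' adde0 in h.
by apply/eqP; rewrite eq_le; apply/andP; split; apply: le => // t /AB [].
Qed.

(** An exponential law charges only nonnegative reals, so taking absolute values preserves the laws,
    and independence is preserved coordinatewise. *)
Lemma exp_env_abs (a b : R) (omega : nat -> nat -> {RV P >-> R}) :
  (forall i j, (0 < i)%N -> (0 < j)%N -> has_exp_law (omega i j) 1) ->
  (forall j, (0 < j)%N -> has_exp_law (omega 0 j) a) ->
  (forall i, (0 < i)%N -> has_exp_law (omega i 0) b) ->
  mutually_independent (fun z : nat * nat => omega z.1 z.2) ->
  exp_env P a b (fun z t => `|omega z.1 z.2 t|).
Proof.
move=> hbulk hv hh ind; split; last by move=> z t; exact: normr_ge0.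
pose mu (z : nat * nat) (A : set R) := P (omega z.1 z.2 @^-1` A).
have indw : indep_family P mu (fun z => omega z.1 z.2 : T -> R).
  split=> [z|J B uJ mB]; first exact: measurable_funPT.
  exact: (ind J B uJ mB).
have mnr (z : nat * nat) : measurable_fun setT (fun x : R => `|x|).
  exact: (@normr_measurable R setT).
exists (fun A : set R => mu (0, 0)%N ((fun x : R => `|x|) @^-1` A)).
apply: eq_indep_family (indep_family_map mnr indw) => -[i j] A mA.
have mB : measurable ((fun x : R => `|x|) @^-1` A).
  by rewrite -[_ @^-1` _]setTI; exact: (mnr (0, 0)%N).
have abs r : exponential_prob r ((fun x : R => `|x|) @^-1` A) = exponential_prob r A.
  by apply: eq_exponential_prob => x x0 /=; rewrite ger0_norm.
rewrite /env_law /= xpair_eqE /mu /=.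
case: i j => [|i] [|j] //=.
- by rewrite -abs -(hv j.+1 isT _ mB).
- by rewrite -abs -(hh i.+1 isT _ mB).
- by rewrite -abs -(hbulk i.+1 j.+1 isT isT _ mB).
Qed.

Lemma negligible_neg_weights (a b : R) (omega : nat -> nat -> {RV P >-> R}) :
  (forall x, omega 0 0 x = 0) ->
  (forall i j, (0 < i)%N -> (0 < j)%N -> has_exp_law (omega i j) 1) ->
  (forall j, (0 < j)%N -> has_exp_law (omega 0 j) a) ->
  (forall i, (0 < i)%N -> has_exp_law (omega i 0) b) ->
  P.-negligible (\bigcup_i \bigcup_j [set t | omega i j t < 0]).
Proof.
move=> h0 hbulk hv hh; apply: negligible_bigcup => i; apply: negligible_bigcup => j.
have mlt0 : measurable (`]-oo, 0[ : set R) by exact: measurable_itv.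
have E : [set t | omega i j t < 0] = omega i j @^-1` `]-oo, 0[.
  by apply/seteqP; split => t /=; rewrite in_itv.
have m : measurable [set t | omega i j t < 0].
  by rewrite E -[_ @^-1` _]setTI; apply: measurable_funPT.
apply/negligibleP => //; rewrite E.
have z r : exponential_prob r (`]-oo, 0[ : set R) = 0%E.
  rewrite (@eq_exponential_prob r _ set0); first by rewrite /exponential_prob integral_set0.
  by move=> x x0; split => //=; rewrite in_itv/= ltNge x0.
case: i j {E m} => [|i] [|j].
- rewrite (_ : _ @^-1` _ = set0) ?measure0//; apply/seteqP; split => t //=.
  by rewrite in_itv/= h0 ltxx.
- by rewrite -(z a) -(hv j.+1 isT _ mlt0).
- by rewrite -(z b) -(hh i.+1 isT _ mlt0).
- by rewrite -(z 1) -(hbulk i.+1 j.+1 isT isT _ mlt0).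
Qed.

End AbsoluteWeights.

Theorem theorem2p9 (R : realType) (d : measure_display) (T : measurableType d)
  (P : probability T R) (rho_m rho_p : R) (omega : nat -> nat -> {RV P >-> R}) :
  0 < rho_m -> rho_m < rho_p -> rho_p < 1 ->
  (forall x, omega 0 0 x = 0) ->
  (forall i j, (0 < i)%N -> (0 < j)%N -> has_exp_law (omega i j) 1) ->
  (forall j, (0 < j)%N -> has_exp_law (omega 0 j) rho_m) ->
  (forall i, (0 < i)%N -> has_exp_law (omega i 0) (1 - rho_p)) ->
  mutually_independent (fun z : nat * nat => omega z.1 z.2) ->
  let eta := (1 - rho_p) * (1 - rho_m) / (rho_m * rho_p) in
  let v_p := 1 / rho_m ^+ 2 - eta / (1 - rho_m) ^+ 2 in
  let v_m := eta / (1 - rho_p) ^+ 2 - 1 / rho_p ^+ 2 in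
  let m_p := 1 / (1 - rho_m) in
  let m_m := 1 / (1 - rho_p) in
  forall u : R,
    (fun t : R =>
       P [set x | let phi := comp_interface (fun i j => omega i j x) (Num.truncn t) in
                  (phi.1%:R - phi.2%:R : R) <=
                  - t * ((1 - eta) / (1 + eta))
                  + 2 * u * powR t (2^-1) / powR (1 + eta) (3 / 2)])
      @ +oo --> (\int[lebesgue_measure]_(x in `[(u * (m_p - m_m))%R, +oo[%classic)
                   (expR (- (x ^+ 2) / (2 * (v_m + v_p)))
                    / Num.sqrt (2 * pi * (v_m + v_p)))%:E)%E.
Proof.
move=> rm0 rmp rp1 w00 hbulk hv hh ind eta v_p v_m m_p m_m u.
have eta0 : 0 < eta by exact: eta_gt0.
have v0 : 0 < v_m + v_p by apply: addr_gt0; [exact: v_m_gt0|exact: v_p_gt0].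
have e10 : 0 < 1 + eta by rewrite addr_gt0.
rewrite (integral_gaussian_tail _ v0).
have eX := exp_env_abs hbulk hv hh ind.
have neg := negligible_neg_weights w00 hbulk hv hh.
set L := 1 - gcdf _; set f := fun t : R => _.
suff key g : 0 < g -> \forall t \near (+oo : set_system R),
    f t \is a fin_num /\ `|L - fine (f t)| <= g.
  apply/fine_cvgP; split; first by apply: filterS (key 1 ltr01) => t [].
  by apply/cvgrPdist_le => g g0; apply: filterS (key g g0) => t [].
move=> g0.
have [dl [S0 [dl0 hlim]]] := interface_limit rm0 rmp rp1 u g0.
have [W0 hW] := @floor_scaling R eta u dl S0 eta0 dl0.
have t1 : \forall t \near (+oo : set_system R), (1 + eta) * W0 ^+ 2 <= t.
  by apply: nbhs_pinfty_ge; exact: num_real.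
have t2 : \forall t \near (+oo : set_system R), 0 <= t.
  by apply: nbhs_pinfty_ge; exact: num_real.
near=> t.
have tW : (1 + eta) * W0 ^+ 2 <= t by near: t.
have t0 : 0 <= t by near: t.
(* In the variable [w] both powers of t become polynomial, and the threshold of the statement takes
   the form required by [floor_scaling]. *)
pose w := Num.sqrt (t / (1 + eta)).
have tw : t = (1 + eta) * w ^+ 2.
  by rewrite sqr_sqrtr ?divr_ge0 ?(ltW e10)// mulrCA divff ?mulr1// gt_eqF.
have Ww : W0 <= w.
  apply: (le_trans (ler_norm _)); rewrite -sqrtr_sqr ler_wsqrtr//.
  by rewrite ler_pdivlMr// mulrC.
have [M [N [Mn NE hM S0S hz]]] := hW w _ t Ww tw erefl.
set n := Num.truncn t in Mn NE hM *.
have sE : - t * ((1 - eta) / (1 + eta)) + 2 * u * powR t 2^-1 / powR (1 + eta) (3 / 2) =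
    - (1 - eta) * w ^+ 2 + 2 * u * w / (1 + eta).
  have -> : powR t 2^-1 = Num.sqrt (1 + eta) * w.
    by rewrite powR12_sqrt// tw sqrtrM ?(ltW e10)// sqrtr_sqr ger0_norm// sqrtr_ge0.
  have -> : powR (1 + eta) (3 / 2) = (1 + eta) * Num.sqrt (1 + eta).
    have -> : 3 / 2 = 1 + 2^-1 :> R by lra.
    rewrite powRD; last by rewrite gt_eqF ?implybT.
    by rewrite powRr1 ?(ltW e10)// powR12_sqrt// ltW.
  have q0 : 0 < Num.sqrt (1 + eta) by rewrite sqrtr_gt0.
  rewrite {1}tw; move: q0; move: (Num.sqrt _) => q q0.
  by field; rewrite !gt_eqF.
have evE : [set x | let phi := comp_interface (fun i j => omega i j x) n in
    (phi.1%:R - phi.2%:R : R) <= - t * ((1 - eta) / (1 + eta)) +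
      2 * u * powR t (2^-1) / powR (1 + eta) (3 / 2)] =
    [set x | Lup (fun i j => omega i j x) M.+1 N <= Lright (fun i j => omega i j x) M N.+1].
  apply/seteqP; split => x /=; rewrite sE (hM _ _ (comp_interface_sum _ _)).
    by rewrite comp_interface_le// NE.
  by rewrite comp_interface_le// NE.
rewrite /f evE distrC.
pose X (z : nat * nat) x := `|omega z.1 z.2 x|.
have mle (h k : T -> R) : measurable_fun setT h -> measurable_fun setT k ->
    measurable [set x | h x <= k x].
  move=> mh mk.
  have -> : [set x | h x <= k x] = setT `&` (fun x => h x - k x) @^-1` `]-oo, 0].
    by rewrite setTI; apply/seteqP; split => x /=; rewrite in_itv/= subr_le0.
  by apply: measurable_funB.
have mO : measurable [set x | Lup (fun i j => omega i j x) M.+1 N <= Lright (fun i j => omega i j x) M N.+1].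
  by apply: mle; [apply: (measurable_Lup (w := fun i j x => omega i j x))|
    apply: (measurable_Lup (w := fun i j x => omega j i x))] => i j; exact: measurable_funPT.
have mX : measurable [set x | Lup (weights X x) M.+1 N <= Lright (weights X x) M N.+1].
  by apply: mle; [apply: (measurable_Lup (w := fun i j x => weights X x i j))|
    apply: (measurable_Lup (w := fun i j x => weights X x j i))] => i j;
    exact: measurable_weights eX.
(* Off the negligible set where some weight is negative, the weights coincide with their absolute
   values, and so do the two events. *)
have PE : P [set x | Lup (fun i j => omega i j x) M.+1 N <= Lright (fun i j => omega i j x) M N.+1] =
    P [set x | Lup (weights X x) M.+1 N <= Lright (weights X x) M N.+1].
  apply: (probability_eq_off mO mX neg) => x nx.
  suff e : weights X x = (fun i j => omega i j x) by rewrite /mkset e.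
  apply/funext => i; apply/funext => j; rewrite /weights /X ger0_norm//= leNgt.
  by apply/negP => h; apply: nx; exists i => //; exists j.
rewrite PE; split; first exact: fin_num_measure.
exact: hlim eX.
Unshelve. all: by end_near.
Qed.
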